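(* Let $n\ge 3$ be a given positive integer. (I) The quantity $\max\{\gamma(K): K\in\mathcal{P}(n+1,n)\}$ equals $n^2-n+1$ if $n$ is odd and equals $n^2-n$ if $n$ is even. (II) Suppose $n$ is odd. (i) An $n$-dimensional minimal cone is exp-maximal if and only if the cone is indecomposable and the relation for its extreme vectors is balanced. (ii) Let $K$ be an $n$-dimensional exp-maximal minimal cone. A $K$-primitive matrix $A$ is exp-maximal if and only if the digraph $(\mathcal{E},\mathcal{P}(A,K))$ is isomorphic to $F_1$ (with $m=n+1$). (III) Suppose $n$ is even. (i) An $n$-dimensional minimal cone is exp-maximal if and only if either the cone is indecomposable and has a balanced relation for its extreme vectors, or it is the direct sum of a ray and an indecomposable minimal cone with a balanced relation for its extreme vectors. (ii) Let $K$ be an $n$-dimensional indecomposable exp-maximal minimal cone. A $K$-primitive matrix $A$ is exp-maximal if and only if, upon labelling suitably the extreme vectors of $K$ as $x_1,\ldots,x_{n+1}$, the digraph $(\mathcal{E},\mathcal{P}(A,K))$ is given by $F_1$ or by $F_2$ (with $m=n+1$ and $\Phi(x_i)$ in the role of vertex $x_i$), where in the latter case $x_1,x_2$ are required to appear on opposite sides of the relation for the extreme vectors of $K$. (iii) Let $K$ be an $n$-dimensional decomposable exp-maximal minimal cone. A $K$-primitive matrix $A$ is exp-maximal if and only if the digraph $(\mathcal{E},\mathcal{P}(A,K))$ is isomorphic to $F_2$ (with $m=n+1$).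
   Context: A proper cone $K$ in $\mathbb{R}^n$ is a closed convex cone that is pointed ($K\cap(-K)=\{0\}$) and has nonempty interior. A face of $K$ is a subcone $F\subseteq K$ such that $y\in F$ whenever $x\in F$ and $y,x-y\in K$. For $x\in K$, $\Phi(x)$ is the smallest face of $K$ containing $x$. A nonzero $x\in K$ is an extreme vector if $\Phi(x)=\{\lambda x:\lambda\ge0\}$, which is then called an extreme ray; nonzero extreme vectors are distinct if they are not multiples of each other. A polyhedral cone is a proper cone (in its linear span) with finitely many extreme rays; $\mathcal{P}(m,n)$ is the set of $n$-dimensional polyhedral cones with exactly $m$ extreme rays. An $n$-dimensional minimal cone is a member of $\mathcal{P}(n+1,n)$. The $n+1$ distinct extreme vectors of a minimal cone satisfy, up to scalar multiples, a unique nonzero linear relation; it is written as $\alpha_1u_1+\cdots+\alpha_pu_p=\beta_1v_1+\cdots+\beta_qv_q$ with all coefficients positive and $u_1,\ldots,u_p,v_1,\ldots,v_q$ pairwise distinct extreme vectors. The relation is balanced if $|p-q|\le 1$. A closed pointed cone is decomposable if it is the direct sum of two nonzero subcones, and indecomposable otherwise. $\pi(K)$ is the set of real matrices $A$ with $AK\subseteq K$. $A\in\pi(K)$ is $K$-primitive if $A^p(K\setminus\{0\})\subseteq\operatorname{int}K$ for some positive integer $p$; the least such $p$ is the exponent $\gamma(A)$. For polyhedral $K$, $\gamma(K)=\max\{\gamma(A):A\text{ is }K\text{-primitive}\}$. A $K$-primitive matrix $A$ is exp-maximal if $\gamma(A)=\gamma(K)$. A cone $K_0\in\mathcal{P}(m,n)$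 is exp-maximal if $\gamma(K_0)=\max\{\gamma(K):K\in\mathcal{P}(m,n)\}$ (so an $n$-dimensional minimal cone is exp-maximal if it attains the maximum over $\mathcal{P}(n+1,n)$). For $A\in\pi(K)$, $(\mathcal{E},\mathcal{P}(A,K))$ is the digraph whose vertex set $\mathcal{E}$ is the set of extreme rays of $K$, with an arc $(\Phi(x),\Phi(y))$ whenever $\Phi(y)\subseteq\Phi(Ax)$. $F_1$ is the digraph on vertices $x_1,\ldots,x_m$ with arcs $x_i\to x_{i+1}$ ($1\le i\le m-1$), $x_m\to x_1$ and $x_m\to x_2$. $F_2$ is $F_1$ together with the additional arc $x_1\to x_3$. *)

(* Defs.v *)
From HB Require Import structures.
From mathcomp Require Import all_boot all_order all_algebra.
From mathcomp Require Import all_classical all_reals all_analysis.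

Set Implicit Arguments.
Unset Strict Implicit.
Unset Printing Implicit Defensive.

Import Order.TTheory GRing.Theory Num.Theory.
Import numFieldNormedType.Exports.

Local Open Scope classical_set_scope.
Local Open Scope card_scope.
Local Open Scope ring_scope.

Section Cones.
Variables (R : realType) (n : nat).
Local Notation vec := 'cV[R]_n.
Implicit Types (K F G : set vec) (x y : vec) (A : 'M[R]_n) (V W : {vspace vec}).

Definition convex_cone K : Prop :=
  [/\ K 0,
      forall x y, K x -> K y -> K (x + y) &
      forall (a : R) x, 0 <= a -> K x -> K (a *: x)].

Definition pointed_cone K : Prop := forall x, K x -> K (- x) -> x = 0.

Definition is_span K V : Prop :=
  (forall x, K x -> x \in V) /\
  (forall W, (forall x, K x -> x \in W) -> (V <= W)%VS).

(* Cones are not required to be full-dimensional in the ambient space, since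
   the summands of a direct sum are not: "nonempty interior" is taken relative
   to the linear span, of dimension d.  When d = n the span is the whole space
   and this is the topological interior. *)
Definition proper_cone_of_dim (d : nat) K : Prop :=
  [/\ convex_cone K, closed K, pointed_cone K &
      exists V, [/\ is_span K V, \dim V = d &
        exists2 x, K x & \forall y \near x, y \in V -> K y]].

Definition face K F : Prop :=
  [/\ convex_cone F, F `<=` K &
      forall x y, F x -> K y -> K (x - y) -> F y].

Definition Phi K x : set vec := \bigcap_(F in [set F | face K F /\ F x]) F.

Definition ray x : set vec := [set y | exists2 l : R, 0 <= l & y = l *: x].

Definition extreme_vector K x : Prop := [/\ K x, x != 0 & Phi K x = ray x].

Definition extreme_rays K : set (set vec) :=
  [set F | exists2 x, extreme_vector K x & F = Phi K x].

Definition polyhedral_cone (m d : nat) K : Prop :=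
  proper_cone_of_dim d K /\ extreme_rays K #= `I_m.

Definition minimal_cone (d : nat) K : Prop := polyhedral_cone d.+1 d K.

Definition distinct_rays x y : Prop :=
  (forall l : R, x <> l *: y) /\ (forall l : R, y <> l *: x).

(* The pair of families (u, v) gives the relation
   alpha_1 u_1 + ... + alpha_p u_p = beta_1 v_1 + ... + beta_q v_q
   for the extreme vectors of K; 0 < p + q says that it is nonzero. *)
Definition extreme_relation K (p q : nat) (u : 'I_p -> vec) (v : 'I_q -> vec)
    : Prop :=
  [/\ (0 < p + q)%N,
      (forall i, extreme_vector K (u i)) /\ (forall j, extreme_vector K (v j)),
      [/\ forall i i', i != i' -> distinct_rays (u i) (u i'),
          forall j j', j != j' -> distinct_rays (v j) (v j') &
          forall i j, distinct_rays (u i) (v j)] &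
      exists (alpha : 'I_p -> R) (beta : 'I_q -> R),
        [/\ forall i, 0 < alpha i, forall j, 0 < beta j &
            \sum_i alpha i *: u i = \sum_j beta j *: v j]].

Definition balanced K : Prop :=
  exists (p q : nat) (u : 'I_p -> vec) (v : 'I_q -> vec),
    [/\ extreme_relation K u v, (p <= q.+1)%N & (q <= p.+1)%N].

(* Scaling an extreme vector only changes its (positive) coefficient, so x and
   y may be taken to be literally among the u_i and v_j. *)
Definition opposite_sides K x y : Prop :=
  exists (p q : nat) (u : 'I_p -> vec) (v : 'I_q -> vec),
    extreme_relation K u v /\
    exists i j, (x = u i /\ y = v j) \/ (y = u i /\ x = v j).

Definition direct_sum K K1 K2 : Prop :=
  [/\ convex_cone K1, convex_cone K2,
      K = [set x | exists x1 x2, [/\ K1 x1, K2 x2 & x = x1 + x2]] &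
      forall x1 x2 y1 y2, K1 x1 -> K2 x2 -> K1 y1 -> K2 y2 ->
        x1 + x2 = y1 + y2 -> x1 = y1 /\ x2 = y2].

Definition decomposable K : Prop :=
  exists K1 K2, [/\ K1 <> [set 0], K2 <> [set 0] & direct_sum K K1 K2].

Definition indecomposable K : Prop := ~ decomposable K.

Definition preserves K A : Prop := forall x, K x -> K (A *m x).

Definition positive_power K A (p : nat) : Prop :=
  forall x, K x -> x != 0 -> (K°) (A ^+ p *m x).

Definition primitive K A : Prop :=
  preserves K A /\ exists2 p : nat, (0 < p)%N & positive_power K A p.

Definition is_exponent K A (p : nat) : Prop :=
  [/\ primitive K A, (0 < p)%N, positive_power K A p &
      forall q : nat, (0 < q)%N -> positive_power K A q -> (p <= q)%N].

(* g = gamma(K) *)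
Definition is_cone_exponent K (g : nat) : Prop :=
  (exists A, is_exponent K A g) /\
  (forall A p, is_exponent K A p -> (p <= g)%N).

Definition exp_maximal_matrix K A : Prop :=
  exists2 g, is_exponent K A g & is_cone_exponent K g.

Definition ray_arc K A F G : Prop :=
  exists x y, [/\ extreme_vector K x, extreme_vector K y,
    F = Phi K x, G = Phi K y & Phi K y `<=` Phi K (A *m x)].

Definition extreme_labelling K (m : nat) (x : 'I_m -> vec) : Prop :=
  (forall i, extreme_vector K (x i)) /\
  set_bij [set: 'I_m] (extreme_rays K) (fun i => Phi K (x i)).

Definition digraph_given_by K A (m : nat) (x : 'I_m -> vec) (E : rel 'I_m)
    : Prop :=
  forall i j, ray_arc K A (Phi K (x i)) (Phi K (x j)) <-> E i j.

Definition digraph_isomorphic_to K A (m : nat) (E : rel 'I_m) : Prop :=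
  exists2 f : 'I_m -> set vec,
    set_bij [set: 'I_m] (extreme_rays K) f &
    forall i j, ray_arc K A (f i) (f j) <-> E i j.

End Cones.

(* M = max {gamma(K) : K in P(m, n)}; that every gamma(K) exists is part of
   the assertion. *)
Definition is_max_cone_exponent (R : realType) (m n M : nat) : Prop :=
  (exists2 K : set 'cV[R]_n, polyhedral_cone m n K & is_cone_exponent K M) /\
  (forall K : set 'cV[R]_n, polyhedral_cone m n K ->
     exists2 g : nat, is_cone_exponent K g & (g <= M)%N).

(* for K in P(m, n), K a subset of R^n *)
Definition exp_maximal_cone (R : realType) (m n : nat) (K : set 'cV[R]_n)
    : Prop :=
  exists2 M : nat, is_max_cone_exponent R m n M & is_cone_exponent K M.

(* The vertex x_i of F_1 and F_2 is the ordinal i - 1. *)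
Definition F1 (m : nat) : rel 'I_m := fun i j =>
  [|| j == i.+1 :> nat,
      (i == m.-1 :> nat) && (j == 0%N :> nat) |
      (i == m.-1 :> nat) && (j == 1%N :> nat)].

Definition F2 (m : nat) : rel 'I_m := fun i j =>
  F1 i j || (i == 0%N :> nat) && (j == 2%N :> nat).

(* Main.v *)
(* For a K-primitive A let N(i) be the set of extreme rays of the face generated
   by A x_i.  In a minimal cone with relation sum_i r_i x_i = 0 the face generated
   by a set S of extreme rays is S itself, unless S contains P = {r > 0} or
   Q = {r < 0}, and then it is the union of S, P and Q.  So the exponent is read
   off the iterates of a closure operator on sets of extreme rays.

   Along a circuit of length l the faces of A^(lk) x grow strictly until they are
   everything, so that they fill up in l(n-1) steps, and an exponent exceeding
   n+1 + (n-1)(n-2) forces all circuits to have length n or more.  This leaves the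
   digraphs F_1 and F_2 (and one that no primitive matrix has).  Comparing the
   coefficients of the x_j in sum_i r_i A x_i, a multiple of the relation, shows
   that the r_i alternate in sign around the circuit, except possibly at x_1 and
   x_2.  The slowest iterates are then those of x_1 or x_2: cyclic intervals
   gaining one element every n steps, until they contain P or Q.  Conversely the
   alternating signs leave room for a nonnegative matrix with the given digraph,
   and balance of the relation is what allows the signs to be alternated. *)

Require Import Defs.
From mathcomp Require Import all_boot boolp zify.

Set Implicit Arguments.
Unset Strict Implicit.
Unset Printing Implicit Defensive.

(** * Faces as closed sets of extreme rays *)

(** The vertices called [x_1], ..., [x_(n+1)] above are numbered 0, ..., n in the code.

    The threshold [n+1 + (n-1)(n-2)] is the time taken by the worst short circuit: two arcs lead
    into a circuit of length [n-1], which needs [n-1] turns to fill up.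

    The role of parity: along 2, 3, ..., n, 0 the sign changes [n-1] times, so 0 and 2 are on the
    same side of the relation for odd [n] and on opposite sides for even [n]. One step before time
    [n(n-1)] the interval grown from vertex 1 misses exactly 0 and 1, so everything hinges on the
    signs of these two. In F1 vertices 1 and 2 have opposite signs; hence 0 and 1 are opposite for
    odd [n] and equal for even [n]. As vertex 0 lags one step behind vertex 1, the exponents are
    [n(n-1)+1] and [n(n-1)]. In F2 vertex 0 lies on a circuit of length [n] too, so [n(n-1)] is
    never exceeded; the coefficient at 1 may vanish there, and this is where the decomposable cones
    come from.

    To pass from the topological definition to generators and a relation takes Minkowski's theorem
    in one direction and a description by half-spaces in the other. *)

Section FaceClosure.
Variables (T : finType) (P Q : {set T}).
Implicit Types S : {set T}.

Definition face_closure S : {set T} :=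
  S :|: (if Q \subset S then P else set0)
    :|: (if P \subset S then Q else set0).

Lemma face_closureE S : face_closure S =
  if (P \subset S) || (Q \subset S) then S :|: P :|: Q else S.
Proof.
rewrite /face_closure; case: ifP => [/subsetP QS|_]; case: ifP => [/subsetP PS|_] //=;
  apply/setP => i; rewrite !inE ?orbF //.
- case: (boolP (i \in Q)) => [/QS ->|]; rewrite ?orbT ?orbF //.
- by case: (boolP (i \in P)) => [/PS ->|]; rewrite ?orbT ?orbF.
Qed.

Lemma face_closure_sub S : S \subset face_closure S.
Proof. by rewrite face_closureE; case: ifP => // _; rewrite -setUA subsetUl. Qed.

Lemma face_closure_mono S S' : S \subset S' -> face_closure S \subset face_closure S'.
Proof.
move=> SS'; rewrite !face_closureE; case: ifP => [/orP H|_].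
  suff -> : (P \subset S') || (Q \subset S') by rewrite !setSU.
  by apply/orP; case: H => H; [left|right]; apply: subset_trans SS'.
by apply: subset_trans SS' _; rewrite -face_closureE face_closure_sub.
Qed.

Lemma face_closure_id S p q : p \in P -> p \notin S -> q \in Q -> q \notin S ->
  face_closure S = S.
Proof.
move=> pP pS qQ qS; rewrite face_closureE; case: ifP => // /orP[]/subsetP.
  by move=> /(_ p pP); rewrite (negPf pS).
by move=> /(_ q qQ); rewrite (negPf qS).
Qed.

Lemma face_closure_small S : #|S| < #|P| -> #|S| < #|Q| -> face_closure S = S.
Proof.
move=> SP SQ; rewrite face_closureE; case: ifP => // /orP[]/subset_leq_card.
  by rewrite leqNgt SP.
by rewrite leqNgt SQ.
Qed.

Lemma face_closure_idem S : face_closure (face_closure S) = face_closure S.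
Proof.
have := face_closureE S; case: ifP => E ->; last by rewrite face_closureE E.
rewrite face_closureE; by case: ifP => // _; apply/setP => i; rewrite !inE;
  do 3!case: (i \in _).
Qed.

End FaceClosure.

(** * Iterating a digraph under the face closure *)

Section FaceDynamics.
Variables (T : finType) (P Q : {set T}) (N : T -> {set T}).
Hypotheses (P1 : 1 < #|P|) (Q1 : 1 < #|Q|).
Implicit Types S : {set T}.

Definition face_step S : {set T} := face_closure P Q (\bigcup_(i in S) N i).

Definition face_iter (k : nat) (i : T) : {set T} :=
  iter k face_step (set1 i).

Lemma face_step_mono S S' : S \subset S' -> face_step S \subset face_step S'.
Proof.
move=> SS'; apply: face_closure_mono; apply/bigcupsP => i iS.
by apply: bigcup_sup; exact: (subsetP SS').
Qed.

Lemma iter_face_step_mono k S S' : S \subset S' ->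
  iter k face_step S \subset iter k face_step S'.
Proof. by move=> SS'; elim: k => //= k; exact: face_step_mono. Qed.

Lemma face_iterD a b i j : i \in face_iter a j ->
  face_iter b i \subset face_iter (a + b) j.
Proof.
move=> ij; rewrite /face_iter addnC iterD; apply: iter_face_step_mono.
by rewrite sub1set.
Qed.

Lemma face_iter_addn a b i :
  face_iter (a + b) i = iter a face_step (face_iter b i).
Proof. exact: iterD. Qed.

Lemma face_iterS k i : face_iter k.+1 i = face_step (face_iter k i).
Proof. by []. Qed.

Lemma mem_face_step S i j : i \in S -> j \in N i -> j \in face_step S.
Proof.
move=> iS jN; apply: (subsetP (face_closure_sub _ _ _)).
by apply/bigcupP; exists i.
Qed.

Lemma path_face_iter i (p : seq T) : path (fun i j => j \in N i) i p ->
  last i p \in face_iter (size p) i.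
Proof.
elim/last_ind: p => [|p j IH]; first by rewrite set11.
rewrite rcons_path last_rcons size_rcons => /andP[/IH ip jN].
by rewrite face_iterS; exact: mem_face_step ip jN.
Qed.

Hypothesis reach_full : forall i, exists k, face_iter k i = setT.

Lemma face_step0 : face_step set0 = set0.
Proof.
rewrite /face_step big_set0 face_closure_small // cards0;
  by [rewrite ltnW|].
Qed.

Lemma successor_neq0 i : N i != set0.
Proof.
apply/eqP => Ni0; have [[|k] fk] := reach_full i.
  have : #|face_iter 0 i| = #|T| by rewrite fk cardsT.
  by rewrite cards1 => T1; have := max_card (mem P); rewrite -T1 leqNgt P1.
move: fk; rewrite /face_iter iterSr {2}/face_step big_set1 Ni0.
have -> : face_closure P Q set0 = set0.
  by rewrite -{2}face_step0 /face_step big_set0.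
have -> : iter k face_step set0 = set0.
  by elim: k => //= k ->; exact: face_step0.
by move=> /setP/(_ i); rewrite !inE.
Qed.

(** The full set is itself a value of [face_step], so monotonicity makes its image full. *)
Lemma face_step_setT : face_step setT = setT.
Proof.
have /card_gt0P[i _] : 0 < #|P| by exact: ltnW.
have [[|k] fk] := reach_full i.
  have : #|face_iter 0 i| = #|T| by rewrite fk cardsT.
  by rewrite cards1 => T1; have := max_card (mem P); rewrite -T1 leqNgt P1.
apply/eqP; rewrite -subTset -{1}fk face_iterS.
by apply: face_step_mono; exact: subsetT.
Qed.

Lemma face_iter_full a b i : face_iter a i = setT -> a <= b ->
  face_iter b i = setT.
Proof.
move=> fa /subnK <-; rewrite /face_iter iterD -/(face_iter a i) fa.
by elim: (b - a) => //= k ->; exact: face_step_setT.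
Qed.

(* The dimension of the face spanned by a closed set of extreme rays. *)
Let rank S := #|S| - ((P :|: Q) \subset S).

(** The correction by one in [rank] could only hurt when [S'] contains [P :|: Q] and [S] does not. A
    closed such [S] misses an element of [P] and one of [Q], so it gains at least two elements. *)
Let rank_lt S S' : [disjoint P & Q] -> face_closure P Q S = S -> S \proper S' ->
  rank S < rank S'.
Proof.
move=> dPQ clS SS'; have sS := proper_card SS'; rewrite /rank.
case: (boolP (_ \subset S)) => [PQ|nPQ].
  rewrite (subset_trans PQ (proper_sub SS')).
  have := subset_leq_card (subset_trans (subsetUl P Q) PQ); lia.
have [|p pP pn] := subsetPn (_ : ~~ (P \subset S)).
  apply: contra nPQ => PS; rewrite subUset PS /=.
  by rewrite -clS face_closureE PS /= subsetUr.
have [|q qP qn] := subsetPn (_ : ~~ (Q \subset S)).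
  apply: contra nPQ => QS; rewrite subUset QS andbT.
  by rewrite -clS face_closureE QS orbT /= setUAC subsetUr.
case: (boolP (_ \subset S')) => [PQ|nPQ']; last by rewrite !subn0.
have pq : p != q.
  by apply/eqP => pq; move: dPQ => /pred0P/(_ p); rewrite /= pP pq qP.
have /subset_leq_card : q |: (p |: S) \subset S'.
  have [pS' qS'] : p \in S' /\ q \in S'.
    by split; apply: (subsetP PQ); rewrite !inE ?pP ?qP ?orbT.
  by rewrite !subUset !sub1set pS' qS' proper_sub.
by rewrite !cardsU1 !inE eq_sym negb_or pq pn qn /= subn0; clear; lia.
Qed.

(** Every [l] steps the face of [i] grows or has become everything. Its rank starts at 1 and the
    full set has rank [#|T| - 1], which leaves room for [#|T| - 2] increases. *)
Lemma closed_walk_full l i : [disjoint P & Q] -> 0 < l -> i \in face_iter l i ->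
  face_iter (l * (#|T| - 2)) i = setT.
Proof.
move=> dPQ l0 il.
have closed k j : face_closure P Q (face_iter k j) = face_iter k j.
  case: k => [|k]; last exact: face_closure_idem.
  by rewrite face_closure_small // cards1.
have mono k : face_iter (l * k) i \subset face_iter (l * k.+1) i.
  by rewrite mulnS; apply: face_iterD.
(* Two equal consecutive terms make the sequence constant, and by [reach_full] the constant is the
   full set. *)
have stop k : face_iter (l * k) i = face_iter (l * k.+1) i ->
    face_iter (l * k) i = setT.
  move=> e; have st t : face_iter (l * (t + k)) i = face_iter (l * k) i.
    elim: t => // t IH.
    by rewrite addSn mulnS face_iter_addn IH -face_iter_addn -mulnS -e.
  have [p fp] := reach_full i; rewrite -(st p); apply: face_iter_full fp _.
  by rewrite mulnDr; apply: (@leq_trans (l * p)); rewrite ?leq_addr ?leq_pmull.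
have rk k : face_iter (l * k) i = setT \/ k < rank (face_iter (l * k) i).
  elim: k => [|k [fk|IH]].
  - right; rewrite muln0 /rank cards1; case: (boolP (_ \subset _)) => //.
    by move=> /(subset_trans (subsetUl P Q))/subset_leq_card;
      rewrite cards1 leqNgt P1.
  - by left; apply: face_iter_full fk _; rewrite leq_mul.
  have [e|ne] := eqVneq (face_iter (l * k) i) (face_iter (l * k.+1) i).
    by left; rewrite -e; exact: stop.
  right; apply: leq_ltn_trans IH _; apply: rank_lt => //.
  by rewrite properEneq ne mono.
have [//|] := rk (#|T| - 2) => H; apply/eqP/negPn/negP => nT.
have: rank (face_iter (l * (#|T| - 2)) i) < rank setT.
  by apply: rank_lt => //; rewrite properEneq nT subsetT.
by move: H; rewrite {3}/rank subsetT cardsT; lia.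
Qed.

End FaceDynamics.

(** * Digraphs without short circuits *)

Lemma nonuniq_split (T : eqType) (c : seq T) : ~~ uniq c ->
  exists a c0 c1 c2, c = c0 ++ a :: c1 ++ a :: c2.
Proof.
elim: c => //= a c IH; rewrite negb_and negbK.
case: (boolP (a \in c)) => [ac _|_ /= /IH [b [c0 [c1 [c2 ->]]]]].
  by case/splitPr: ac => c1 c2; exists a, [::], c1, c2.
by exists b, (a :: c0), c1, c2.
Qed.

(** Here [t] is the length of a tail leading into a circuit of length [s]. Equality holds for
    [s = n - 1] and [t = 2]. *)
Lemma lollipop_bound t s n : 2 < n -> t + s <= n.+1 -> s < n ->
  t + s * (n.+1 - 2) <= n.+1 + (n - 1) * (n - 2).
Proof.
move=> n3 ts sn; have : s * (n - 2) <= (n - 1) * (n - 2) by rewrite leq_mul2r; lia.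
by rewrite (_ : n.+1 - 2 = (n - 2).+1) ?mulnS; lia.
Qed.

Lemma modn_shiftK i j n : 0 < n -> (i + (n - j %% n)) %% n + j = i %[mod n].
Proof.
move=> n0; rewrite modnDml -modnDmr -addnA subnK ?modnDr //.
by rewrite ltnW // ltn_pmod.
Qed.

Section SlowDigraphs.
Variables (T : finType) (n : nat) (P Q : {set T}) (N : T -> {set T}).
Hypotheses (n3 : 3 <= n) (cardT : #|T| = n.+1).
Hypotheses (P1 : 1 < #|P|) (Q1 : 1 < #|Q|) (dPQ : [disjoint P & Q]).
Hypothesis reach_full : forall i, exists k, face_iter P Q N k i = setT.
Variable x : T.
Hypothesis slow : face_iter P Q N (n.+1 + (n - 1) * (n - 2)) x != setT.

Let e : rel T := fun i j => j \in N i.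

(* A circuit of length [l < n] is reached from [x] in at most [n.+1 - l] steps, and
   then takes [l * (n - 1)] more to fill up. *)
Lemma slow_cycle_size (c : seq T) : cycle e c -> has (connect e x) c -> n <= size c.
Proof.
have [k] := ubnP (size c); elim: k => // k IH in c *; rewrite ltnS => ck cc xc.
have [uc|/nonuniq_split[a [c0 [c1 [c2 ec]]]]] := boolP (uniq c); last first.
  (* A repeated vertex [a] cuts off the shorter closed walk [a :: c1], to which induction applies.
     The rest [a :: c3] serves to show that [a] can be reached from [x]. *)
  have : cycle e (rot (size c0) c) by rewrite rot_cycle.
  have : has (connect e x) (rot (size c0) c) by rewrite has_rot.
  rewrite ec rot_size_cat -!cat_cons -catA cat_cons /= has_cat /= orbA => hx.
  set c3 := c2 ++ c0 in hx *.
  rewrite rcons_cat cat_path /= rcons_path => /and3P[pc1 ea1 pc3].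
  have cy1 : cycle e (a :: c1) by rewrite /= rcons_path pc1.
  have cy3 : cycle e (a :: c3) by rewrite /= rcons_path.
  have xa : connect e x a.
    case/orP: hx => [/orP[//|/hasP[z zc xz]]|/orP[//|/hasP[z zc xz]]].
      apply: connect_trans xz _; have := connect_cycle cy1; apply; rewrite ?mem_head //.
      by rewrite inE zc orbT.
    apply: connect_trans xz _; have := connect_cycle cy3; apply.
    - by rewrite inE zc orbT.
    - by rewrite mem_head.
  apply: (@leq_trans (size (a :: c1))).
    apply: IH => //=; last by rewrite xa.
    by apply: leq_trans ck; rewrite ec !size_cat /= size_cat /=; clear; lia.
  by rewrite !size_cat /= size_cat /=; clear; lia.
rewrite leqNgt; apply/negP => cn.
case/hasP: xc => y yc /connectP[p0 p0P y0].
case: (shortenP p0P) y0 => p pP up _ yE.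
have hp : has (mem c) (x :: p) by apply/hasP; exists y => //; rewrite yE mem_last.
(* The time at which a simple path from [x] first meets [c]. The vertices before it are distinct and
   outside [c], whence [t + size c <= n.+1]. *)
set t := find (mem c) (x :: p).
set z := nth x (x :: p) t.
have zc : z \in c := nth_find x hp.
have tp : t < size (x :: p) by rewrite -has_find.
have tle : t + size c <= n.+1.
  have tk : size (take t (x :: p)) = t by rewrite size_takel // ltnW.
  rewrite -cardT -tk -size_cat.
  have /card_uniqP <- : uniq (take t (x :: p) ++ c); last exact: max_card.
  rewrite cat_uniq take_uniq // uc andbT; apply/hasPn => v vc.
  apply/negP => vt; have := before_find x (_ : index v (x :: p) < t).
  have iv : index v (x :: p) < t.
    have := vt; rewrite -index_mem tk; congr (_ < _).
    by rewrite -[in RHS](cat_take_drop t (x :: p)) index_cat vt.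
  by move=> /(_ iv); rewrite nth_index ?(mem_take vt) // [mem c v]vc.
have zt : z \in face_iter P Q N t x.
  have := path_face_iter P Q (take_path t pP); rewrite size_takel //.
  rewrite (last_nth x) size_takel //; suff -> : z = nth x (x :: take t p) t by [].
  by rewrite /z; case: (t) => //= t'; rewrite nth_take.
have zl : z \in face_iter P Q N (size c) z.
  have [i c' ec'] := rot_to zc.
  have : cycle e (z :: c') by rewrite -ec' rot_cycle.
  move=> /= /(path_face_iter P Q); rewrite last_rcons size_rcons.
  by rewrite -(size_rot i c) ec'.
have c0 : 0 < size c by case: (c) zc.
have full := closed_walk_full P1 Q1 reach_full dPQ c0 zl.
move/negP: slow; apply; apply/eqP.
apply: (face_iter_full P1 reach_full (a := t + size c * (#|T| - 2))).
  by apply/eqP; rewrite -subTset -full face_iterD.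
by rewrite cardT; exact: lollipop_bound.
Qed.

Let g i := odflt i [pick j in N i].

Let gP i : e i (g i).
Proof.
rewrite /g /e; case: pickP => //= Ni; move: (successor_neq0 P1 Q1 reach_full i).
by case/set0Pn => j; rewrite Ni.
Qed.

(** A circuit is a periodic sequence over all naturals, so that rotating it is a shift of the index.
    Reachability from [x] is included because [slow_cycle_size] asks for it. *)
Let circuit l (f : nat -> T) := [/\ forall k, e (f k) (f k.+1),
  forall k, f (k + l) = f k,
  forall i j, i < l -> j < l -> f i = f j -> i = j &
  forall k, connect e x (f k)].

Let periodic_mod l (f : nat -> T) k : (forall k, f (k + l) = f k) -> f k = f (k %% l).
Proof.
move=> fp; rewrite {1}(divn_eq k l); elim: (k %/ l) => // q IH.
by rewrite mulSn -addnA addnC fp.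
Qed.

Let circuit_shift l f t : 0 < l -> circuit l f -> circuit l (fun k => f (k + t)).
Proof.
move=> l0 [fe fp fi fx]; split=> [k|k|i j ni nj|k] //; first by rewrite addnAC fp.
rewrite (periodic_mod (i + t) fp) (periodic_mod (j + t) fp) => /fi.
by rewrite !ltn_pmod // => /(_ isT isT)/eqP; rewrite eqn_modDr !modn_small // => /eqP.
Qed.

Let path_circuit f j k : (forall k, e (f k) (f k.+1)) ->
  path e (f j) [seq f i | i <- iota j.+1 k] /\
  last (f j) [seq f i | i <- iota j.+1 k] = f (j + k).
Proof.
move=> fe; elim: k j => [|k IH] j /=; first by rewrite addn0.
by rewrite fe /=; have [-> ->] := IH j.+1; rewrite addSnnS.
Qed.

(** The arc closes a circuit on the [k.+1] vertices [f j], ..., [f (j + k)]. In [detour] it passes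
    through one more vertex [w]. *)
Let chord f j k : (forall k, e (f k) (f k.+1)) -> connect e x (f j) ->
  e (f (j + k)) (f j) -> n <= k.+1.
Proof.
move=> fe xj ekj; have [pf lf] := path_circuit j k fe.
have := @slow_cycle_size (f j :: [seq f i | i <- iota j.+1 k]).
rewrite /= size_map size_iota rcons_path pf lf ekj xj /=; exact.
Qed.

Let detour f w j k : (forall k, e (f k) (f k.+1)) -> connect e x (f j) ->
  e (f (j + k)) w -> e w (f j) -> n <= k.+2.
Proof.
move=> fe xj ekj wj; have [pf lf] := path_circuit j k fe.
have := @slow_cycle_size (w :: f j :: [seq f i | i <- iota j.+1 k]).
by rewrite /= size_map size_iota rcons_path pf lf ekj xj wj orbT /=; exact.
Qed.

(** Singletons are closed, so the iterates of [f 0] would remain singletons forever. *)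
Let singletons_not_full f : (forall k, N (f k) = [set f k.+1]) -> False.
Proof.
move=> Nf; have H k : face_iter P Q N k (f 0) = [set f k].
  elim: k => // k IH; rewrite face_iterS IH /face_step big_set1 Nf.
  by rewrite face_closure_small // cards1.
have [k fk] := reach_full (f 0).
have : #|face_iter P Q N k (f 0)| = #|T| by rewrite fk cardsT.
by rewrite H cards1 cardT; lia.
Qed.

Let image_circuit l f : circuit l f -> #|[set f (val i) | i : 'I_l]| = l.
Proof.
move=> [_ _ fi _]; rewrite card_imset ?card_ord // => i j /fi.
by rewrite !ltn_ord => /(_ isT isT)/val_inj.
Qed.

(** Following chosen successors gives a simple circuit of length [n] or [n.+1]. In the second case
    it passes through all vertices, and some vertex has a further arc. That arc can only skip one
    vertex, and using it shortens the circuit to length [n]. *)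
Let exists_circuit : exists f, circuit n f.
Proof.
pose h k := iter k g x.
have he k : e (h k) (h k.+1) by exact: gP.
have hx k : connect e x (h k).
  by elim: k => // k IH; apply: connect_trans IH (connect1 (he k)).
have [i [l0 [l00 hl0]]] : exists i l, 0 < l /\ h (i + l) = h i.
  have : ~~ uniq [seq h k | k <- iota 0 n.+2].
    apply/negP => /card_uniqP; rewrite size_map size_iota => H.
    by have := max_card (mem [seq h k | k <- iota 0 n.+2]); rewrite H cardT ltnn.
  move=> /(uniqPn x) [i [j [ij]]]; rewrite size_map size_iota => jn.
  rewrite !(nth_map 0) ?size_iota ?(ltn_trans ij) // !nth_iota // ?(ltn_trans ij) //.
  by move=> hij; exists i, (j - i); rewrite subn_gt0 ij subnKC // ltnW.
pose f k := h (i + k).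
have fg k t : f (k + t) = iter k g (f t).
  by rewrite /f addnCA /h iterD.
have exl : exists l, (0 < l) && (f l == f 0).
  by exists l0; rewrite l00 /f hl0 addn0 eqxx.
case: (ex_minnP exl) => l /andP[l1 /eqP fl] minl.
have fe k : e (f k) (f k.+1) by rewrite /f addnS.
have fp k : f (k + l) = f k by rewrite fg fl -fg addn0.
have fi0 a b : a < b -> b < l -> f a <> f b.
  move=> ab bl fab; suff : l <= l - b + a by clear -ab bl; lia.
  apply: minl; rewrite fg fab -fg (subnK (ltnW bl)) fl eqxx andbT.
  by rewrite addn_gt0 subn_gt0 bl.
have cf : circuit l f.
  split=> // [i1 i2 il1 il2 fab|k']; last exact: hx.
  by case: (ltngtP i1 i2) => // ab; [case: (fi0 i1 i2)|case: (fi0 i2 i1)].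
have nl : n <= l.
  have := @chord f 0 l.-1 fe (hx _); rewrite add0n prednK //; apply.
  by rewrite -fl -{2}(prednK l1).
have ln : l <= n.+1.
  by rewrite -cardT -(image_circuit cf); exact: max_card.
have [en|ln'] := eqVneq l n; first by exists f; rewrite -en.
have {ln' nl ln} eln : l = n.+1 by lia.
have [Nf|] := pselect (forall k, N (f k) = [set f k.+1]).
  by case: (singletons_not_full Nf).
move=> /existsNP [k Nk].
have [z kz zk] : exists2 z, e (f k) z & z <> f k.+1.
  apply: contrapT => H; apply: Nk; apply/setP => z; rewrite inE.
  apply/idP/eqP => [kz|->]; last exact: fe.
  by apply: contrapT => zk; apply: H; exists z.
have cf' := circuit_shift k.+1 l1 cf.
have [t tl zt] : exists2 t, t < l & z = f (t + k.+1).
  have /eqP im : [set f (val i + k.+1) | i : 'I_l] == setT.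
    by rewrite eqEcard subsetT (image_circuit cf') cardsT cardT eln /=.
  have : z \in [set f (val i + k.+1) | i : 'I_l] by rewrite im inE.
  by case/imsetP => t _ ->; exists (val t) => //; exact: ltn_ord.
have t0 : t != 0 by apply/eqP => t0; apply: zk; rewrite zt t0.
have kn : f (n + k.+1) = f k by rewrite -(fp k) eln; congr f; lia.
(* The arc from [f k] to [f (t + k.+1)] closes a circuit of length [n - t + 1], so [t <= 1]. *)
have t1 : t = 1.
  have := @chord f (t + k.+1) (n - t) fe (hx _).
  have -> : t + k.+1 + (n - t) = n + k.+1 by lia.
  rewrite kn -zt => /(_ kz); lia.
have n0 : 0 < n by lia.
(* The circuit runs from [f k.+2] to [f (n + k.+1) = f k] and returns by the new arc, leaving out
   [f k.+1]. *)
exists (fun q => f (q %% n + k.+2)); split.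
- move=> q; have [q1|q1] := eqVneq (q %% n) n.-1.
    have -> : q.+1 %% n = 0 by rewrite -addn1 -modnDml q1 addn1 prednK // modnn.
    rewrite q1; have -> : n.-1 + k.+2 = n + k.+1 by lia.
    by rewrite kn; move: kz; rewrite zt t1 add0n.
  have -> : q.+1 %% n = (q %% n).+1.
    by rewrite -addn1 -modnDml addn1 modn_small // -ltn_predRL ltn_neqAle q1
      -ltnS prednK // ltn_pmod.
  exact: fe.
- by move=> q; rewrite modnDr.
- move=> a b an bn; rewrite !modn_small // => fab.
  have [_ _ fi' _] := circuit_shift k.+2 l1 cf.
  by apply: fi' fab; rewrite eln ltnW.
- by move=> q; exact: hx.
Qed.

Let off_circuit f : circuit n f -> exists2 w, forall k, f k <> w &
  forall v, v = w \/ exists2 k, k < n & v = f k.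
Proof.
move=> cf; have [fe fp fi fx] := cf; have n0 : 0 < n by exact: ltn_trans n3.
have /eqP/cards1P[w Ew] : #|~: [set f (val i) | i : 'I_n]| = 1.
  have := cardsC [set f (val i) | i : 'I_n].
  by rewrite (image_circuit cf) cardT -addn1 => /addnI.
exists w => [k fk|v].
  have : w \in ~: [set f (val i) | i : 'I_n] by rewrite Ew set11.
  rewrite inE => /negP; apply; apply/imsetP.
  by exists (Ordinal (ltn_pmod k n0)) => //; rewrite -fk (periodic_mod k fp).
have [vw|vw] := boolP (v \in ~: [set f (val i) | i : 'I_n]).
  by left; move: vw; rewrite Ew => /set1P.
right; move: vw; rewrite inE negbK => /imsetP[k _ ->].
by exists (val k) => //; exact: ltn_ord.
Qed.

(** Any other arc between two vertices of the circuit would close a circuit shorter than [n]; [r] is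
    the distance along the circuit from [f j] to [f i]. *)
Let arc_circuit f i j : circuit n f -> e (f i) (f j) -> f j = f i.+1.
Proof.
move=> cf; have [fe fp fi fx] := cf; have n0 : 0 < n by exact: ltn_trans n3.
move=> fij; set r := (i + (n - j %% n)) %% n.
have rj : r + j = i %[mod n] by exact: modn_shiftK.
have rjE : f (r + j) = f i by rewrite (periodic_mod _ fp) rj -periodic_mod.
have := (@chord (fun k => f (k + j)) 0 r (fun k => fe (k + j)) (fx _)).
rewrite add0n rjE => /(_ fij) nr.
have rn : r.+1 = n by apply/eqP; rewrite eqn_leq nr ltn_pmod.
rewrite -[LHS]fp addnC -{1}rn addSn (periodic_mod _ fp) [RHS](periodic_mod _ fp).
by rewrite -addn1 -[i.+1]addn1 -(modnDml (r + j)) rj modnDml.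
Qed.

(** In F1 the vertices 1, ..., n form a circuit of length [n] by the arc from n to 1, while 0 is a
    detour from n to 1. So [w] is to play the role of 0. *)
Let label (f : nat -> T) (w : T) (i : 'I_n.+1) : T :=
  if val i is k.+1 then f k else w.

Hypothesis compatible : face_closure P Q (\bigcup_(i in P) N i) =
  face_closure P Q (\bigcup_(i in Q) N i).

Let target := exists2 s : 'I_n.+1 -> T, injective s &
  (forall i j, (s j \in N (s i)) = F1 i j) \/
  (forall i j, (s j \in N (s i)) = F2 i j).

Let lasso f w := [/\ circuit n f, forall k, f k <> w,
  forall v, v = w \/ exists2 k, k < n & v = f k, e (f n.-1) w & w \notin N w].

Let n0 : 0 < n. Proof. exact: ltn_trans n3. Qed.

Let label_inj f w : lasso f w -> injective (label f w).
Proof.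
move=> [[_ _ fi _] fw _ _ _] [[|i] i1] [[|j] j1] /=; rewrite /label /= => E;
  apply/val_inj => //=.
- by case: (fw j).
- by case: (fw i).
- by rewrite (fi i j).
Qed.

Let mem_circuit f w k j : lasso f w -> k < n -> j < n ->
  (f j \in N (f k)) = (j == k.+1) || (k == n.-1) && (j == 0).
Proof.
move=> [cf _ _ _ _] kn jn; have [fe fp fi fx] := cf.
apply/idP/orP => [/(arc_circuit cf) E|[/eqP->|/andP[/eqP-> /eqP->]]]; last 2 first.
- exact: fe.
- by have := fe n.-1; rewrite prednK // -[n]add0n fp.
have [k1|k1] := ltnP k.+1 n; first by left; apply/eqP; exact: fi.
have kE : k = n.-1 by apply/eqP; rewrite -eqSS prednK // eqn_leq kn k1.
right; rewrite kE eqxx; apply/eqP; apply: fi => //.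
by rewrite E kE prednK // -[n]add0n fp.
Qed.

(** An arc from [w] to [f j] closes a circuit [f j], ..., [f n.-1], [w] of length [n - j + 1], so
    [j <= 1]. *)
Let mem_exit f w z : lasso f w -> z \in N w -> z = f 0 \/ z = f 1.
Proof.
move=> [[fe fp fi fx] fw Tw wl ww] zw.
have [zE|[j jn zE]] := Tw z; first by rewrite zE (negPf ww) in zw.
have jn1 : j <= n.-1 by rewrite -ltnS prednK.
have := @detour f w j (n.-1 - j) fe (fx _); rewrite (subnKC jn1) -zE => /(_ wl zw) jb.
have : j <= 1 by clear -jb jn n3; lia.
by case: j {jb jn1} jn zE => [|[|]] // _ ->; [left|right].
Qed.

(** A second entry at [f i] closes a circuit of length [i + 2] through [f 0]. In [exit1_entry] the
    circuit goes through [f 1] and has length [i + 1], unless [i = 0]. *)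
Let exit0_entry f w i : lasso f w -> f 0 \in N w -> i < n.-1 -> e (f i) w -> i = n.-2.
Proof.
move=> [[fe fp fi fx] fw Tw wl ww] zw i1 iw.
have := @detour f w 0 i fe (fx _) iw zw; clear -i1; lia.
Qed.

Let exit1_entry f w i : lasso f w -> f 1 \in N w -> i < n.-1 -> e (f i) w -> i = 0.
Proof.
move=> [[fe fp fi fx] fw Tw wl ww] zw i1 iw; case: i i1 iw => // i i1 iw.
have := @detour f w 1 i fe (fx _) iw zw; clear -i1; lia.
Qed.

(* The third digraph whose shortest circuits have length [n]: [w] and [f 0] have
   the same arcs in and out.  It is not the digraph of a primitive matrix. *)
Let twins_not_full f w : lasso f w -> N w = [set f 1] ->
  (forall k, k < n -> (w \in N (f k)) = (k == n.-1)) -> False.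
Proof.
move=> lf Nw Nfw; have [cf fw Tw wl ww] := lf; have [fe fp fi fx] := cf.
have f01 : f 0 <> f 1 by move=> /fi; rewrite n0 (ltn_trans _ n3) // => /(_ isT isT).
have Nf k : N (f k) = if k %% n == n.-1 then [set w; f 0] else [set f k.+1].
  rewrite (periodic_mod k fp) (periodic_mod k.+1 fp).
  have kn : k %% n < n by rewrite ltn_pmod.
  apply/setP => z; have [->|[j jn ->]] := Tw z.
    rewrite Nfw //; case: ifP => _; rewrite !inE ?eqxx //.
    by apply/esym/eqP => H; case: (fw (k.+1 %% n)).
  rewrite (mem_circuit lf) //; case: ifP => kE.
    rewrite (eqP kE) prednK // !inE /= (ltn_eqF jn) /=.
    rewrite (introF eqP (fw j)) /=; apply/eqP/eqP => [-> //|]; exact: fi.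
  rewrite inE /= orbF.
  have -> : k.+1 %% n = (k %% n).+1.
    rewrite -addn1 -modnDml addn1 modn_small // ltn_neqAle kn andbT.
    by rewrite -[n in _ != n]prednK // eqSS kE.
  apply/eqP/eqP => [-> //|]; apply: fi => //.
  by rewrite ltn_neqAle kn andbT -[n in _ != n]prednK // eqSS kE.
(* If one side of the relation is the pair of twins, its image is the single vertex [f 1]. By
   [compatible] the other side has the same image, but a vertex outside the pair does not lead to
   [f 1]. *)
have twin (A B : {set T}) : 1 < #|A| -> 1 < #|B| -> [disjoint A & B] ->
    face_closure A B (\bigcup_(i in A) N i) = face_closure A B (\bigcup_(i in B) N i) ->
    A \subset [set w; f 0] -> False.
  move=> A1 B1 dAB cAB AS.
  have eA : A = [set w; f 0].
    apply/eqP; rewrite eqEcard AS cards2.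
    by apply: leq_trans A1; case: (_ != _).
  have NA : \bigcup_(i in A) N i = [set f 1].
    rewrite eA bigcup_setU !big_set1 Nw Nf mod0n.
    by case: n n3 => [|[|m]] //= _; rewrite setUid.
  move: cAB; rewrite NA face_closure_small ?cards1 // => cAB.
  have /card_gt0P[q qB] : 0 < #|B| by exact: ltnW.
  have qA : q \notin A.
    by apply/negP => qA; move: dAB => /pred0P/(_ q); rewrite /= qA qB.
  have [qw|[k kn qk]] := Tw q; first by rewrite eA qw !inE eqxx in qA.
  have : f k.+1 \in [set f 1].
    rewrite cAB; apply: (subsetP (face_closure_sub _ _ _)).
    by apply/bigcupP; exists q => //; rewrite qk; exact: fe.
  rewrite inE => /eqP.
  have [k1|k1] := ltnP k.+1 n.
    move=> /fi; rewrite k1 (ltn_trans _ n3) // => /(_ isT isT) [k0].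
    by rewrite eA qk k0 !inE eqxx orbT in qA.
  have -> : k.+1 = n by apply/eqP; rewrite eqn_leq k1 kn.
  by rewrite -[n]add0n fp.
have cl2 : face_closure P Q [set w; f 0] = [set w; f 0].
  rewrite face_closureE; case: ifP => // /orP[PS|QS]; exfalso.
    exact: (twin P Q).
  apply: (twin Q P) => //; first by rewrite disjoint_sym.
  have symc A : face_closure Q P A = face_closure P Q A.
    by rewrite !face_closureE orbC (setUAC A).
  by rewrite !symc.
(* Since the pair of twins is closed, the iterates of [f 1] go round as singletons, apart from being
   that pair once per turn. *)
have H k : (exists2 j, f j <> f 0 & face_iter P Q N k (f 1) = [set f j]) \/
    face_iter P Q N k (f 1) = [set w; f 0].
  elim: k => [|k [[j j0 E]|E]].
  - by left; exists 1 => //; exact: nesym.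
  - rewrite face_iterS E /face_step big_set1 Nf.
    case: ifP => jE; first by right.
    left; exists j.+1; last by rewrite face_closure_small ?cards1.
    rewrite (periodic_mod j.+1 fp).
    have jn : j %% n < n by rewrite ltn_pmod.
    have j1 : (j %% n).+1 < n.
      by rewrite ltn_neqAle jn andbT -[n in _ != n]prednK // eqSS jE.
    rewrite -addn1 -modnDml addn1 modn_small // => /fi.
    by rewrite j1 n0 => /(_ isT isT).
  - left; exists 1; first exact: nesym.
    rewrite face_iterS E /face_step bigcup_setU !big_set1 Nw Nf mod0n.
    case: eqP => [n1|_]; first by clear -n1 n3; lia.
    by rewrite setUid face_closure_small ?cards1.
have [k fk] := reach_full (f 1).
have : #|face_iter P Q N k (f 1)| <= 2.
  have [[j _ ->]|->] := H k; first by rewrite cards1.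
  by rewrite cards2; case: (_ != _).
by rewrite fk cardsT cardT ltnS leqNgt; have := n3; case: (n) => [|[|[]]].
Qed.

Let mem_exitE f w j : lasso f w -> j < n ->
  (f j \in N w) = (j == 0) && (f 0 \in N w) || (j == 1) && (f 1 \in N w).
Proof.
move=> lf jn; have [[_ _ fi _] _ _ _ _] := lf; have n1 : 1 < n by exact: ltn_trans n3.
apply/idP/orP => [jw|[/andP[/eqP->]|/andP[/eqP->]]//].
have [E|E] := mem_exit lf jw; [left|right].
  by have := fi _ _ jn n0 E => j0; rewrite -{1}j0 eqxx -j0.
by have := fi _ _ jn n1 E => j0; rewrite -{1}j0 eqxx -j0.
Qed.

(** Now [f 1] is the only exit of [w]. Without an arc from [f 0] to [w] this is the twin digraph.
    With it the digraph is F2, where [f 0] is vertex 0 and [w] is vertex 1; hence the swap [t] of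
    these labels. *)
Let lasso_exit1 f w : lasso f w -> f 0 \notin N w -> target.
Proof.
move=> lf w0; have [[fe fp fi fx] fw Tw wl ww] := lf.
have n1 : 1 < n by exact: ltn_trans n3.
have w1 : f 1 \in N w.
  have /set0Pn[z zw] := successor_neq0 P1 Q1 reach_full w.
  by have [E|<-//] := mem_exit lf zw; rewrite -E zw in w0.
have w01 : w \in N (f 0).
  apply: contrapT => w0'; apply: (twins_not_full lf).
    apply/setP => z; rewrite inE; apply/idP/eqP => [zw|->//].
    by have [E|//] := mem_exit lf zw; rewrite -E zw in w0.
  move=> k kn; apply/idP/eqP => [kw|->//].
  have [k1|k1] := ltnP k n.-1; last by clear -k1 kn; lia.
  by case: w0'; rewrite -(exit1_entry lf w1 k1 kw).
have Nfw k : k < n -> (w \in N (f k)) = (k == 0) || (k == n.-1).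
  move=> kn; apply/idP/orP => [kw|[/eqP->|/eqP->]//].
  have [k1|k1] := ltnP k n.-1; last by right; clear -k1 kn; lia.
  by left; rewrite (exit1_entry lf w1 k1 kw).
pose t : 'I_n.+1 -> 'I_n.+1 := fun i =>
  if val i is 0 then inord 1 else if val i is 1 then ord0 else i.
have tt i : t (t i) = i.
  case: i => [[|[|i]] ii]; apply/val_inj; rewrite /t /= ?inordK //.
exists (label f w \o t); first exact: inj_comp (label_inj lf) (can_inj tt).
have sE i : (label f w \o t) i = if val i is 0 then f 0 else
   if val i is 1 then w else f (val i).-1.
  by case: i => [[|[|i]] ii]; rewrite /label /t /= ?inordK.
have Nwf j : j < n -> (f j \in N w) = (j == 1).
  by move=> jn; rewrite (mem_exitE lf) // w1 (negPf w0) andbF andbT.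
right => i j; rewrite !sE {sE}.
case: i j => [[|[|i]] ii] [[|[|j]] jj]; rewrite /F2 /F1 /=
  ?(mem_circuit lf) ?Nfw ?Nwf ?(negPf ww) //;
  by clear -ii jj n3; lia.
Qed.

(** If [w] has a second entry, it is [f n.-2], and rotating the circuit so that this becomes the
    last vertex leads back to [lasso_exit1]. Otherwise [w] is vertex 0 and the presence of an arc
    from [w] to [f 1] decides between F2 and F1. *)
Let lasso_target f w : lasso f w -> target.
Proof.
move=> lf; have [w0|w0] := boolP (f 0 \in N w); last exact: lasso_exit1 lf w0.
have [cf fw Tw wl ww] := lf; have [fe fp fi fx] := cf.
have n1 : 1 < n by exact: ltn_trans n3.
have [[i i1 iw]|noi] := pselect (exists2 i, i < n.-1 & e (f i) w).
  have ei := exit0_entry lf w0 i1 iw.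
  apply: (@lasso_exit1 (fun k => f (k + n.-1)) w).
    split=> //; first exact: circuit_shift.
      move=> v; have [->|[k kn ->]] := Tw v; [by left|right].
      exists ((k + (n - n.-1 %% n)) %% n); rewrite ?ltn_pmod //.
      by rewrite [RHS](periodic_mod _ fp) modn_shiftK // -(periodic_mod _ fp).
    have -> : n.-1 + n.-1 = n.-2 + n by clear -n1; lia.
    by rewrite fp -ei.
  rewrite add0n; apply/negP => /(mem_exit lf) [] /fi; rewrite ?n0 ?n1 ltn_predL n0;
    by move=> /(_ isT isT); clear -n3; lia.
have Nfw k : k < n -> (w \in N (f k)) = (k == n.-1).
  move=> kn; apply/idP/eqP => [kw|->//].
  have [k1|k1] := ltnP k n.-1; last by clear -k1 kn; lia.
  by case: noi; exists k.
exists (label f w); first exact: label_inj.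
have [w1|w1] := boolP (f 1 \in N w).
  have Nwf j : j < n -> (f j \in N w) = (j == 0) || (j == 1).
    by move=> jn; rewrite (mem_exitE lf) // w1 w0 !andbT.
  right => -[[|i] ii] [[|j] jj]; rewrite /label /F2 /F1 /=
    ?(mem_circuit lf) ?Nfw ?Nwf ?(negPf ww) //;
    by clear -ii jj n3; lia.
have Nwf j : j < n -> (f j \in N w) = (j == 0).
  by move=> jn; rewrite (mem_exitE lf) // w0 (negPf w1) andbF andbT orbF.
left => -[[|i] ii] [[|j] jj]; rewrite /label /F1 /=
  ?(mem_circuit lf) ?Nfw ?Nwf ?(negPf ww) //;
  by clear -ii jj n3; lia.
Qed.

Theorem slow_digraph : exists2 s : 'I_n.+1 -> T, injective s &
  (forall i j, (s j \in N (s i)) = F1 i j) \/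
  (forall i j, (s j \in N (s i)) = F2 i j).
Proof.
have [f0 cf0] := exists_circuit.
have [w fw0 Tw0] := off_circuit cf0.
(* If nothing entered [w], each circuit vertex would have a single successor. *)
have [i0 i0w] : exists i, e (f0 i) w.
  apply: contrapT => H; apply: (@singletons_not_full f0) => k.
  apply/setP => z; rewrite inE; apply/idP/eqP => [kz|->].
    have [zw|[j _ zj]] := Tw0 z; first by case: H; exists k; rewrite -zw.
    by rewrite zj; apply: arc_circuit => //; rewrite -zj.
  by case: cf0 => fe _ _ _; exact: fe.
have ww : w \notin N w.
  apply/negP => ww; have [_ _ _ fx] := cf0.
  have cw : cycle e [:: w] by rewrite /= andbT.
  have xw : has (connect e x) [:: w].
    by rewrite /= orbF (connect_trans (fx i0) (connect1 i0w)).
  have := slow_cycle_size cw xw; rewrite leqNgt.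
  by rewrite (ltn_trans _ n3).
(* After rotating the circuit, the arc into [w] starts from its last vertex. *)
apply: (@lasso_target (fun k => f0 (k + i0.+1)) w); have [_ fp _ _] := cf0.
split=> //; first exact: circuit_shift.
  move=> v; have [->|[k kn ->]] := Tw0 v; [by left|right].
  exists ((k + (n - i0.+1 %% n)) %% n); rewrite ?ltn_pmod //.
  by rewrite [RHS](periodic_mod _ fp) modn_shiftK // -(periodic_mod _ fp).
by rewrite addnS -addSn prednK // addnC fp; exact: i0w.
Qed.

End SlowDigraphs.

(** * Iterates of F1 and F2 *)

Section CyclicIntervals.
Variables (n : nat) (P Q : {set 'I_n.+1}) (N : 'I_n.+1 -> {set 'I_n.+1}).
Hypotheses (n3 : 2 < n) (P1 : 1 < #|P|) (Q1 : 1 < #|Q|) (dPQ : [disjoint P & Q]).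
Hypothesis F1N : forall i j, F1 i j -> j \in N i.

(* The [l] cyclically consecutive vertices ending at [e]. *)
Let interval (l e : nat) : {set 'I_n.+1} :=
  [set i : 'I_n.+1 | (i <= e) && (e < i + l) || (e + n.+1 < i + l)].

Local Notation o := (@inord n).
Let oK k : k <= n -> val (o k) = k. Proof. by move=> kn; rewrite /= inordK. Qed.

Let interval_sub_step l e : 0 < e < n -> l <= n ->
  interval l e.+1 \subset \bigcup_(i in interval l e) N i.
Proof.
move=> en ln; apply/subsetP => -[[|[|j]] jn]; rewrite inE /= => H;
  apply/bigcupP.
- exists (o n); last by apply: F1N; rewrite /F1 oK //= eqxx ?andbT ?orbT.
  by rewrite inE oK //; clear -en ln H; lia.
- have [le|le] := leqP l e.+1; last first.
    exists (o n); last by apply: F1N; rewrite /F1 oK //= eqxx ?andbT ?orbT.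
    by rewrite inE oK //; clear -en ln H le; lia.
  exists (o 0); last by apply: F1N; rewrite /F1 oK //=.
  by rewrite inE oK //; clear -en ln H le; lia.
- have jn1 : j < n by exact: ltnW jn.
  exists (o j.+1); last by apply: F1N; rewrite /F1 oK //= eqxx.
  by rewrite inE oK //; clear -en ln H; lia.
Qed.

(** Vertex n leads to both 0 and 1, so an interval gains an element whenever its end passes from n
    to 1. No interval of the sequence ends at 0. *)
Let interval_sub_wrap l : 0 < l <= n ->
  interval l.+1 1 \subset \bigcup_(i in interval l n) N i.
Proof.
move=> ln; apply/subsetP => -[[|[|j]] jn]; rewrite inE /= => H;
  apply/bigcupP.
- exists (o n); last by apply: F1N; rewrite /F1 oK //= eqxx ?andbT ?orbT.
  by rewrite inE oK //; clear -ln H; lia.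
- exists (o n); last by apply: F1N; rewrite /F1 oK //= eqxx ?andbT ?orbT.
  by rewrite inE oK //; clear -ln H; lia.
- have jn1 : j < n by exact: ltnW jn.
  exists (o j.+1); last by apply: F1N; rewrite /F1 oK //= eqxx.
  by rewrite inE oK //; clear -ln H jn1; lia.
Qed.

Let interval11 : interval 1 1 = [set o 1].
Proof.
apply/setP => i; rewrite !inE -val_eqE oK ?(ltnW (ltnW n3)) //=.
by have := ltn_ord i; clear -n3; lia.
Qed.

(** The end of the interval runs through 1, ..., n, so a turn takes [n] steps: [k] counts completed
    turns and [t] the position in the current one. *)
Lemma interval_sub_face_iter k t : t < n -> k < n ->
  interval k.+1 t.+1 \subset face_iter P Q N (k * n + t) (o 1).
Proof.
move=> tn kn; have [s] := ubnP (k * n + t); elim: s => // s IH in k t tn kn *.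
rewrite ltnS; case: t tn => [|t] tn ks; last first.
  rewrite addnS face_iterS; apply: subset_trans (face_closure_sub _ _ _).
  apply: subset_trans (interval_sub_step _ _) _ => //.
  apply/bigcupsP => i iI; apply: bigcup_sup.
  apply: (subsetP (IH k t _ kn _)) iI; first exact: ltnW.
  by clear -ks; lia.
case: k kn ks => [|k] kn ks; first by rewrite interval11.
have -> : k.+1 * n + 0 = (k * n + n.-1).+1 by rewrite mulSn; clear -n3; lia.
rewrite face_iterS; apply: subset_trans (face_closure_sub _ _ _).
apply: subset_trans (interval_sub_wrap _) _; first exact: ltnW.
apply/bigcupsP => i iI; apply: bigcup_sup.
have nE : n.-1.+1 = n by apply: ltn_predK n3.
apply: (subsetP (IH k n.-1 _ (ltnW kn) _)); rewrite ?nE //.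
by move: ks; rewrite mulSn; clear -n3; lia.
Qed.

Let face_iter_closed k i : face_closure P Q (face_iter P Q N k i) = face_iter P Q N k i.
Proof.
case: k => [|k]; last exact: face_closure_idem.
by rewrite face_closure_small // cards1.
Qed.

Let full_of_sub k i (S : {set 'I_n.+1}) : S \subset face_iter P Q N k i ->
  (P \subset S) || (Q \subset S) -> (forall i, i \notin S -> i \in P :|: Q) ->
  face_iter P Q N k i = setT.
Proof.
move=> SF SPQ H; apply/eqP; rewrite -subTset -face_iter_closed.
apply: subset_trans (face_closure_mono _ _ SF); rewrite face_closureE SPQ.
apply/subsetP => j _; have [jS|/H] := boolP (j \in S); rewrite !inE ?jS //.
by case/orP => ->; rewrite ?orbT.
Qed.

(** At this time the interval misses at most vertex 2. One of [P] and [Q] does not contain 2, hence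
    lies in the interval, and the closure adds the other. *)
Lemma iter_full_at1 : o 2 \in P :|: Q -> face_iter P Q N (n.-1 * n) (o 1) = setT.
Proof.
move=> o2.
have n11 : n.-1 < n by rewrite ltn_predL (ltn_trans _ n3).
have := interval_sub_face_iter (ltn_trans (isT : 0 < 2) n3) n11.
rewrite addn0 (ltn_predK n3) => sub.
have mem i : (i \in interval n 1) = (i != o 2).
  by rewrite inE -val_eqE oK ?(ltnW n3) //= ; have := ltn_ord i; clear -n3; lia.
apply: full_of_sub sub _ _ => [|i]; last by rewrite mem negbK => /eqP->.
have notin (A : {set 'I_n.+1}) : o 2 \notin A -> A \subset interval n 1.
  by move=> nA; apply/subsetP => i iA; rewrite mem; apply: contraNneq nA => <-.
have : (o 2 \notin P) || (o 2 \notin Q).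
  rewrite -negb_and; apply/andP => -[oP oQ].
  by move: dPQ => /pred0P/(_ (o 2)); rewrite /= oP oQ.
by case/orP => /notin ->; rewrite ?orbT.
Qed.

Lemma mem_face_iter_add k a : k + a <= n -> o (k + a) \in face_iter P Q N a (o k).
Proof.
elim: a => [|a IH] kan; first by rewrite addn0 set11.
rewrite addnS in kan *; rewrite face_iterS.
apply: mem_face_step (IH (ltnW kan)) _.
by apply: F1N; rewrite /F1 (oK kan) (oK (ltnW kan)) eqxx.
Qed.

Lemma mem_face_iter_wrap k : k <= n -> o 1 \in face_iter P Q N (n - k).+1 (o k).
Proof.
move=> kn; rewrite face_iterS; apply: (@mem_face_step _ _ _ _ _ (o n)).
  by have := @mem_face_iter_add k (n - k); rewrite subnKC //; apply.
by apply: F1N; rewrite /F1 !oK ?eqxx ?andbT ?orbT // ltnW // ltnW.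
Qed.

Lemma iter_reach_full : o 2 \in P :|: Q ->
  forall j, exists k, face_iter P Q N k j = setT.
Proof.
move=> o2 j; exists ((n - j).+1 + n.-1 * n); apply/eqP.
rewrite -subTset -(iter_full_at1 o2); apply: face_iterD.
have jn : j <= n by rewrite -ltnS.
have oj : o j = j by apply/val_inj; rewrite oK.
by have := mem_face_iter_wrap jn; rewrite oj.
Qed.

Section Full.
Hypothesis reach_full : forall i, exists k, face_iter P Q N k i = setT.

(** The vertices 1, ..., n lie on a circuit of length [n], and [closed_walk_full] allows [n.-1]
    turns. With the arc from 0 to 2, vertex 0 is on such a circuit as well, which gives
    [iter_full_F2]. *)
Lemma iter_full_pos (j : 'I_n.+1) : 0 < j ->
  face_iter P Q N (n * n.-1) j = setT.
Proof.
move=> j0; have jn : j <= n by rewrite -ltnS.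
have -> : n.-1 = #|'I_n.+1| - 2 by rewrite card_ord subSS subn1.
apply: closed_walk_full => //; first exact: ltn_trans n3.
have oj : o j = j by apply/val_inj; rewrite oK.
have H1 := mem_face_iter_wrap jn; rewrite oj in H1.
have H2 := @mem_face_iter_add 1 j.-1; rewrite add1n prednK // oj in H2.
have := subsetP (face_iterD j.-1 H1) _ (H2 jn).
by have -> : (n - j).+1 + j.-1 = n by clear -j0 jn; lia.
Qed.

Lemma iter_full_F2 : o 2 \in N (o 0) -> face_iter P Q N (n * n.-1) (o 0) = setT.
Proof.
move=> H02.
have -> : n.-1 = #|'I_n.+1| - 2 by rewrite card_ord subSS subn1.
apply: closed_walk_full => //; first exact: ltn_trans n3.
have H0 : o 2 \in face_iter P Q N 1 (o 0).
  by rewrite face_iterS; apply: mem_face_step H02; rewrite set11.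
have H1 := @mem_face_iter_add 2 (n - 2); rewrite subnKC ?(ltnW n3) // in H1.
have H2 := subsetP (face_iterD (n - 2) H0) _ (H1 (leqnn _)).
have en : (1 + (n - 2)).+1 = n by clear -n3; lia.
suff : o 0 \in face_iter P Q N (1 + (n - 2)).+1 (o 0) by rewrite en.
rewrite face_iterS; apply: mem_face_step H2 _.
by apply: F1N; rewrite /F1 !oK ?eqxx ?andbT ?orbT // ltnW // ltnW.
Qed.

End Full.

Local Notation same i j := ((i \in P) && (j \in P) || (i \in Q) && (j \in Q)).
Local Notation opp i j := ((i \in P) && (j \in Q) || (i \in Q) && (j \in P)).

Let notin_other (A B : {set 'I_n.+1}) i : [disjoint A & B] -> i \in A -> i \notin B.
Proof.
by move=> dAB iA; apply/negP => iB; move: dAB => /pred0P/(_ i); rewrite /= iA iB.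
Qed.

(** The decisive moment: [k = n - 2] and [t = n.-1] belong to the interval of length [n - 1] ending
    at n, which misses exactly 0 and 1. *)
Let timeE : (n - 2) * n + n.-1 = (n * n.-1).-1.
Proof. by clear -n3; case: n n3 => [|[|m]] // _; rewrite !subSS subn0 /=; nia. Qed.

Lemma iter_full_same : same (o 0) (o 1) ->
  face_iter P Q N (n * n.-1).-1 (o 1) = setT.
Proof.
move=> s01.
have n11 : n.-1 < n by rewrite ltn_predL (ltn_trans _ n3).
have n2 : n - 2 < n by clear -n3; lia.
have := interval_sub_face_iter n11 n2.
rewrite timeE (ltn_predK n3) => sub.
have mem i : (i \in interval (n - 2).+1 n) = (i != o 0) && (i != o 1).
  rewrite inE -!val_eqE !oK ?(ltnW (ltnW n3)) //=.
  by have := ltn_ord i; clear -n3; lia.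
apply: full_of_sub sub _ _ => [|i].
  have notin (A : {set 'I_n.+1}) : o 0 \notin A -> o 1 \notin A ->
      A \subset interval (n - 2).+1 n.
    move=> nA0 nA1; apply/subsetP => i iA; rewrite mem.
    by apply/andP; split; [apply: contraNneq nA0 => <-|apply: contraNneq nA1 => <-].
  case/orP: s01 => /andP[s0 s1]; apply/orP.
    by right; apply: notin; exact: (@notin_other P).
  by left; apply: notin; apply: (@notin_other Q) => //; rewrite disjoint_sym.
rewrite mem negb_and !negbK inE => /orP[/eqP->|/eqP->];
  by case/orP: s01 => /andP[s0 s1]; rewrite ?s0 ?s1 ?orbT.
Qed.

Section Upper.
Hypothesis NF2 : forall i j, j \in N i -> F2 i j.

(** The extra arc of F2 from 0 to 2 changes nothing: an interval containing 0 and ending at such an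
    [e] contains 1, which leads to 2 anyway. In [wrap_sub_interval] the interval does not contain
    0. *)
Let step_sub_interval l e : 0 < e < n -> 0 < l <= n ->
  \bigcup_(i in interval l e) N i \subset interval l e.+1.
Proof.
move=> en ln; apply/bigcupsP => i; rewrite inE => iI.
apply/subsetP => j /NF2; rewrite /F2 /F1 inE /=.
have := ltn_ord i; have := ltn_ord j; clear -iI en ln; lia.
Qed.

Let wrap_sub_interval l : 0 < l <= n ->
  \bigcup_(i in interval l n) N i \subset interval l.+1 1.
Proof.
move=> ln; apply/bigcupsP => i; rewrite inE => iI.
apply/subsetP => j /NF2; rewrite /F2 /F1 inE /=.
have := ltn_ord i; have := ltn_ord j; clear -iI ln; lia.
Qed.

Lemma face_iter_sub_interval M k t :
  (forall k t, t < n -> k < n -> k * n + t <= M ->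
    face_closure P Q (interval k.+1 t.+1) = interval k.+1 t.+1) ->
  t < n -> k < n -> k * n + t <= M ->
  face_iter P Q N (k * n + t) (o 1) \subset interval k.+1 t.+1.
Proof.
move=> cl tn kn; have [s] := ubnP (k * n + t); elim: s => // s IH in k t tn kn *.
rewrite ltnS; case: t tn => [|t] tn ks kM; last first.
  rewrite -(cl k t.+1 tn kn kM) addnS face_iterS; apply: face_closure_mono.
  apply: subset_trans (step_sub_interval _ _) => //.
  apply/bigcupsP => i iI; apply: bigcup_sup.
  apply: (subsetP (IH k t _ kn _ _)) iI; first exact: ltnW.
    by clear -ks; lia.
  by clear -kM; lia.
case: k kn ks kM => [|k] kn ks kM; first by rewrite interval11.
rewrite -(cl k.+1 0 tn kn kM).
have -> : k.+1 * n + 0 = (k * n + n.-1).+1 by rewrite mulSn; clear -n3; lia.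
rewrite face_iterS; apply: face_closure_mono.
apply: subset_trans (wrap_sub_interval _); last exact: ltnW.
apply/bigcupsP => i iI; apply: bigcup_sup.
have nE : n.-1.+1 = n by apply: ltn_predK n3.
have := IH k n.-1 _ (ltnW kn); rewrite nE => /(_ (leqnn _)) H;
  apply: (subsetP (H _ _) _ iI).
  by move: ks; rewrite mulSn; clear -n3; lia.
by move: kM; rewrite mulSn; clear -n3; lia.
Qed.

Let opp_closed (S : {set 'I_n.+1}) i j : opp i j -> i \notin S -> j \notin S ->
  face_closure P Q S = S.
Proof.
by move=> /orP[]/andP[iA jA] iS jS;
  [apply: (face_closure_id iA iS jA jS)|apply: (face_closure_id jA jS iA iS)].
Qed.

Hypothesis opp_succ : forall k, 1 < k < n -> opp (o k) (o k.+1).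
Hypothesis opp_wrap : opp (o n) (o 0).

Let notin_interval l e k : k <= n -> ~~ ((k <= e) && (e < k + l) || (e + n.+1 < k + l)) ->
  o k \notin interval l e.
Proof. by move=> kn; rewrite inE oK. Qed.

(** The two vertices after [e] are missing and have opposite signs, so neither [P] nor [Q] is
    contained. Only for [e = n] are these two 0 and 1, whose signs are not prescribed here. *)
Let interval_closed_lt l e : l < n -> 0 < e < n ->
  face_closure P Q (interval l e) = interval l e.
Proof.
move=> ln en; have [en'|en'] := ltnP e.+1 n.
  have e1 : 1 < e.+1 < n by clear -en en'; lia.
  by apply: opp_closed (opp_succ e1) _ _; apply: notin_interval;
    clear -ln en en'; lia.
have e1 : e.+1 = n by clear -en en'; lia.
by apply: opp_closed opp_wrap _ _; apply: notin_interval; clear -ln en e1; lia.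
Qed.

Let time_lt k t : t < n -> k < n -> k * n + t <= (n * n.-1).-1 -> k.+1 < n.
Proof.
move=> tn kn; rewrite -timeE => H; rewrite ltnNge; apply/negP => nk.
have ek : k = (n - 2).+1 by clear -kn nk n3; lia.
by move: H; rewrite ek mulSn; clear -n3; lia.
Qed.

Lemma iter_not_full_opp : opp (o 0) (o 1) ->
  face_iter P Q N (n * n.-1).-1 (o 1) != setT.
Proof.
move=> o01; have nE : n.-1.+1 = n by apply: ltn_predK n3.
apply/eqP => fT; have /subsetP/(_ (o 0)) : setT \subset interval (n - 2).+1 n.-1.+1.
  rewrite -fT -timeE; apply: (@face_iter_sub_interval (n * n.-1).-1) => //.
  - move=> k t tn kn kt; have kn1 := time_lt tn kn kt.
    have [tn1|tn1] := ltnP t.+1 n; first exact: interval_closed_lt.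
    have -> : t.+1 = n by clear -tn1 tn; lia.
    by apply: opp_closed o01 _ _; apply: notin_interval; clear -kn1 n3; lia.
  - by rewrite nE.
  - by clear -n3; lia.
  - by rewrite timeE.
move=> /(_ (in_setT _)); apply/negP; apply: notin_interval => //.
by clear -n3; lia.
Qed.

(** One step earlier, an interval ending at n has length at most [n - 2] and misses 0, 1 and 2. So
    it suffices that 2 is opposite to either 1 ([c = 1]) or 0 ([c = 2]). *)
Let sub_interval_before (c : nat) : (c == 1) || (c == 2) ->
  opp (o (2 - c)) (o 2) ->
  face_iter P Q N (n * n.-1).-2 (o 1) \subset interval (n - 2).+1 n.-1.
Proof.
move=> c12 oc; have nE : n.-1.+1 = n by apply: ltn_predK n3.
have timeE2 : (n - 2) * n + n.-2 = (n * n.-1).-2.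
  by rewrite -timeE; clear -n3; lia.
have {2}<- : n.-2.+1 = n.-1 by clear -n3; lia.
rewrite -timeE2; apply: (@face_iter_sub_interval (n * n.-1).-2) => //.
- move=> k t tn kn kt.
  have kn1 : k.+1 < n by apply: time_lt tn kn _; apply: leq_trans kt _; rewrite leq_pred.
  have [tn1|tn1] := ltnP t.+1 n; first exact: interval_closed_lt.
  have tE : t = n.-1 by clear -tn1 tn; lia.
  have kn2 : k.+2 < n.
    rewrite ltnNge; apply/negP => nk; have ek : k = n - 2 by clear -kn1 nk; lia.
    by move: kt; rewrite -timeE2 ek tE; clear -n3; lia.
  by rewrite tE nE; apply: opp_closed oc _ _; apply: notin_interval;
    clear -kn2 n3 c12; lia.
- by clear -n3; lia.
- by clear -n3; lia.
- by rewrite timeE2.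
Qed.

Lemma iter_not_full_same : opp (o 1) (o 2) ->
  face_iter P Q N (n * n.-1).-2 (o 1) != setT.
Proof.
move=> o12; apply/eqP => fT; have := @sub_interval_before 1 isT o12.
rewrite fT => /subsetP/(_ (o 0) (in_setT _)); apply/negP; apply: notin_interval => //.
by clear -n3; lia.
Qed.

(** The closure can only add elements of [P] and [Q], hence never 1. And 1 is reached only from 0
    and n, which the preceding interval misses. *)
Lemma iter_not_full_zero : opp (o 0) (o 2) -> o 1 \notin P :|: Q ->
  face_iter P Q N (n * n.-1).-1 (o 1) != setT.
Proof.
move=> o02 o1; apply/eqP => fT; have sub := @sub_interval_before 2 isT o02.
have e1 : (n * n.-1).-1 = (n * n.-1).-2.+1.
  by rewrite prednK // -timeE; clear -n3; lia.
move: fT; rewrite e1 face_iterS => /setP/(_ (o 1)); rewrite in_setT.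
have -> : (o 1 \in face_step P Q N (face_iter P Q N (n * n.-1).-2 (o 1))) =
    (o 1 \in \bigcup_(i in face_iter P Q N (n * n.-1).-2 (o 1)) N i).
  rewrite /face_step face_closureE; case: ifP => // _.
  by move: o1; rewrite !inE negb_or => /andP[/negPf-> /negPf->]; rewrite !orbF.
case/bigcupP => i /(subsetP sub) iI /NF2; move: iI.
rewrite inE /F2 /F1 oK ?(ltnW (ltnW n3)) //; have := ltn_ord i; clear -n3; lia.
Qed.

End Upper.
End CyclicIntervals.

From mathcomp Require Import all_order all_algebra perm.
From mathcomp Require Import all_classical all_reals all_analysis.
From mathcomp Require Import ring lra.

Import Order.TTheory GRing.Theory Num.Theory.
Import numFieldNormedType.Exports.

Local Open Scope classical_set_scope.
Local Open Scope ring_scope.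

(** * Faces, interiors and extreme vectors of closed cones *)

Section ConvexCones.
Variables (R : realType) (n : nat).
Implicit Types (K F : set 'cV[R]_n) (x y u v : 'cV[R]_n) (a b : R).

(** The vectors on the right form a face containing [x]. Conversely, a face containing [x] contains
    the summand [a *: y] of [x]. *)
Lemma PhiP K x y : convex_cone K -> K x ->
  Phi K x y <-> K y /\ exists2 a, 0 < a & K (x - a *: y).
Proof.
move=> [K0 KD KZ] Kx; split=> [|[Ky [a a0 Kxy]] F [[[F0 FD FZ] FK Fface] Fx]].
  move=> /(_ [set z | K z /\ exists2 a, 0 < a & K (x - a *: z)]); apply.
  split=> /=; last first.
    split=> //; exists 1; first exact: ltr01.
    by rewrite scale1r subrr.
  split.
  - split; first by split=> //; exists 1; rewrite ?scaler0 ?subr0.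
      move=> y1 y2 [Ky1 [a a0 Ha]] [Ky2 [b b0 Hb]]; split; first exact: KD.
      have ab0 : 0 < a + b by exact: addr_gt0.
      (* Weighting the two differences by [b / (a + b)] and [a / (a + b)] gives [y1] and [y2] the
         same coefficient. *)
      exists (a * b / (a + b)); first by rewrite divr_gt0 ?mulr_gt0.
      have -> : x - (a * b / (a + b)) *: (y1 + y2) =
          (b / (a + b)) *: (x - a *: y1) + (a / (a + b)) *: (x - b *: y2).
        apply/matrixP => i j; rewrite !mxE.
        by field; rewrite lt0r_neq0.
      by apply: KD; apply: KZ => //; rewrite divr_ge0 // ltW.
    move=> b y1 b0 [Ky1 [a a0 Ha]]; split; first exact: KZ.
    have b1 : 0 < 1 + b by rewrite ltr_pwDl.
    exists (a / (1 + b)); first by rewrite divr_gt0.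
    have -> : x - (a / (1 + b)) *: (b *: y1) =
        (1 / (1 + b)) *: x + (b / (1 + b)) *: (x - a *: y1).
      by apply/matrixP => i j; rewrite !mxE; field; rewrite lt0r_neq0.
    by apply: KD; apply: KZ; rewrite // divr_ge0 // ltW.
  - by move=> z [].
  - move=> y1 y2 [Ky1 [a a0 Ha]] Ky2 K12; split=> //; exists a => //.
    have -> : x - a *: y2 = (x - a *: y1) + a *: (y1 - y2).
      by apply/matrixP => i j; rewrite !mxE; ring.
    by apply: KD => //; apply: KZ => //; exact: ltW.
have Fay : F (a *: y).
  by apply: (Fface x) => //; apply: KZ => //; exact: ltW.
have -> : y = a^-1 *: (a *: y) by rewrite scalerA mulVf ?scale1r // lt0r_neq0.
by apply: FZ => //; rewrite invr_ge0 ltW.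
Qed.

Lemma Phi_refl K x : Phi K x x.
Proof. by move=> F []. Qed.

Lemma Phi_face K x : convex_cone K -> K x -> face K (Phi K x).
Proof.
move=> cK Kx; split.
- split; first by move=> F [[[]]].
    by move=> y z Hy Hz F HF; case: (HF) => -[[_ FD _] _ _] _; apply: FD;
      [apply: Hy|apply: Hz].
  by move=> a y a0 Hy F HF; case: (HF) => -[[_ _ FZ] _ _] _; apply: FZ => //; apply: Hy.
- by move=> y /(PhiP _ cK Kx) [].
- move=> y z Hy Kz Kyz F HF; case: (HF) => -[_ _ Ff] _.
  by apply: (Ff y) => //; apply: Hy.
Qed.

Lemma Phi_sub K x y : Phi K x y -> K x -> convex_cone K -> Phi K y `<=` Phi K x.
Proof. by move=> xy Kx cK z; apply; split=> //; exact: Phi_face. Qed.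

Lemma nbhs_cone_sub K x y : nbhs x K -> exists2 a, 0 < a & K (x - a *: y).
Proof.
move=> /nbhs_ballP [e /= e0 He].
have s0 : 0 < 1 + \sum_i `|y i 0| by rewrite ltr_pwDl // sumr_ge0.
exists (e / (1 + \sum_i `|y i 0|)); first by rewrite divr_gt0.
apply: He; split=> // i j; rewrite /ball /= !mxE (ord1 j) opprB addrC subrK.
rewrite normrM gtr0_norm ?divr_gt0 // -mulrA -[ltRHS]mulr1 ltr_pM2l //.
rewrite mulrC ltr_pdivrMr // mul1r (bigD1 i) //= ltr_pwDl // lerDl.
by rewrite sumr_ge0.
Qed.

Lemma cone_nbhs K x u a : convex_cone K -> nbhs u K -> 0 < a ->
  K (x - a *: u) -> nbhs x K.
Proof.
move=> [K0 KD KZ] /nbhs_ballP [e /= e0 He] a0 Kxu.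
apply/nbhs_ballP; exists (a * e); first by rewrite /= mulr_gt0.
move=> v Hv.
have -> : v = (x - a *: u) + a *: (u + a^-1 *: (v - x)).
  apply/matrixP => i j; rewrite !mxE; field; exact: lt0r_neq0.
apply: KD => //; apply: KZ; first exact: ltW.
apply: He; split=> // i j; have := Hv.2 i j; rewrite /ball /= !mxE => Hij.
rewrite opprD addrA subrr sub0r normrN normrM gtr0_norm ?invr_gt0 //.
by rewrite mulrC ltr_pdivrMr // distrC mulrC.
Qed.

Lemma interior_PhiP K x u : convex_cone K -> nbhs u K -> K x ->
  (K° x <-> K `<=` Phi K x).
Proof.
move=> cK Ku Kx; split.
  rewrite /interior /= => nx y Ky; apply/PhiP => //; split=> //.
  exact: nbhs_cone_sub.
move=> H; have /(PhiP _ cK Kx)[_ [a a0 Ka]] := H u (nbhs_singleton Ku).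
exact: cone_nbhs Ku a0 Ka.
Qed.

Lemma closed_cone_approx K x y : closed K ->
  (forall e, 0 < e -> exists2 a, `|a| < e & K (x + a *: y)) -> K x.
Proof.
move=> cK H; apply: cK => B /nbhs_ballP [e /= e0 He].
have s0 : 0 < 1 + \sum_i `|y i 0| by rewrite ltr_pwDl // sumr_ge0.
have [a ae Ka] := H (e / (1 + \sum_i `|y i 0|)) (divr_gt0 e0 s0).
exists (x + a *: y); split=> //; apply: He; split=> // i j.
rewrite /ball /= !mxE (ord1 j) opprD addrA subrr sub0r normrN normrM.
apply: (@le_lt_trans _ _ (`|a| * (1 + \sum_i `|y i 0|))).
  rewrite ler_wpM2l // (bigD1 i) //= addrCA lerDl addr_ge0 // sumr_ge0 //.
by rewrite -ltr_pdivlMr.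
Qed.

(** If [t] were unbounded, the vectors [t^-1 *: (x - t *: y)] of [K] would tend to [- y], against
    pointedness. The supremum is attained because [K] is closed. *)
Lemma max_sub_cone K x y : convex_cone K -> closed K -> pointed_cone K ->
  K x -> K y -> y != 0 ->
  exists t, [/\ 0 <= t, K (x - t *: y) & forall s, K (x - s *: y) -> s <= t].
Proof.
move=> [K0 KD KZ] clK pK Kx Ky y0.
pose S := [set t | K (x - t *: y)].
have S0 : S 0 by rewrite /S /= scale0r subr0.
have Sub : has_ubound S.
  apply: contrapT => nub; move/eqP: y0; apply; apply: pK => //.
  apply: (@closed_cone_approx _ _ x) => // e e0.
  have [t [St te]] : exists t, S t /\ e^-1 + 1 < t.
    apply: contrapT => nt; apply: nub; exists (e^-1 + 1) => t St.
    by rewrite leNgt; apply/negP => ht; apply: nt; exists t.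
  have t0 : 0 < t by apply: lt_trans te; rewrite addr_gt0 ?invr_gt0.
  exists t^-1.
    rewrite gtr0_norm ?invr_gt0 // invf_plt ?posrE //.
    by apply: lt_trans te; rewrite ltrDl.
  have -> : - y + t^-1 *: x = t^-1 *: (x - t *: y).
    by apply/matrixP => i j; rewrite !mxE; field; rewrite lt0r_neq0.
  by apply: KZ => //; rewrite invr_ge0 ltW.
have hS : has_sup S by split=> //; exists 0.
exists (sup S); split.
- exact: ub_le_sup.
- apply: (@closed_cone_approx _ _ y) => // e e0.
  have [s Ss hs] := sup_adherent e0 hS.
  exists (sup S - s).
    by rewrite ger0_norm ?subr_ge0 ?ub_le_sup // ltrBlDr -ltrBlDl.
  suff -> : x - sup S *: y + (sup S - s) *: y = x - s *: y by [].
  by apply/matrixP => i j; rewrite !mxE; ring.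
- by move=> s Ss; exact: ub_le_sup.
Qed.

End ConvexCones.

(** * Minkowski's theorem: closed pointed cones are generated by extreme vectors *)

Section Minkowski.
Variables (R : realType) (n : nat).
Implicit Types (K F S : set 'cV[R]_n) (x y u v : 'cV[R]_n) (a b : R).

Lemma set_span S : exists2 X : seq 'cV[R]_n,
  forall x, x \in X -> S x & forall x, S x -> x \in <<X>>%VS.
Proof.
suff H k : forall X : seq 'cV[R]_n, (forall x, x \in X -> S x) ->
    (n <= \dim <<X>> + k)%N -> exists2 X : seq 'cV[R]_n,
    forall x, x \in X -> S x & forall x, S x -> x \in <<X>>%VS.
  by apply: (H n [::]) => //; rewrite leq_addl.
elim: k => [|k IH] X XS Xk.
  exists X => // x _; suff /eqP -> : <<X>>%VS == fullv by rewrite memvf.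
  by rewrite eqEdim subvf dimvf /dim /= muln1; rewrite addn0 in Xk.
have [H|/existsNP[x /not_implyP[Sx xX]]] :=
    pselect (forall x, S x -> x \in <<X>>%VS); first by exists X.
apply: (IH (x :: X)).
  by move=> z; rewrite inE => /predU1P[->//|]; exact: XS.
apply: leq_trans Xk _; rewrite addnS -addSn leq_add2r.
have sub : (<<X>> <= <<x :: X>>)%VS by rewrite span_cons addvSr.
rewrite ltn_neqAle (dimv_leqif_sup sub) dimvS // andbT.
by apply/negP => /subvP/(_ x); rewrite memv_span ?mem_head // => /(_ isT).
Qed.

Lemma convex_cone_sum K (I : Type) (s : seq I) (P : pred I) (f : I -> 'cV[R]_n) :
  convex_cone K -> (forall i, P i -> K (f i)) -> K (\sum_(i <- s | P i) f i).
Proof. by move=> [K0 KD _] H; elim/big_ind: _ => //. Qed.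

(** Adding to [y] the combination [t] with the absolute values of its coefficients gives a
    nonnegative combination, which lies in [F]; both [y] and [t] are in [K], so [y] is in [F]. *)
Lemma face_span_sub K F (X : seq 'cV[R]_n) y : face K F ->
  (forall x, x \in X -> F x) -> y \in <<X>>%VS -> K y -> F y.
Proof.
move=> [cF FK Fface] XF yX Ky.
have eqy := coord_span (X := in_tuple X) yX.
pose t := \sum_(i < size X) `|coord (in_tuple X) i y| *: (in_tuple X)`_i.
have Ft : F t.
  apply: convex_cone_sum => // i _; case: cF => _ _; apply; first exact: normr_ge0.
  exact/XF/mem_nth.
apply: (Fface (t + y)) => //.
  rewrite [X in t + X]eqy -big_split /=; apply: convex_cone_sum => // i _.
  rewrite -scalerDl; case: cF => _ _; apply; last exact/XF/mem_nth.
  by rewrite -lerBlDl sub0r lerNnormlW.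
by rewrite addrK; exact: FK.
Qed.

(** Induction on the dimension of the face of [x]. If [x] is not extreme, take [y] in its face but
    off its ray, and move from [x] against [y] and from [y] against [x] as far as [K] allows. The
    end points [z] and [w] have smaller faces, and [x] is a positive multiple of [z + t *: w]. *)
Theorem closed_pointed_cone_extreme_sum K x :
  convex_cone K -> closed K -> pointed_cone K -> K x ->
  exists2 s : seq 'cV[R]_n,
    forall v, v \in s -> extreme_vector K v & x = \sum_(v <- s) v.
Proof.
move=> cK clK pK Kx; have [K0 KD KZ] := cK.
have [X _ HX] := set_span (Phi K x).
have [d] := ubnP (\dim <<X>>); elim: d => // d IH in x Kx X HX *.
rewrite ltnS => dX.
have [->|x0] := eqVneq x 0; first by exists [::]; rewrite ?big_nil.
have [ex|nex] := pselect (Phi K x = ray x).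
  exists [:: x]; last by rewrite big_seq1.
  by move=> v; rewrite inE => /eqP->.
have [y [xy ry]] : exists y, Phi K x y /\ ~ ray x y.
  apply: contrapT => H; apply: nex; apply/seteqP; split=> y.
    by move=> xy; apply: contrapT => ry; apply: H; exists y.
  move=> [l l0 ->]; case: (Phi_face cK Kx) => -[_ _ FZ] _ _.
  exact: FZ l0 (@Phi_refl _ _ _ _).
have [Ky [a a0 Kxy]] := (PhiP _ cK Kx).1 xy.
have y0 : y != 0 by apply/eqP => y0; apply: ry; exists 0; rewrite ?scale0r.
have [t [t0 Kz maxt]] := max_sub_cone cK clK pK Kx Ky y0.
have [s [s0 Kw maxs]] := max_sub_cone cK clK pK Ky Kx x0.
set z := x - t *: y in Kz; set w := y - s *: x in Kw.
have ta : 0 < t by exact: lt_le_trans (maxt _ Kxy).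
have zx : Phi K x z.
  apply/PhiP => //; split=> //; exists 1; rewrite // scale1r opprB addrC subrK.
  exact: KZ.
have wx : Phi K x w.
  apply/PhiP => //; split=> //; exists a; rewrite // scalerBr opprB addrA.
  rewrite addrAC; apply: KD => //; rewrite scalerA; apply: KZ => //.
  by rewrite mulr_ge0 // ltW.
(* A face is cut out of [K] by its span, so a face that misses some [v] has a smaller span and the
   induction applies. *)
have dec u v : Phi K x u -> Phi K x v -> ~ Phi K u v -> exists2 s : seq 'cV[R]_n,
    forall v, v \in s -> extreme_vector K v & u = \sum_(v <- s) v.
  move=> xu xv uv.
  have Ku : K u by have [] := (PhiP _ cK Kx).1 xu.
  have Kv : K v by have [] := (PhiP _ cK Kx).1 xv.
  have [Y Yu HY] := set_span (Phi K u).
  apply: (IH u Ku Y HY); apply: leq_trans dX.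
  have sub : (<<Y>> <= <<X>>)%VS.
    by apply/span_subvP => q /Yu /(Phi_sub xu Kx cK); exact: HX.
  rewrite ltn_neqAle (dimv_leqif_sup sub) dimvS // andbT.
  apply/negP => /subvP/(_ v) /(_ (HX _ xv)) vY; apply: uv.
  exact: face_span_sub (Phi_face cK Ku) Yu vY Kv.
have [|sz Hsz ez] := dec z y zx xy.
  move=> /(PhiP _ cK Kz) [_ [b b0 Kb]].
  have : K (x - (t + b) *: y) by rewrite scalerDl opprD addrA.
  by move/maxt; rewrite gerDl leNgt b0.
have [|sw Hsw ew] := dec w x wx (@Phi_refl _ _ _ _).
  move=> /(PhiP _ cK Kw) [_ [b b0 Kb]].
  have : K (y - (s + b) *: x) by rewrite scalerDl opprD addrA.
  by move/maxs; rewrite gerDl leNgt b0.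
have e1 : (1 - t * s) *: x = z + t *: w.
  by rewrite /z /w; apply/matrixP => i j; rewrite !mxE; ring.
(* Otherwise [- z] lies in [K], so [z = 0] and [y] would be on the ray of [x]. *)
have ts : 0 < 1 - t * s.
  rewrite ltNge; apply/negP => ts.
  have z0 : z = 0.
    apply: pK => //.
    have -> : - z = t *: w + (- (1 - t * s)) *: x.
      by rewrite scaleNr e1 [- (z + _)]opprD [RHS]addrC subrK.
    by apply: KD; apply: KZ => //; rewrite ?oppr_ge0 // ltW.
  apply: ry; exists t^-1; first by rewrite invr_ge0.
  move/eqP: z0; rewrite subr_eq0 => /eqP ->.
  by rewrite scalerA mulVf ?scale1r // lt0r_neq0.
have sc c v : 0 < c -> extreme_vector K v -> extreme_vector K (c *: v).
  move=> c0 [Kv v0 Ev]; split; first by apply: KZ => //; exact: ltW.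
    by rewrite scaler_eq0 negb_or v0 lt0r_neq0.
  have -> : Phi K (c *: v) = Phi K v.
    apply/seteqP; split; apply: Phi_sub => //; last by apply: KZ => //; exact: ltW.
      rewrite Ev; exists c => //; exact: ltW.
    apply/PhiP => //; first by apply: KZ => //; exact: ltW.
    split=> //; exists c => //; by rewrite subrr.
  rewrite Ev; apply/seteqP; split=> q [l l0 ->].
    exists (l / c); first by rewrite divr_ge0 // ltW.
    by rewrite scalerA divfK // lt0r_neq0.
  by exists (l * c); rewrite ?scalerA // mulr_ge0 // ltW.
exists ([seq (1 - t * s)^-1 *: v | v <- sz] ++
        [seq (t / (1 - t * s)) *: v | v <- sw]).
  move=> v; rewrite mem_cat => /orP[/mapP[q qs ->]|/mapP[q qs ->]]; apply: sc.
  - by rewrite invr_gt0.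
  - exact: Hsz.
  - by rewrite divr_gt0.
  - exact: Hsw.
rewrite big_cat !big_map /= -!scaler_sumr -ez -ew [t / _]mulrC -scalerA -scalerDr -e1.
by rewrite scalerA mulVf ?scale1r // lt0r_neq0.
Qed.

End Minkowski.

(** * Cones with a single linear relation *)

Section Frames.
Variables (R : realType) (n m : nat).
Implicit Types (K : set 'cV[R]_n) (e : 'I_m -> 'cV[R]_n) (r a b c d : 'I_m -> R).

Definition lincomb e a : 'cV[R]_n := \sum_i a i *: e i.

(* [K] is the cone generated by the [e i], whose linear relations are exactly
   the multiples of [r]; the last two conditions make every [e i] extreme. *)
Record cone_frame K e r : Prop := ConeFrame {
  frame_gen : forall x, K x <-> exists2 a, (forall i, 0 <= a i) & x = lincomb e a;
  frame_ker : forall c, lincomb e c = 0 <-> exists t, forall i, c i = t * r i;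
  frame_pos : forall i0, exists2 i, i != i0 & 0 < r i;
  frame_neg : forall i0, exists2 i, i != i0 & r i < 0 }.

Definition pos_set r : {set 'I_m} := [set i | 0 < r i]%SET.
Definition neg_set r : {set 'I_m} := [set i | r i < 0]%SET.

Lemma lincombD e a b : lincomb e (fun i => a i + b i) = lincomb e a + lincomb e b.
Proof. by rewrite /lincomb -big_split; apply: eq_bigr => i _; rewrite scalerDl. Qed.

Lemma lincombZ e l a : lincomb e (fun i => l * a i) = l *: lincomb e a.
Proof. by rewrite /lincomb scaler_sumr; apply: eq_bigr => i _; rewrite scalerA. Qed.

Lemma lincombB e a b : lincomb e (fun i => a i - b i) = lincomb e a - lincomb e b.
Proof. by rewrite /lincomb -sumrB; apply: eq_bigr => i _; rewrite scalerBl. Qed.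

Lemma lincomb_delta e j : lincomb e (fun i => (i == j)%:R) = e j.
Proof.
rewrite /lincomb (bigD1 j) //= eqxx scale1r big1 ?addr0 // => i /negPf ->.
by rewrite scale0r.
Qed.

Lemma mulmx_lincomb A e a : A *m lincomb e a = lincomb (fun i => A *m e i) a.
Proof. by rewrite /lincomb mulmx_sumr; apply: eq_bigr => i _; rewrite scalemxAr. Qed.

Section OneFrame.
Variables (K : set 'cV[R]_n) (e : 'I_m -> 'cV[R]_n) (r : 'I_m -> R).
Hypothesis fK : cone_frame K e r.

Lemma frame_opp : cone_frame K e (fun i => - r i).
Proof.
case: fK => G H P N; split=> //.
- move=> c; rewrite H; split=> -[t Ht]; exists (- t) => i; rewrite Ht; ring.
- by move=> i0; have [i ii ri] := N i0; exists i; rewrite // oppr_gt0.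
- by move=> i0; have [i ii ri] := P i0; exists i; rewrite // oppr_lt0.
Qed.

Lemma frame_lincomb_eq a b : lincomb e a = lincomb e b ->
  exists t, forall i, a i = b i + t * r i.
Proof.
move/eqP; rewrite -subr_eq0 -lincombB => /eqP/(frame_ker fK)[t Ht].
by exists t => i; rewrite -Ht; ring.
Qed.

Lemma frame_lincombP c : K (lincomb e c) <-> exists t, forall i, 0 <= c i + t * r i.
Proof.
split=> [/(frame_gen fK)[a a0 /esym/frame_lincomb_eq[t Ht]]|[t Ht]].
  by exists t => i; rewrite -Ht.
apply/(frame_gen fK); exists (fun i => c i + t * r i) => //.
rewrite lincombD lincombZ.
by have /(frame_ker fK) -> : exists s, forall i, r i = s * r i;
  [exists 1 => i; rewrite mul1r|rewrite scaler0 addr0].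
Qed.

Lemma frame_cone : convex_cone K.
Proof.
split.
- apply/(frame_gen fK); exists (fun=> 0) => //.
  by rewrite /lincomb big1 // => i _; rewrite scale0r.
- move=> _ _ /(frame_gen fK)[a a0 ->] /(frame_gen fK)[b b0 ->].
  apply/(frame_gen fK); exists (fun i => a i + b i); last by rewrite lincombD.
  by move=> i; rewrite addr_ge0.
- move=> l _ l0 /(frame_gen fK)[a a0 ->].
  apply/(frame_gen fK); exists (fun i => l * a i); last by rewrite lincombZ.
  by move=> i; rewrite mulr_ge0.
Qed.

Lemma frame_K a : (forall i, 0 <= a i) -> K (lincomb e a).
Proof. by move=> a0; apply/(frame_gen fK); exists a. Qed.

Lemma frame_Ke i : K (e i).
Proof. by rewrite -lincomb_delta; apply: frame_K => j; rewrite ler0n. Qed.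

(** The relation takes both signs away from [i0], so none of its nonzero multiples is nonnegative
    there. *)
Lemma frame_relation_ge0 t a (i0 : 'I_m) :
  (forall i, i != i0 -> 0 <= a i) -> (forall i, i != i0 -> a i = t * r i) ->
  forall i, i != i0 -> a i = 0.
Proof.
move=> a0 Ha i ii; suff t0 : t = 0 by rewrite Ha // t0 mul0r.
have [p pp rp] := frame_pos fK i0; have [q qq rq] := frame_neg fK i0.
apply/eqP; rewrite eq_le; apply/andP; split.
  by have := a0 q qq; rewrite Ha // nmulr_lge0.
by have := a0 p pp; rewrite Ha // pmulr_lge0.
Qed.

Lemma frame_relation0 t i0 j0 : (forall i, i != i0 -> i != j0 -> 0 = t * r i) -> t = 0.
Proof.
move=> H; have [p pi0 rp] := frame_pos fK i0; have [q qi0 rq] := frame_neg fK i0.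
have [pj0|pj0] := eqVneq p j0.
  have qj0 : q != j0 by apply/eqP => qj0; move: rp rq; rewrite pj0 qj0; lra.
  by have /esym/eqP := H q qi0 qj0; rewrite mulf_eq0 (lt_eqF rq) orbF => /eqP.
by have /esym/eqP := H p pi0 pj0; rewrite mulf_eq0 (gt_eqF rp) orbF => /eqP.
Qed.

Lemma frame_neq0 i : e i != 0.
Proof.
apply/eqP => ei; have /(frame_ker fK)[t Ht] : lincomb e (fun j => (j == i)%:R) = 0.
  by rewrite lincomb_delta.
have t0 : t = 0.
  by apply: (@frame_relation0 t i i) => j ji _; rewrite -Ht (negPf ji).
by have /eqP := Ht i; rewrite t0 eqxx mul0r oner_eq0.
Qed.

Lemma frame_distinct i j l : i != j -> e i <> l *: e j.
Proof.
move=> ij E; have /(frame_ker fK)[t Ht] :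
    lincomb e (fun k => (k == i)%:R - l * (k == j)%:R) = 0.
  by rewrite lincombB lincombZ !lincomb_delta E subrr.
have t0 : t = 0.
  apply: (@frame_relation0 t i j) => k ki kj.
  by rewrite -Ht (negPf ki) (negPf kj) mulr0 subr0.
by have /eqP := Ht i; rewrite t0 eqxx (negPf ij) mul0r mulr0 subr0 oner_eq0.
Qed.

Lemma frame_pointed : pointed_cone K.
Proof.
move=> x /(frame_gen fK)[a a0 xa] /(frame_gen fK)[b b0 xb].
have /(frame_ker fK)[t Ht] : lincomb e (fun i => a i + b i) = 0.
  by rewrite lincombD -xa -xb subrr.
have ab0 i : a i + b i = 0.
  have [p pi _] := frame_pos fK i.
  apply: (@frame_relation_ge0 t (fun i => a i + b i) p) => //.
    by move=> j _; rewrite addr_ge0.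
  by rewrite eq_sym.
rewrite xa /lincomb big1 // => i _.
by have := ab0 i; have := a0 i; have := b0 i => b0i a0i abi;
  rewrite (_ : a i = 0) ?scale0r //; lra.
Qed.

Lemma frame_ray i : Phi K (e i) = ray (e i).
Proof.
have cK := frame_cone; apply/seteqP; split=> [y|y [l l0 ->]]; last first.
  case: (Phi_face cK (frame_Ke i)) => -[_ _ FZ] _ _; apply: FZ => //.
  exact: Phi_refl.
move=> /(PhiP _ cK (frame_Ke i)) [/(frame_gen fK)[b b0 yb] [l l0]].
move=> /(frame_gen fK)[c c0 E].
have /(frame_ker fK)[t Ht] :
    lincomb e (fun j => (l * b j + c j) - (j == i)%:R) = 0.
  by rewrite lincombB lincombD lincombZ -E -yb lincomb_delta [l *: y + _]addrC subrK subrr.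
have bc j : j != i -> l * b j + c j = 0.
  move=> ji; apply: (@frame_relation_ge0 t (fun j => l * b j + c j) i) => //.
    by move=> k _; rewrite addr_ge0 // mulr_ge0 // ltW.
  by move=> k ki; rewrite -Ht (negPf ki) subr0.
have b1 j : j != i -> b j = 0.
  move=> /bc H; have : l * b j = 0.
    by have := mulr_ge0 (ltW l0) (b0 j); have := c0 j; move: H; lra.
  by move=> /eqP; rewrite mulf_eq0 (gt_eqF l0) => /eqP.
exists (b i) => //; rewrite yb /lincomb (bigD1 i) //= big1 ?addr0 // => j ji.
by rewrite b1 // scale0r.
Qed.

Lemma frame_extreme i : extreme_vector K (e i).
Proof. by split; [exact: frame_Ke|exact: frame_neq0|exact: frame_ray]. Qed.

Lemma frame_extremeP v : extreme_vector K v <-> exists i l, 0 < l /\ v = l *: e i.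
Proof.
have cK := frame_cone; split=> [[Kv v0 Ev]|[i [l [l0 ->]]]].
  have /(frame_gen fK)[a a0 va] := Kv.
  have [i ai] : exists i, 0 < a i.
    apply: contrapT => H; case/eqP: v0; rewrite va /lincomb big1 // => i _.
    rewrite (_ : a i = 0) ?scale0r //; apply/eqP; rewrite eq_le a0 andbT leNgt.
    by apply/negP => ai; apply: H; exists i.
  have : Phi K v (e i).
    apply/PhiP => //; split; first exact: frame_Ke.
    exists (a i) => //; rewrite va -[in X in _ - X](lincomb_delta e i).
    rewrite -lincombZ -lincombB; apply: frame_K => j.
    by case: eqP => [->|_]; rewrite ?mulr1 ?mulr0 ?subrr ?subr0.
  rewrite Ev => -[l l0 E].
  have l1 : 0 < l.
    rewrite lt_neqAle l0 andbT eq_sym; apply/eqP => l00.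
    by have /eqP := frame_neq0 i; rewrite E l00 scale0r.
  exists i, l^-1; split; first by rewrite invr_gt0.
  by rewrite E scalerA mulVf ?scale1r // gt_eqF.
have Kl : K (l *: e i) by case: cK => _ _; apply; [exact: ltW|exact: frame_Ke].
split=> //; first by rewrite scaler_eq0 negb_or frame_neq0 gt_eqF.
apply/seteqP; split=> y.
  have il : Phi K (e i) (l *: e i) by rewrite frame_ray; exists l => //; exact: ltW.
  move=> /(Phi_sub il (frame_Ke i) cK); rewrite frame_ray => -[k k0 ->].
  exists (k / l); first by rewrite divr_ge0 // ltW.
  by rewrite scalerA divfK // gt_eqF.
move=> [k k0 ->]; case: (Phi_face cK Kl) => -[_ _ FZ] _ _; apply: FZ => //.
exact: Phi_refl.
Qed.

Lemma frame_PhiZ x l : 0 < l -> K x -> Phi K (l *: x) = Phi K x.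
Proof.
have cK := frame_cone => l0 Kx.
have Kl : K (l *: x) by case: cK => _ _; apply=> //; exact: ltW.
apply/seteqP; split; apply: Phi_sub => //.
  case: (Phi_face cK Kx) => -[_ _ FZ] _ _; apply: FZ; first exact: ltW.
  exact: Phi_refl.
rewrite -[x in Phi _ _ x]scale1r -(mulVf (lt0r_neq0 l0)) -scalerA.
case: (Phi_face cK Kl) => -[_ _ FZ] _ _; apply: FZ; first by rewrite invr_ge0 ltW.
exact: Phi_refl.
Qed.

Lemma frame_Phi_inj i j : Phi K (e i) = Phi K (e j) -> i = j.
Proof.
move=> E; apply/eqP/negPn/negP => ij; have : Phi K (e j) (e i).
  by rewrite -E; exact: Phi_refl.
by rewrite frame_ray => -[l _]; exact: frame_distinct.
Qed.

Lemma frame_pos_card (i0 : 'I_m) : (1 < #|pos_set r|)%N.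
Proof.
have [i _ ri] := frame_pos fK i0; have [j ji rj] := frame_pos fK i.
apply: (@leq_trans #|[set i; j]%SET|); first by rewrite finset.cards2 eq_sym ji.
apply/subset_leq_card/fintype.subsetP => k.
by rewrite !inE => /orP[]/eqP->.
Qed.

Lemma frame_neg_card (i0 : 'I_m) : (1 < #|neg_set r|)%N.
Proof.
have [i _ ri] := frame_neg fK i0; have [j ji rj] := frame_neg fK i.
apply: (@leq_trans #|[set i; j]%SET|); first by rewrite finset.cards2 eq_sym ji.
apply/subset_leq_card/fintype.subsetP => k.
by rewrite !inE => /orP[]/eqP->.
Qed.

Lemma pos_neg_disjoint : [disjoint pos_set r & neg_set r]%B.
Proof. by apply/pred0P => i /=; rewrite !inE; apply/negP => /andP[]; lra. Qed.

End OneFrame.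
End Frames.

(** * Faces of a framed cone and the action of a matrix on them *)

Section Supports.
Variables (R : realType) (n m : nat).
Implicit Types (K : set 'cV[R]_n) (e : 'I_m -> 'cV[R]_n) (r a b c d : 'I_m -> R).

Lemma exists_pos_scale (f g : 'I_m -> R) : (forall i, 0 <= f i) ->
  (forall i, 0 < g i -> 0 < f i) -> exists2 t, 0 < t & forall i, t * g i <= f i.
Proof.
(* Where [f i = 0] the quotient is 0 by convention, and [g i <= 0] by hypothesis. *)
move=> f0 gf; pose s := 1 + \sum_i `|g i| / f i.
have s0 : 0 < s by rewrite ltr_pwDl // sumr_ge0 // => i _; rewrite divr_ge0.
exists s^-1 => [|i]; first by rewrite invr_gt0.
have [gi|gi] := ltP 0 (g i); last first.
  by apply: le_trans (f0 i); rewrite pmulr_rle0 ?invr_gt0.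
rewrite ler_pdivrMl // -ler_pdivrMr ?gf // -[g i]gtr0_norm // /s (bigD1 i) //=.
by rewrite addrCA lerDl addr_ge0 // sumr_ge0 // => j _; rewrite divr_ge0.
Qed.

Definition supp K e x : {set 'I_m} := [set j | `[< Phi K x (e j) >]]%SET.

Lemma in_supp K e x j : (j \in supp K e x) <-> Phi K x (e j).
Proof. by rewrite inE; split=> /asboolP. Qed.

Lemma frame_Phi_pos K e r a j : cone_frame K e r -> (forall i, 0 <= a i) ->
  neg_set r \subset [set i | 0 < a i]%SET -> 0 < r j -> Phi K (lincomb e a) (e j).
Proof.
move=> fK a0 /fintype.subsetP ra rj.
have [i|t t0 Ht] := @exists_pos_scale a (fun i => - r i) a0.
  by rewrite oppr_gt0 => ri; have := ra i; rewrite !inE ri => /(_ isT).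
apply/(PhiP _ (frame_cone fK) (frame_K fK a0)); split; first exact: frame_Ke fK _.
exists (t * r j); first exact: mulr_gt0.
rewrite -[e j](lincomb_delta e) -lincombZ -lincombB; apply/(frame_lincombP fK).
exists t => i; have := Ht i; have := a0 i; case: eqP => [->|_]; rewrite ?mulr1 ?mulr0; lra.
Qed.

Section Frame.
Variables (K : set 'cV[R]_n) (e : 'I_m -> 'cV[R]_n) (r : 'I_m -> R).
Hypothesis fK : cone_frame K e r.

Local Notation closure_r := (face_closure (pos_set r) (neg_set r)).

(** The coefficients of a vector may be changed by multiples of [r] only. So [e j] with [a j = 0] is
    in the face iff some [a + t r] is nonnegative and positive at [j], which forces [a] to be
    positive wherever [t r] is negative. *)
Lemma supp_lincomb a : (forall i, 0 <= a i) ->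
  supp K e (lincomb e a) = closure_r [set i | 0 < a i]%SET.
Proof.
move=> a0; apply/finset.setP => j; apply/idP/idP.
  move=> /in_supp/(PhiP _ (frame_cone fK) (frame_K fK a0)) [_ [l l0]].
  rewrite -[e j](lincomb_delta e) -lincombZ -lincombB => /(frame_lincombP fK) [t Ht].
  have Ht' i : i != j -> 0 <= a i + t * r i.
    by move=> ij; have := Ht i; rewrite (negPf ij) mulr0 subr0.
  have Hj : 0 < a j + t * r j by have := Ht j; rewrite eqxx mulr1; lra.
  rewrite /face_closure !inE; have [//|aj] := ltP 0 (a j).
  have tr : 0 < t * r j by lra.
  have [t0|t0|t0] := ltgtP t 0; last by move: tr; rewrite t0 mul0r ltxx.
    have rj : r j < 0 by move: tr; rewrite nmulr_rgt0.
    have -> : pos_set r \subset [set i | 0 < a i]%SET; last by rewrite inE rj orbT.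
    apply/fintype.subsetP => i; rewrite !inE => ri.
    have ij : i != j by apply/eqP => ij; move: ri rj; rewrite ij; lra.
    have : t * r i < 0 by rewrite nmulr_rlt0.
    by have := Ht' i ij; lra.
  have rj : 0 < r j by move: tr; rewrite pmulr_rgt0.
  have -> : neg_set r \subset [set i | 0 < a i]%SET; last by rewrite inE rj.
  apply/fintype.subsetP => i; rewrite !inE => ri.
  have ij : i != j by apply/eqP => ij; move: ri rj; rewrite ij; lra.
  have : t * r i < 0 by rewrite pmulr_rlt0.
  by have := Ht' i ij; lra.
move=> H; apply/in_supp; move: H.
rewrite /face_closure !inE => /orP[/orP[aj|]|].
- apply/(PhiP _ (frame_cone fK) (frame_K fK a0)); split; first exact: frame_Ke fK _.
  exists (a j) => //; rewrite -[e j](lincomb_delta e) -lincombZ -lincombB.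
  apply: (frame_K fK) => i.
  by case: eqP => [->|_]; rewrite ?mulr1 ?mulr0 ?subrr ?subr0.
- by case: ifP => [ra|]; rewrite inE // => rj; exact: frame_Phi_pos fK _ ra rj.
- case: ifP => [ra|]; rewrite inE // => rj.
  apply: (frame_Phi_pos (frame_opp fK) a0); last by rewrite oppr_gt0.
  apply: fintype.subset_trans ra; apply/fintype.subsetP => i.
  by rewrite !inE oppr_lt0.
Qed.

Lemma supp_closed x : K x -> closure_r (supp K e x) = supp K e x.
Proof. by case/(frame_gen fK) => a a0 ->; rewrite supp_lincomb // face_closure_idem. Qed.

Lemma supp_sub x y : K x -> Phi K x y -> supp K e y \subset supp K e x.
Proof.
move=> Kx xy; apply/fintype.subsetP => j /in_supp yj; apply/in_supp.
exact: (Phi_sub xy Kx (frame_cone fK)).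
Qed.

Lemma supp_e j : supp K e (e j) = [set j]%SET.
Proof.
rewrite -[in LHS](lincomb_delta e j) supp_lincomb; last by move=> i; rewrite ler0n.
have -> : [set i | 0 < ((i == j)%:R : R)]%SET = [set j]%SET.
  by apply/finset.setP => i; rewrite !inE; case: eqP; rewrite ?ltr01 ?ltxx.
by rewrite face_closure_small // finset.cards1;
  [exact: frame_pos_card fK j|exact: frame_neg_card fK j].
Qed.

Lemma Phi_e_sub x j : K x -> (Phi K (e j) `<=` Phi K x <-> j \in supp K e x).
Proof.
move=> Kx; rewrite in_supp; split=> [H|xj]; first by apply: H; exact: Phi_refl.
by apply: Phi_sub => //; exact: (frame_cone fK).
Qed.

Lemma supp_full x : (exists u : 'cV[R]_n, nbhs u K) -> K x ->
  (K° x <-> supp K e x = finset.setT).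
Proof.
move=> [u Ku] Kx; rewrite (interior_PhiP (frame_cone fK) Ku Kx); split=> H.
  by apply/finset.setP => j; rewrite finset.in_setT; apply/idP; apply/in_supp;
    apply: H; exact: (frame_Ke fK).
move=> y /(frame_gen fK) [a a0 ->]; case: (Phi_face (frame_cone fK) Kx) => cP _ _.
apply: convex_cone_sum => // i _; case: cP => _ _; apply=> //.
by apply/in_supp; rewrite H finset.in_setT.
Qed.

Section Preserved.
Variable A : 'M[R]_n.
Hypothesis KA : preserves K A.

Definition successors j := supp K e (A *m e j).

Local Notation step_A := (face_step (pos_set r) (neg_set r) successors).

Lemma Phi_mulmx x y : K x -> Phi K x y -> Phi K (A *m x) (A *m y).
Proof.
move=> Kx /(PhiP _ (frame_cone fK) Kx) [Ky [l l0 H]].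
apply/(PhiP _ (frame_cone fK) (KA Kx)); split; first exact: KA.
by exists l => //; rewrite scalemxAr -mulmxBr; exact: KA.
Qed.

Lemma supp_mulmx_lincomb a : (forall i, 0 <= a i) ->
  supp K e (A *m lincomb e a) = step_A [set i | 0 < a i]%SET.
Proof.
move=> a0; apply/eqP; rewrite finset.eqEsubset; apply/andP; split; last first.
  rewrite -(supp_closed (KA (frame_K fK a0))); apply: face_closure_mono.
  apply/finset.bigcupsP => i; rewrite inE => ai; apply: supp_sub.
    exact/KA/(frame_K fK).
  apply: Phi_mulmx; first exact: (frame_K fK).
  apply/in_supp; rewrite supp_lincomb //; apply: (fintype.subsetP (face_closure_sub _ _ _)).
  by rewrite inE.
have Hc i : exists c, (forall j, 0 <= c j) /\ A *m e i = lincomb e c.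
  by have /(frame_gen fK) [c c0 ->] := KA (frame_Ke fK i); exists c.
pose c i := projT1 (cid (Hc i)).
have c0 i j : 0 <= c i j by rewrite /c; case: cid => /= ? [].
have cE i : A *m e i = lincomb e (c i) by rewrite /c; case: cid => /= ? [].
have -> : A *m lincomb e a = lincomb e (fun j => \sum_i a i * c i j).
  rewrite mulmx_lincomb /lincomb; under eq_bigr do rewrite cE /lincomb scaler_sumr.
  rewrite exchange_big /=; apply: eq_bigr => j _; rewrite scaler_suml.
  by apply: eq_bigr => i _; rewrite scalerA.
rewrite supp_lincomb; last by move=> j; rewrite sumr_ge0 // => i _; rewrite mulr_ge0.
apply: face_closure_mono; apply/fintype.subsetP => j; rewrite inE => H.
have [i ai ci] : exists2 i, 0 < a i & 0 < c i j.
  apply: contrapT => nH; move: H; rewrite big1 ?ltxx // => i _.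
  apply/eqP; rewrite mulf_eq0 -[_ || _]negbK negb_or; apply/negP => /andP[ai ci].
  by apply: nH; exists i; rewrite lt_neqAle eq_sym ?ai ?ci /=.
apply/finset.bigcupP; exists i; first by rewrite inE.
rewrite /successors cE supp_lincomb //; apply: (fintype.subsetP (face_closure_sub _ _ _)).
by rewrite inE.
Qed.

Lemma supp_mulmx x : K x -> supp K e (A *m x) = step_A (supp K e x).
Proof.
move=> Kx; apply/eqP; rewrite finset.eqEsubset; apply/andP; split.
  have /(frame_gen fK) [a a0 ->] := Kx; rewrite supp_mulmx_lincomb //.
  by apply: face_step_mono; rewrite supp_lincomb // face_closure_sub.
rewrite -(supp_closed (KA Kx)); apply: face_closure_mono.
apply/finset.bigcupsP => i /in_supp xi; apply: supp_sub; first exact: KA.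
exact: Phi_mulmx.
Qed.

Lemma preserves_exp k x : K x -> K (A ^+ k *m x).
Proof.
move=> Kx; elim: k => [|k IH]; first by rewrite expr0 mul1mx.
by rewrite exprS -mulmxE -mulmxA; exact: KA.
Qed.

Lemma supp_exp k x : K x -> supp K e (A ^+ k *m x) = iter k step_A (supp K e x).
Proof.
move=> Kx; elim: k => [|k IH]; first by rewrite expr0 mul1mx.
rewrite exprS -mulmxE -mulmxA supp_mulmx; last exact: preserves_exp.
by rewrite IH.
Qed.

(** The two sides of the relation are one and the same vector, so [A] maps them to the same face. *)
Lemma successors_compatible :
  closure_r (\bigcup_(i in pos_set r) successors i)%SET =
  closure_r (\bigcup_(i in neg_set r) successors i)%SET.
Proof.
pose a i := Num.max (r i) 0; pose b i := Num.max (- r i) 0.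
have a0 i : 0 <= a i by rewrite le_max lexx orbT.
have b0 i : 0 <= b i by rewrite le_max lexx orbT.
have E : lincomb e a = lincomb e b.
  apply/eqP; rewrite -subr_eq0 -lincombB; apply/eqP/(frame_ker fK); exists 1 => i.
  by rewrite /a /b; case: (leP (r i) 0); case: (leP (- r i) 0); lra.
have Ea : [set i | 0 < a i]%SET = pos_set r.
  by apply/finset.setP => i; rewrite !inE lt_max ltxx orbF.
have Eb : [set i | 0 < b i]%SET = neg_set r.
  by apply/finset.setP => i; rewrite !inE lt_max ltxx orbF oppr_gt0.
by have := supp_mulmx_lincomb a0; rewrite E supp_mulmx_lincomb // Ea Eb => /esym.
Qed.

Lemma positive_powerP p : (exists u : 'cV[R]_n, nbhs u K) ->
  positive_power K A p <->
  forall j, face_iter (pos_set r) (neg_set r) successors p j = finset.setT.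
Proof.
move=> Ku; split=> H.
  move=> j; have := H (e j) (frame_Ke fK j) (frame_neq0 fK j).
  rewrite (supp_full Ku) ?supp_exp ?supp_e //; first exact: frame_Ke fK j.
  exact/preserves_exp/(frame_Ke fK).
move=> x Kx x0; apply/(supp_full Ku (preserves_exp _ Kx)).
rewrite supp_exp //; have /finset.set0Pn[i ix] : supp K e x != finset.set0.
  apply: contra_neq x0 => E; have /(frame_gen fK) [a a0 xE] := Kx.
  move: E; rewrite xE supp_lincomb // => E; rewrite /lincomb big1 // => i _.
  rewrite (_ : a i = 0) ?scale0r //; apply/eqP; rewrite eq_le a0 andbT leNgt.
  apply/negP => ai; have : i \in closure_r [set i | 0 < a i]%SET.
    by apply: (fintype.subsetP (face_closure_sub _ _ _)); rewrite inE.
  by rewrite E inE.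
apply/eqP; rewrite -finset.subTset -(H i); apply: iter_face_step_mono.
by rewrite finset.sub1set.
Qed.

End Preserved.
End Frame.
End Supports.

(** * Every minimal cone has a frame *)

Section FramesOfMinimalCones.
Variables (R : realType) (n : nat).
Implicit Types (K : set 'cV[R]_n).

Lemma extreme_labelling_of_bij K m (f : 'I_m -> set 'cV[R]_n) :
  set_bij [set: 'I_m] (extreme_rays K) f ->
  exists2 x : 'I_m -> 'cV[R]_n, extreme_labelling K x & forall i, f i = Phi K (x i).
Proof.
move=> bf; have [ff _ _] := bf.
have H i : exists x, extreme_vector K x /\ f i = Phi K x.
  by have [x xe fx] := ff i I; exists x.
pose x i := projT1 (cid (H i)).
have xe i : extreme_vector K (x i) by rewrite /x; case: cid => /= ? [].
have fx : f = fun i => Phi K (x i).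
  by apply/funext => i; rewrite /x; case: cid => /= ? [].
by exists x => [|i]; [split=> //; rewrite -fx|rewrite fx].
Qed.

Lemma minimal_cone_labelling d K : minimal_cone d K ->
  exists x : 'I_d.+1 -> 'cV[R]_n, extreme_labelling K x.
Proof.
move=> [_]; rewrite card_eq_sym => /card_set_bijP [f [ff fi fs]].
have [|x xl _] := @extreme_labelling_of_bij K d.+1 (fun i => f i); last by exists x.
split=> [i _|i j _ _ fij|F /fs [k kd fk]].
- by apply: ff; exact: ltn_ord.
- by apply/val_inj/fi; rewrite ?inE //=; exact: ltn_ord.
- by exists (Ordinal kd).
Qed.

Lemma extreme_labelling_inj K m (x : 'I_m -> 'cV[R]_n) i j (l : R) :
  extreme_labelling K x -> x i = l *: x j -> 0 <= l -> i = j.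
Proof.
move=> [xe [_ xi _]] E l0; apply: xi; rewrite ?in_setT //.
have [_ xi0 ->] := xe i; have [_ _ ->] := xe j.
have l1 : l != 0 by apply: contra_neq xi0 => l00; rewrite E l00 scale0r.
rewrite E; apply/seteqP; split=> y [k k0 ->].
  by exists (k * l); rewrite ?scalerA // mulr_ge0.
by exists (k / l); rewrite ?divr_ge0 // scalerA divfK.
Qed.

(** If no coefficient is positive off [i0], then either all are nonpositive, against pointedness, or
    [x i0] is a nonnegative combination of the others, against its extremality. *)
Lemma extreme_relation_sign K m (x : 'I_m -> 'cV[R]_n) (r : 'I_m -> R) :
  convex_cone K -> pointed_cone K -> extreme_labelling K x ->
  lincomb x r = 0 -> (exists i, r i != 0) ->
  forall i0, exists2 i, i != i0 & 0 < r i.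
Proof.
move=> cK pK xl r0 [k0 rk0] i0; have [xe _] := xl; have [K0 KD KZ] := cK.
have Kx i : K (x i) by case: (xe i).
have xn0 i : x i != 0 by case: (xe i).
apply: contrapT => H.
have rle i : i != i0 -> r i <= 0.
  by move=> ii; rewrite leNgt; apply/negP => ri; apply: H; exists i.
have sumE j : r j *: x j = \sum_(i | i != j) (- r i) *: x i.
  move: r0; rewrite /lincomb (bigD1 j) //= => /eqP; rewrite addr_eq0 => /eqP ->.
  by rewrite -sumrN; apply: eq_bigr => i _; rewrite scaleNr.
have Ksum (P : pred 'I_m) : (forall i, P i -> r i <= 0) ->
    K (\sum_(i | P i) (- r i) *: x i).
  move=> HP; apply: convex_cone_sum => // i Pi.
  by apply: KZ => //; rewrite oppr_ge0 HP.
have [ri0|ri0] := leP (r i0) 0.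
  have rle' i : r i <= 0 by have [->|/rle] := eqVneq i i0.
  have : (- r k0) *: x k0 = 0.
    apply: pK; first by apply: KZ; rewrite ?oppr_ge0.
    by rewrite scaleNr opprK sumE; exact: Ksum.
  by move/eqP; rewrite scaler_eq0 oppr_eq0 (negPf rk0) (negPf (xn0 k0)).
have [j ji rj] : exists2 j, j != i0 & r j < 0.
  apply: contrapT => nj; have := sumE i0; rewrite big1 => [/eqP|i ii].
    by rewrite scaler_eq0 (gt_eqF ri0) (negPf (xn0 i0)).
  rewrite (_ : r i = 0) ?oppr0 ?scale0r //; apply/eqP; rewrite eq_le rle //= leNgt.
  by apply/negP => ri; apply: nj; exists i.
have : Phi K (x i0) (x j).
  apply/PhiP => //; split=> //; exists (- r j / r i0).
    by rewrite divr_gt0 // oppr_gt0.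
  have -> : x i0 - (- r j / r i0) *: x j =
      (r i0)^-1 *: (r i0 *: x i0 - (- r j) *: x j).
    by rewrite scalerBr !scalerA mulVf ?gt_eqF // scale1r [(r i0)^-1 * _]mulrC.
  apply: KZ; first by rewrite invr_ge0 ltW.
  rewrite sumE (bigD1 j) //= addrAC subrr add0r; apply: Ksum => i /andP[ii _].
  exact: rle.
case: (xe i0) => _ _ -> [l l0 E].
by move: ji; rewrite (extreme_labelling_inj xl E l0) eqxx.
Qed.

Lemma row_lincomb m (x : 'I_m -> 'cV[R]_n) (c : 'rV[R]_m) :
  c *m (\matrix_(i < m) (x i)^T) = (lincomb x (c 0))^T.
Proof.
apply/rowP => k; rewrite !mxE summxE; apply: eq_bigr => i _.
by rewrite !mxE.
Qed.

(** By Minkowski's theorem the [n.+1] extreme vectors generate [K]. They span the whole space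
    because [K] has interior points, so their relations form a line. *)
Theorem minimal_cone_frame K (x : 'I_n.+1 -> 'cV[R]_n) :
  minimal_cone n K -> extreme_labelling K x -> exists r, cone_frame K x r.
Proof.
move=> [[cK clK pK [V [[KV _] dV [u Ku nu]]]] _] xl; have [xe [_ _ xs]] := xl.
have [K0 KD KZ] := cK.
have Vfull : V = fullv by apply/eqP; rewrite eqEdim subvf dimvf /dim /= muln1 dV.
have {}nu : nbhs u K by apply: filterS nu => y; apply; rewrite Vfull memvf.
have gen y : K y <-> exists2 a, (forall i, 0 <= a i) & y = lincomb x a.
  split=> [Ky|[a a0 ->]]; last first.
    by apply: convex_cone_sum => // i _; apply: KZ => //; case: (xe i).
  have [s se ->] := closed_pointed_cone_extreme_sum cK clK pK Ky.
  elim: s se {Ky} => [|v s IH] se.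
    exists (fun=> 0) => //; rewrite big_nil /lincomb big1 // => i _.
    by rewrite scale0r.
  have [a a0 E] := IH (fun w ws => se w (mem_behead (s := v :: s) ws)).
  have ve := se v (mem_head _ _).
  have [i _ vi] := xs (Phi K v) (ex_intro2 _ _ v ve erefl).
  have [l l0 vl] : exists2 l, 0 <= l & v = l *: x i.
    have [_ _ Ei] := xe i; have : ray (x i) v by rewrite -Ei vi; exact: Phi_refl.
    by case=> l l0 ->; exists l.
  exists (fun j => l * (j == i)%:R + a j).
    by move=> j; rewrite addr_ge0 // mulr_ge0 // ler0n.
  by rewrite big_cons E lincombD lincombZ lincomb_delta -vl.
pose M := \matrix_(i < n.+1) (x i)^T.
have full : row_full M.
  rewrite -sub1mx; apply/row_subP => k.
  (* A basis vector is a multiple of the difference of two elements of [K], namely an interior point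
     [u] and [u] moved slightly. *)
  have [l l0 Kl] := nbhs_cone_sub (row k 1%:M)^T nu.
  have /gen [a _ Ea] := Ku; have /gen [b _ Eb] := Kl.
  have -> : row k 1%:M = (\row_i ((a i - b i) / l)) *m M.
    rewrite row_lincomb -[LHS]trmxK; congr trmx.
    have -> : lincomb x ((\row_i ((a i - b i) / l)) 0) =
        lincomb x (fun i => l^-1 * (a i - b i)).
      by apply: eq_bigr => i _; rewrite mxE mulrC.
    rewrite lincombZ lincombB -Ea -Eb opprB addrCA subrr addr0.
    by rewrite scalerA mulVf ?scale1r // gt_eqF.
  exact: submxMl.
have rk : \rank (kermx M) = 1%N.
  by rewrite mxrank_ker (eqP full) subSnn.
have : kermx M != 0 by rewrite -mxrank_eq0 rk.
case/rowV0Pn => r rM r0.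
have rker : r *m M = 0 by apply/sub_kermxP.
have xr : lincomb x (r 0) = 0.
  by apply: trmx_inj; rewrite -row_lincomb rker trmx0.
have ker c : lincomb x c = 0 <-> exists t, forall i, c i = t * r 0 i.
  split=> [c0|[t Ht]]; last first.
    have -> : lincomb x c = lincomb x (fun i => t * r 0 i).
      by apply: eq_bigr => i _; rewrite Ht.
    by rewrite lincombZ xr scaler0.
  have : ((\row_i c i) <= kermx M)%MS.
    apply/sub_kermxP; rewrite row_lincomb.
    have -> : lincomb x ((\row_i c i) 0) = lincomb x c.
      by apply: eq_bigr => i _; rewrite mxE.
    by rewrite c0 trmx0.
  have kr : (kermx M <= r)%MS.
    by rewrite -(geq_leqif (mxrank_leqif_sup rM)) rk rank_rV r0.
  move=> /submx_trans /(_ kr) /sub_rVP [t Et].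
  by exists t => i; have /rowP/(_ i) := Et; rewrite !mxE.
have rn0 : exists i, r 0 i != 0.
  apply: contrapT => H; case/eqP: r0; apply/rowP => i; rewrite mxE.
  by apply/eqP/negPn/negP => ri; apply: H; exists i.
exists (r 0); split=> //; first exact: (extreme_relation_sign cK pK xl xr rn0).
move=> i0; have [| |i ii ri] :=
    @extreme_relation_sign K _ x (fun i => - r 0 i) cK pK xl _ _ i0.
- have -> : lincomb x (fun i => - r 0 i) = lincomb x (fun i => -1 * r 0 i).
    by apply: eq_bigr => i _; rewrite mulN1r.
  by rewrite lincombZ xr scaler0.
- by have [i ri] := rn0; exists i; rewrite oppr_eq0.
- by exists i; rewrite // -oppr_gt0.
Qed.

Lemma frame_labelling K m (e : 'I_m -> 'cV[R]_n) r : cone_frame K e r ->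
  extreme_labelling K e.
Proof.
move=> fK; split; first exact: frame_extreme fK.
split=> [i _|i j _ _|F [v /(frame_extremeP fK) [i [l [l0 ->]]] ->]].
- by exists (e i) => //; exact: frame_extreme fK i.
- exact: (frame_Phi_inj fK).
- by exists i => //; rewrite (frame_PhiZ fK l0 (frame_Ke fK i)).
Qed.

End FramesOfMinimalCones.

(** * Every frame defines a minimal cone *)

Section MinimalConesOfFrames.
Variables (R : realType) (n : nat).
Implicit Types (K : set 'cV[R]_n) (w : 'I_n -> R).

Definition functional w (v : 'cV[R]_n) : R := \sum_k w k * v k 0.

Lemma functional_nbhs w x : 0 < functional w x ->
  \forall y \near x, 0 < functional w y.
Proof.
move=> wx; pose s := 1 + \sum_k `|w k|.
have s0 : 0 < s by rewrite ltr_pwDl // sumr_ge0.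
apply/nbhs_ballP; exists (functional w x / s); first by rewrite /= divr_gt0.
move=> y [_ xy]; have : functional w x - functional w y < functional w x; last by lra.
rewrite /functional -sumrB; under eq_bigr do rewrite -mulrBr.
apply: (@le_lt_trans _ _ (\sum_k `|w k| * (functional w x / s))).
  apply: ler_sum => k _; apply: le_trans (ler_norm _) _; rewrite normrM ler_wpM2l //.
  by have := xy k 0; rewrite /ball /= => /ltW.
rewrite -mulr_suml mulrCA -[ltRHS]mulr1 ltr_pM2l // ltr_pdivrMr // mul1r /s.
by rewrite ltrDr.
Qed.

Lemma functional_closure w K x : (forall y, K y -> 0 <= functional w y) ->
  closure K x -> 0 <= functional w x.
Proof.
move=> Kw clx; rewrite leNgt; apply/negP => wx.
have wN y : functional (fun k => - w k) y = - functional w y.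
  by rewrite /functional -sumrN; apply: eq_bigr => k _; rewrite mulNr.
have /functional_nbhs nx : 0 < functional (fun k => - w k) x by rewrite wN oppr_gt0.
have [y [Ky]] := clx _ nx; rewrite /= wN oppr_gt0 => wy.
by have := Kw y Ky; lra.
Qed.

Section Frame.
Variables (K : set 'cV[R]_n) (d : nat) (e : 'I_d.+1 -> 'cV[R]_n) (r : 'I_d.+1 -> R).
Hypothesis fK : cone_frame K e r.

Let M : 'M[R]_(d.+1, n) := \matrix_i (e i)^T.
(** A linear choice of coefficients for the vectors in the span of the generators; [defect] vanishes
    exactly on that span. *)
Let coef (v : 'cV[R]_n) (i : 'I_d.+1) : R := (v^T *m pinvmx M) 0 i.
Let defect (v : 'cV[R]_n) (k : 'I_n) : R := (v^T *m cokermx M) 0 k.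

Let coefE v i : coef v i = functional (fun k => pinvmx M k i) v.
Proof. by rewrite /coef mxE; apply: eq_bigr => k _; rewrite mxE mulrC. Qed.

Let defectE v i : defect v i = functional (fun k => cokermx M k i) v.
Proof. by rewrite /defect mxE; apply: eq_bigr => k _; rewrite mxE mulrC. Qed.

Let coef_defect v : (forall k, defect v k = 0) -> v = lincomb e (coef v).
Proof.
move=> dv; have vM : (v^T <= M)%MS.
  by rewrite submxE; apply/eqP/rowP => k; rewrite [RHS]mxE; exact: dv.
have := mulmxKpV vM; rewrite row_lincomb => /trmx_inj {1}<-.
by apply: eq_bigr.
Qed.

Let defect_lincomb c k : defect (lincomb e c) k = 0.
Proof.
have -> : lincomb e c = lincomb e ((\row_i c i) 0).
  by apply: eq_bigr => i _; rewrite mxE.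
by rewrite /defect -row_lincomb -mulmxA mulmx_coker mulmx0 mxE.
Qed.

Let coef_lincomb c : exists t, forall i, coef (lincomb e c) i = c i + t * r i.
Proof.
by apply: (frame_lincomb_eq fK); rewrite -coef_defect // => k; exact: defect_lincomb.
Qed.

(** Elimination of [t]: an index with [r i > 0] bounds it below by [- a i / r i], one with [r j < 0]
    bounds it above by [- a j / r j]. The witness is the largest lower bound. *)
Let feasible (a : 'I_d.+1 -> R) : (exists t, forall i, 0 <= a i + t * r i) <->
  (forall i, r i = 0 -> 0 <= a i) /\
  (forall i j, 0 < r i -> r j < 0 -> 0 <= a i / r i - a j / r j).
Proof.
split=> [[t Ht]|[H0 H]].
  split=> [i ri|i j ri rj]; first by have := Ht i; rewrite ri mulr0 addr0.
  have : 0 <= a i / r i + t.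
    have -> : a i / r i + t = (a i + t * r i) / r i by field; rewrite gt_eqF.
    by rewrite divr_ge0 // ltW.
  have : a j / r j + t <= 0.
    have -> : a j / r j + t = (a j + t * r j) / r j by field; rewrite lt_eqF.
    by rewrite mulr_ge0_le0 // invr_le0 ltW.
  lra.
have [p0 _ rp0] := frame_pos fK ord0.
have [p rp Hp] := @arg_minP _ _ _ p0 (fun i => 0 < r i) (fun i => a i / r i) rp0.
exists (- (a p / r p)) => i; have [ri|ri|ri] := ltgtP (r i) 0.
- have := H p i rp ri; have -> : a i + - (a p / r p) * r i =
    (- r i) * (a p / r p - a i / r i) by field; rewrite ?(lt_eqF ri) ?(gt_eqF rp).
  by apply: mulr_ge0; rewrite oppr_ge0 ltW.
- have := Hp i ri; have -> : a i + - (a p / r p) * r i =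
    r i * (a i / r i - a p / r p) by field; rewrite ?(gt_eqF ri) ?(gt_eqF rp).
  by move=> h; apply: mulr_ge0; rewrite ?subr_ge0 // ltW.
- by rewrite ri mulr0 addr0 H0.
Qed.

(** Finitely many linear equations and inequalities: closedness follows, and so does the relative
    interior, since the sum of all generators satisfies every inequality strictly. *)
Let halfspaces v : K v <-> [/\ forall k, defect v k = 0,
  forall i, r i = 0 -> 0 <= coef v i &
  forall i j, 0 < r i -> r j < 0 -> 0 <= coef v i / r i - coef v j / r j].
Proof.
split=> [/[dup] Kv /(frame_gen fK) [a a0 va]|[dv H0 H]].
  have dv k : defect v k = 0 by rewrite va defect_lincomb.
  move: Kv; rewrite {1}(coef_defect dv) => /(frame_lincombP fK)/feasible [H0 H].
  by split.
by rewrite (coef_defect dv); apply/(frame_lincombP fK)/feasible.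
Qed.

Let slackE v i j : coef v i / r i - coef v j / r j =
  functional (fun k => pinvmx M k i / r i - pinvmx M k j / r j) v.
Proof.
rewrite !coefE /functional !mulr_suml -sumrB; apply: eq_bigr => k _.
by rewrite mulrBl ![_ / _ * v k 0]mulrAC.
Qed.

Lemma frame_closed : closed K.
Proof.
move=> x clx; apply/halfspaces; split=> [k|i ri|i j ri rj].
- apply/eqP; rewrite eq_le; apply/andP; split.
    rewrite -oppr_ge0 defectE.
    have -> : - functional (fun l => cokermx M l k) x =
        functional (fun l => - cokermx M l k) x.
      by rewrite /functional -sumrN; apply: eq_bigr => l _; rewrite mulNr.
    apply: functional_closure clx => y /halfspaces [dy _ _].
    have -> : functional (fun l => - cokermx M l k) y = - defect y k.
      by rewrite defectE /functional -sumrN; apply: eq_bigr => l _; rewrite mulNr.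
    by rewrite dy oppr0.
  rewrite defectE; apply: functional_closure clx => y /halfspaces [dy _ _].
  by rewrite -defectE dy.
- rewrite coefE; apply: functional_closure clx => y /halfspaces [_ H _].
  by rewrite -coefE H.
- rewrite slackE; apply: functional_closure clx => y /halfspaces [_ _ H].
  by rewrite -slackE H.
Qed.

Lemma frame_relative_interior : \forall y \near lincomb e (fun=> 1),
  (forall k, defect y k = 0) -> K y.
Proof.
have [t Ht] := coef_lincomb (fun=> 1).
have n0 : \forall y \near lincomb e (fun=> 1), forall i, r i = 0 -> 0 <= coef y i.
  apply: (@filter_forall _ 'I_d.+1 (fun i y => r i = 0 ->
    0 <= coef y i) (nbhs (lincomb e (fun=> 1)))) => i.
  have [ri|ri] := eqVneq (r i) 0; last first.
    by apply: nearW => y ri'; rewrite ri' eqxx in ri.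
  have : 0 < functional (fun k => pinvmx M k i) (lincomb e (fun=> 1)).
    by rewrite -coefE Ht ri mulr0 addr0 ltr01.
  by move/functional_nbhs; apply: filterS => y; rewrite coefE => /ltW.
have n1 : \forall y \near lincomb e (fun=> 1), forall i j, 0 < r i -> r j < 0 ->
    0 <= coef y i / r i - coef y j / r j.
  apply: (@filter_forall _ 'I_d.+1 (fun i y => forall j, 0 < r i -> r j < 0 ->
    0 <= coef y i / r i - coef y j / r j) (nbhs (lincomb e (fun=> 1)))) => i.
  apply: (@filter_forall _ 'I_d.+1 (fun j y => 0 < r i -> r j < 0 ->
    0 <= coef y i / r i - coef y j / r j) (nbhs (lincomb e (fun=> 1)))) => j.
  have [ri|ri] := ltP 0 (r i); last by apply: nearW.
  have [rj|rj] := ltP (r j) 0; last by apply: nearW.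
  have : 0 < functional (fun k => pinvmx M k i / r i - pinvmx M k j / r j)
      (lincomb e (fun=> 1)).
    rewrite -slackE !Ht.
    have -> : (1 + t * r i) / r i - (1 + t * r j) / r j = (r i)^-1 - (r j)^-1.
      by field; rewrite ?(gt_eqF ri) ?(lt_eqF rj).
    have : 0 < (r i)^-1 by rewrite invr_gt0.
    have : (r j)^-1 < 0 by rewrite invr_lt0.
    lra.
  by move/functional_nbhs; apply: filterS => y; rewrite slackE => /ltW.
by apply: filterS2 n0 n1 => y H0 H1 dy; apply/halfspaces; split.
Qed.

(** Dropping one generator with nonzero coefficient in the relation leaves a basis of the span. *)
Lemma frame_span : exists V : {vspace 'cV[R]_n}, [/\ is_span K V, \dim V = d &
  forall y, y \in V -> forall k, defect y k = 0].
Proof.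
have [i0 _ ri0] := frame_pos fK ord0.
pose X := [tuple e (lift i0 k) | k < d].
have Xk (k : 'I_d) : X`_k = e (lift i0 k) by rewrite -tnth_nth tnth_mktuple.
have fX : free X.
  apply/freeP => k Hk i.
  have : lincomb e (fun j => if unlift i0 j is Some i then k i else 0) = 0.
    rewrite /lincomb (bigD1_ord i0) //= unlift_none scale0r add0r -[RHS]Hk.
    by apply: eq_bigr => j _; rewrite liftK Xk.
  move=> /(frame_ker fK) [t Ht]; have := Ht i0; rewrite unlift_none => /esym/eqP.
  rewrite mulf_eq0 (gt_eqF ri0) orbF => /eqP t0.
  by have := Ht (lift i0 i); rewrite liftK t0 mul0r.
have eX i : e i \in <<X>>%VS.
  have lX k : e (lift i0 k) \in <<X>>%VS.
    by apply/memv_span/tnthP; exists k; rewrite tnth_mktuple.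
  have [k ->|->] := unliftP i0 i; first exact: lX.
  have : lincomb e r = 0 by apply/(frame_ker fK); exists 1 => j; rewrite mul1r.
  rewrite /lincomb (bigD1_ord i0) //= => /eqP; rewrite addr_eq0 => /eqP E.
  have -> : e i0 = (r i0)^-1 *: (r i0 *: e i0).
    by rewrite scalerA mulVf ?scale1r // gt_eqF.
  by rewrite E memvZ // memvN memv_suml // => k _; rewrite memvZ.
exists <<X>>%VS; split.
- split=> [x /(frame_gen fK) [a _ ->]|W KW].
    by apply: memv_suml => i _; rewrite memvZ.
  by apply/span_subvP => x /tnthP [k ->]; rewrite tnth_mktuple; apply/KW/(frame_Ke fK).
- by move/eqP: fX; rewrite size_tuple.
- move=> y yX k; rewrite (coord_span yX).
  have -> : \sum_(i < d) coord X i y *: X`_i =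
      lincomb e (fun j => if unlift i0 j is Some i then coord X i y else 0).
    rewrite /lincomb (bigD1_ord i0) //= unlift_none scale0r add0r.
    by apply: eq_bigr => j _; rewrite liftK Xk.
  exact: defect_lincomb.
Qed.

Theorem frame_minimal_cone : minimal_cone d K.
Proof.
have [V [sV dV VD]] := frame_span; split; last first.
  apply: card_eq_trans (_ : [set: 'I_d.+1] #= `I_d.+1)%card; last first.
    by rewrite card_eq_sym; exact: card_II.
  rewrite card_eq_sym; have [_ be] := frame_labelling fK.
  by apply/card_set_bijP; exists (fun i => Phi K (e i)).
split; [exact: frame_cone fK|exact: frame_closed|exact: frame_pointed fK|].
exists V; split=> //; exists (lincomb e (fun=> 1)).
  by apply: (frame_K fK) => i; exact: ler01.
by apply: filterS frame_relative_interior => y Ky /VD.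
Qed.

End Frame.
End MinimalConesOfFrames.

(** * Decomposability and the relation *)

Section Decomposition.
Variables (R : realType) (n : nat).
Implicit Types (K : set 'cV[R]_n).

Lemma direct_sum_sym K K1 K2 : direct_sum K K1 K2 -> direct_sum K K2 K1.
Proof.
move=> [c1 c2 -> H]; split=> //.
  by apply/seteqP; split=> x [y [z [Hy Hz ->]]]; exists z, y; rewrite addrC.
move=> x1 x2 y1 y2 Hx1 Hx2 Hy1 Hy2; rewrite addrC [RHS]addrC => E.
by have [] := H _ _ _ _ Hx2 Hx1 Hy2 Hy1 E.
Qed.

Lemma direct_sum_sub K K1 K2 x : direct_sum K K1 K2 -> K1 x -> K x.
Proof.
by move=> [_ [K20 _ _] -> _] Kx; exists x, 0; rewrite addr0.
Qed.

Lemma direct_sum_face K K1 K2 : pointed_cone K -> direct_sum K K1 K2 -> face K K1.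
Proof.
move=> pK ds; have ds' := direct_sum_sym ds; have [c1 c2 E H] := ds.
split=> // [x|x y K1x Ky Kxy]; first exact: direct_sum_sub ds.
have [y1 [y2 [Hy1 Hy2 yE]]] : [set x | exists x1 x2, [/\ K1 x1, K2 x2 & x = x1 + x2]] y.
  by rewrite -E.
have [z1 [z2 [Hz1 Hz2 zE]]] :
    [set x | exists x1 x2, [/\ K1 x1, K2 x2 & x = x1 + x2]] (x - y) by rewrite -E.
have [K10 D1 _] := c1; have [K20 D2 _] := c2.
have [_ yz] : x = y1 + z1 /\ 0 = y2 + z2.
  apply: H => //; [exact: D1|exact: D2|].
  by rewrite addr0 addrACA -yE -zE addrC subrK.
have y20 : y2 = 0.
  apply: pK; first exact: direct_sum_sub ds' _.
  suff -> : - y2 = z2 by exact: direct_sum_sub ds' _.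
  by apply/eqP; rewrite eq_sym -addr_eq0 addrC -yz.
by rewrite yE y20 addr0.
Qed.

Lemma direct_sum_disjoint K K1 K2 x : direct_sum K K1 K2 -> K1 x -> K2 x -> x = 0.
Proof.
move=> [[K10 _ _] [K20 _ _] _ H] H1 H2.
by have [] := H x 0 0 x H1 K20 K10 H2 _; rewrite // addr0 add0r.
Qed.

Section Frame.
Variables (m : nat) (K : set 'cV[R]_n) (e : 'I_m -> 'cV[R]_n) (r : 'I_m -> R).
Hypothesis fK : cone_frame K e r.

Lemma frame_direct_sum K1 K2 i : direct_sum K K1 K2 -> K1 (e i) \/ K2 (e i).
Proof.
move=> ds; have ds' := direct_sum_sym ds; have [c1 c2 E H] := ds.
have : K (e i) := frame_Ke fK i.
rewrite E => -[y1 [y2 [Hy1 Hy2 eE]]].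
have cK := frame_cone fK; have [K0 KD KZ] := cK.
have Ky1 : K y1 := direct_sum_sub ds Hy1; have Ky2 : K y2 := direct_sum_sub ds' Hy2.
have : ray (e i) y1.
  rewrite -(frame_ray fK); apply/(PhiP _ cK (frame_Ke fK i)); split=> //.
  by exists 1; rewrite ?ltr01 // scale1r eE addrC addKr.
case=> l l0 y1E; have [l1|l1] := eqVneq l 0.
  by right; rewrite eE y1E l1 scale0r add0r.
left; have -> : e i = l^-1 *: y1 by rewrite y1E scalerA mulVf // scale1r.
by case: c1 => _ _; apply; rewrite ?invr_ge0.
Qed.

Lemma lincomb_restrict (P : pred 'I_m) a :
  \sum_(i | P i) a i *: e i = lincomb e (fun i => if P i then a i else 0).
Proof.
rewrite /lincomb big_mkcond; apply: eq_bigr => i _.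
by case: (P i); rewrite ?scale0r.
Qed.

(* The generators in [K1] would satisfy a relation of their own, which is a
   multiple of [r] only if all generators, or none, are in [K1]. *)
Lemma frame_indecomposable : (forall i, r i != 0) -> indecomposable K.
Proof.
move=> r0 [K1 [K2 [K1n0 K2n0 ds]]]; have ds' := direct_sum_sym ds.
have [c1 c2 E H] := ds; have [K10 D1 Z1] := c1; have [K20 D2 Z2] := c2.
pose P i := `[< K1 (e i) >].
have P2 i : ~~ P i -> K2 (e i).
  by move=> /asboolPn nP; case: (frame_direct_sum i ds).
have s1 (a : 'I_m -> R) : (forall i, 0 <= a i) -> K1 (\sum_(i | P i) a i *: e i).
  move=> a0; apply: convex_cone_sum => // i /asboolP Pi; exact: Z1.
have s2 (a : 'I_m -> R) : (forall i, 0 <= a i) -> K2 (\sum_(i | ~~ P i) a i *: e i).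
  by move=> a0; apply: convex_cone_sum => // i /P2 Pi; exact: Z2.
pose a i := Num.max (r i) 0; pose b i := Num.max (- r i) 0.
have a0 i : 0 <= a i by rewrite le_max lexx orbT.
have b0 i : 0 <= b i by rewrite le_max lexx orbT.
have ab i : r i = a i - b i.
  by rewrite /a /b; case: (leP (r i) 0); case: (leP (- r i) 0); lra.
have sumr : lincomb e r = 0 by apply/(frame_ker fK); exists 1 => i; rewrite mul1r.
have [E1 _] : \sum_(i | P i) a i *: e i = \sum_(i | P i) b i *: e i /\
    \sum_(i | ~~ P i) a i *: e i = \sum_(i | ~~ P i) b i *: e i.
  apply: H; [exact: s1|exact: s2|exact: s1|exact: s2|].
  rewrite -!(bigID P xpredT) /=; apply/eqP; rewrite -subr_eq0 -sumrB -[X in _ == X]sumr.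
  by apply/eqP; apply: eq_bigr => i _; rewrite -scalerBl -ab.
have /(frame_ker fK)[t Ht] : lincomb e (fun i => if P i then r i else 0) = 0.
  rewrite -lincomb_restrict; apply/eqP.
  move/eqP: E1; rewrite -subr_eq0 -sumrB; congr (_ == _).
  by apply: eq_bigr => i _; rewrite -scalerBl -ab.
have all1 K3 K4 : direct_sum K K3 K4 -> (forall i, K3 (e i)) -> K4 = [set 0].
  move=> ds3 H3; apply/seteqP; split=> [y K4y|y ->]; last by case: ds3 => _ [].
  have : K y by apply: direct_sum_sub (direct_sum_sym ds3) _.
  move=> /(frame_gen fK) [c c0 yE]; apply: (direct_sum_disjoint ds3 _ K4y).
  by rewrite yE; case: ds3 => -[? ? Z3] _ _ _; apply: convex_cone_sum => // i _; exact: Z3.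
have [t1|t1] := eqVneq t 1.
  apply: K2n0; apply: all1 ds _ => i; apply/asboolP.
  by have := Ht i; rewrite t1 mul1r -/(P i); case: (P i) => // /esym/eqP;
    rewrite (negPf (r0 i)).
apply: K1n0; apply: all1 ds' _ => i; apply: P2; apply/negP => Pi.
have /eqP := Ht i; rewrite Pi -{1}[r i]mul1r -subr_eq0 -mulrBl mulf_eq0 (negPf (r0 i)).
by rewrite orbF subr_eq0 eq_sym (negPf t1).
Qed.

Lemma ray_cone (x : 'cV[R]_n) : convex_cone (ray x).
Proof.
split; first by exists 0; rewrite ?scale0r.
  move=> _ _ [l l0 ->] [k k0 ->]; exists (l + k); first exact: addr_ge0.
  by rewrite scalerDl.
by move=> l _ l0 [k k0 ->]; exists (l * k); rewrite ?scalerA // mulr_ge0.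
Qed.

Definition other_generators (j : 'I_m) : set 'cV[R]_n :=
  [set x | exists2 a : 'I_m -> R, (forall i, 0 <= a i) /\ a j = 0 & x = lincomb e a].

(** The coefficient at [j] is unaffected by adding multiples of [r], so it is determined by the
    vector. *)
Lemma frame_ray_sum j : r j = 0 -> direct_sum K (ray (e j)) (other_generators j).
Proof.
move=> rj; split.
- exact: ray_cone.
- split.
  + exists (fun=> 0) => //; rewrite /lincomb big1 // => i _; exact: scale0r.
  + move=> _ _ [a [a0 aj] ->] [b [b0 bj] ->]; exists (fun i => a i + b i).
      by split=> [i|]; rewrite ?addr_ge0 // aj bj addr0.
    by rewrite lincombD.
  + move=> l _ l0 [a [a0 aj] ->]; exists (fun i => l * a i); last by rewrite lincombZ.
    by split=> [i|]; rewrite ?mulr_ge0 // aj mulr0.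
- apply/seteqP; split=> [x /(frame_gen fK) [a a0 ->]|_ [_ [_ [[l l0 ->] [a [a0 aj] ->] ->]]]].
    exists (a j *: e j), (lincomb e (fun i => if i != j then a i else 0)); split.
    + by exists (a j).
    + exists (fun i => if i != j then a i else 0) => //.
      by split=> [i|]; [case: ifP|rewrite eqxx].
    + by rewrite -lincomb_restrict /lincomb (bigD1 j).
  rewrite -[e j](lincomb_delta e) -lincombZ -lincombD; apply: (frame_K fK) => i.
  by rewrite addr_ge0 // mulr_ge0 // ler0n.
move=> _ _ _ _ [l l0 ->] [a [a0 aj] ->] [k k0 ->] [b [b0 bj] ->].
rewrite -[e j](lincomb_delta e) -!lincombZ -!lincombD => /(frame_lincomb_eq fK) [t Ht].
have lk : l = k.
  by have := Ht j; rewrite eqxx !mulr1 aj bj !addr0 rj mulr0 addr0.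
split; first by rewrite lk.
rewrite [LHS](_ : _ = lincomb e (fun i => b i + t * r i)); last first.
  apply: eq_bigr => i _; congr (_ *: _).
  by have := Ht i; rewrite lk -addrA => /addrI.
rewrite lincombD lincombZ.
have -> : lincomb e r = 0 by apply/(frame_ker fK); exists 1 => i; rewrite mul1r.
by rewrite scaler0 addr0.
Qed.

Lemma frame_decomposable (j : 'I_m) : r j = 0 -> decomposable K.
Proof.
move=> rj; exists (ray (e j)), (other_generators j); split; last exact: frame_ray_sum.
  move=> E; have : ray (e j) (e j) by exists 1; rewrite ?ler01 ?scale1r.
  by rewrite E => ej; have := frame_neq0 fK j; rewrite ej eqxx.
have [i ij _] := frame_pos fK j => E.
have : other_generators j (e i).
  exists (fun k => (k == i)%:R); last by rewrite lincomb_delta.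
  by split=> [k|]; rewrite ?ler0n // eq_sym (negPf ij).
by rewrite E => ei; have := frame_neq0 fK i; rewrite ei eqxx.
Qed.

End Frame.
End Decomposition.

(** * Balance, opposite sides and decomposability in terms of signs *)

Section Relations.
Variables (R : realType) (n m : nat).
Variables (K : set 'cV[R]_n) (e : 'I_m -> 'cV[R]_n) (r : 'I_m -> R).
Hypothesis fK : cone_frame K e r.

(** Each [u i] and [v j] is a positive multiple of a generator, so the given relation becomes a
    nonzero multiple [t] of [r]. A negative [t] means that the two sides are exchanged. *)
Lemma frame_relation p q (u : 'I_p -> 'cV[R]_n) (v : 'I_q -> 'cV[R]_n) :
  extreme_relation K u v ->
  exists (f : 'I_p -> 'I_m) (g : 'I_q -> 'I_m) (t : R), [/\ t != 0,
    injective f /\ injective g,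
    (forall i, exists2 l, 0 < l & u i = l *: e (f i)) /\
    (forall j, exists2 l, 0 < l & v j = l *: e (g j)),
    forall k, 0 < t * r k <-> exists i, f i = k &
    forall k, t * r k < 0 <-> exists j, g j = k].
Proof.
move=> [pq [ue ve] [du dv duv] [al [be [al0 be0 E]]]].
have Hu i : exists y : 'I_m * R, 0 < y.2 /\ u i = y.2 *: e y.1.
  by have /(frame_extremeP fK) [k [l H]] := ue i; exists (k, l).
have Hv i : exists y : 'I_m * R, 0 < y.2 /\ v i = y.2 *: e y.1.
  by have /(frame_extremeP fK) [k [l H]] := ve i; exists (k, l).
have [f Hf] := choice Hu; have [g Hg] := choice Hv => {Hu Hv}.
have same (k k' : 'I_m) (l l' : R) w w' : 0 < l' -> w = l *: e k -> w' = l' *: e k' ->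
    k = k' -> distinct_rays w w' -> False.
  move=> l0 -> -> -> [H _]; apply: (H (l / l')).
  by rewrite scalerA divfK // gt_eqF.
have fi : injective (fun i => (f i).1).
  move=> i j fij; apply/eqP/negPn/negP => ij.
  by have [_ E1] := Hf i; have [l0 E2] := Hf j;
    exact: (same _ _ _ _ _ _ l0 E1 E2 fij (du i j ij)).
have gi : injective (fun i => (g i).1).
  move=> i j fij; apply/eqP/negPn/negP => ij.
  by have [_ E1] := Hg i; have [l0 E2] := Hg j;
    exact: (same _ _ _ _ _ _ l0 E1 E2 fij (dv i j ij)).
have fg i j : (f i).1 <> (g j).1.
  by move=> fij; have [_ E1] := Hf i; have [l0 E2] := Hg j;
    exact: (same _ _ _ _ _ _ l0 E1 E2 fij (duv i j)).
pose c k := \sum_i (al i * (f i).2) * (k == (f i).1)%:R -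
  \sum_j (be j * (g j).2) * (k == (g j).1)%:R.
have sumf (s : nat) (h : 'I_s -> 'I_m * R) (a : 'I_s -> R) :
    lincomb e (fun k => \sum_i (a i * (h i).2) * (k == (h i).1)%:R) =
    \sum_i a i *: ((h i).2 *: e (h i).1).
  rewrite /lincomb; under eq_bigr do rewrite scaler_suml.
  rewrite exchange_big /=; apply: eq_bigr => i _.
  rewrite -[e (h i).1](lincomb_delta e) scalerA -lincombZ; apply: eq_bigr => k _.
  by [].
have /(frame_ker fK) [t Ht] : lincomb e c = 0.
  rewrite lincombB !sumf; apply/eqP; rewrite subr_eq0; apply/eqP.
  transitivity (\sum_i al i *: u i); first by apply: eq_bigr => i _; have [_ <-] := Hf i.
  by rewrite E; apply: eq_bigr => i _; have [_ <-] := Hg i.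
have cf i : c (f i).1 = al i * (f i).2.
  rewrite /c (bigD1 i) //= eqxx mulr1 big1 ?addr0 => [|j ji].
    rewrite big1 ?subr0 // => j _; case: eqP => [H|_]; last by rewrite mulr0.
    by case: (fg _ _ H).
  case: eqP => [H|_]; last by rewrite mulr0.
  by have := fi _ _ H => ij; rewrite ij eqxx in ji.
have cg i : c (g i).1 = - (be i * (g i).2).
  rewrite /c [X in _ - X](bigD1 i) //= eqxx mulr1 [X in _ - (_ + X)]big1 ?addr0 => [|j ji].
    rewrite big1 ?sub0r // => j _; case: eqP => [/esym H|_]; last by rewrite mulr0.
    by case: (fg _ _ H).
  case: eqP => [H|_]; last by rewrite mulr0.
  by have := gi _ _ H => ij; rewrite ij eqxx in ji.
have c0 k : (forall i, (f i).1 <> k) -> (forall i, (g i).1 <> k) -> c k = 0.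
  move=> nf ng; rewrite /c !big1 ?subr0 // => j _; case: eqP => [H|_]; rewrite ?mulr0 //.
    by case: (ng j).
  by case: (nf j).
have pf i : 0 < al i * (f i).2 by have [? _] := Hf i; rewrite mulr_gt0.
have pg i : 0 < be i * (g i).2 by have [? _] := Hg i; rewrite mulr_gt0.
exists (fun i => (f i).1), (fun j => (g j).1), t; split.
- apply/eqP => t0; have Hc k : c k = 0 by rewrite Ht t0 mul0r.
  have [p0|p0] := posnP p.
    have q0 : (0 < q)%N by rewrite p0 in pq.
    by have := pg (Ordinal q0); rewrite -oppr_lt0 -cg Hc ltxx.
  by have := pf (Ordinal p0); rewrite -cf Hc ltxx.
- by [].
- by split=> i; [have [? ->] := Hf i; exists (f i).2|have [? ->] := Hg i; exists (g i).2].
- move=> k; rewrite -Ht; split=> [ck|[i <-]]; last by rewrite cf.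
  apply: contrapT => nf.
  have [[j jk]|ng] := pselect (exists j, (g j).1 = k).
    by move: ck; rewrite -jk cg oppr_gt0; have := pg j; lra.
  by move: ck; rewrite c0 ?ltxx // => i H; [apply: nf|apply: ng]; exists i.
- move=> k; rewrite -Ht; split=> [ck|[i <-]]; last by rewrite cg oppr_lt0.
  apply: contrapT => ng.
  have [[j jk]|nf] := pselect (exists j, (f j).1 = k).
    by move: ck; rewrite -jk cf; have := pf j; lra.
  by move: ck; rewrite c0 ?ltxx // => i H; [apply: nf|apply: ng]; exists i.
Qed.

Lemma frame_extreme_relation : 'I_m ->
  extreme_relation K (fun i : 'I_#|pos_set r| => e (enum_val i))
    (fun j : 'I_#|neg_set r| => e (enum_val j)).
Proof.
move=> i0; have dist i j : i != j -> distinct_rays (e i) (e j).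
  by move=> ij; split=> l; apply: (frame_distinct fK); rewrite // eq_sym.
split.
- by rewrite addn_gt0 (ltn_trans _ (frame_pos_card fK i0)).
- by split=> i; exact: frame_extreme fK _.
- split=> [i i' ii|i i' ii|i j]; apply: dist.
  + by apply: contra_neq ii => /enum_val_inj.
  + by apply: contra_neq ii => /enum_val_inj.
  have := enum_valP i; have := enum_valP j; rewrite !inE.
  by move=> H1 H2; apply/eqP => H; move: H1 H2; rewrite H; lra.
exists (fun i => r (enum_val i)), (fun i => - r (enum_val i)); split=> [i|i|].
- by have := enum_valP i; rewrite inE.
- by have := enum_valP i; rewrite inE oppr_gt0.
rewrite -(big_enum_val (fun i => r i *: e i)) -(big_enum_val (fun i => - r i *: e i)) /=.
rewrite (lincomb_restrict e) [RHS](lincomb_restrict e).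
apply/eqP; rewrite -subr_eq0 -lincombB; apply/eqP/(frame_ker fK); exists 1 => i.
by rewrite !inE mul1r; case: ltgtP => ri; rewrite ?subr0 ?sub0r ?opprK // ri.
Qed.

Definition balanced_signs : Prop :=
  (#|pos_set r| <= #|neg_set r|.+1)%N /\ (#|neg_set r| <= #|pos_set r|.+1)%N.

Lemma frame_relation_card p q (u : 'I_p -> 'cV[R]_n) (v : 'I_q -> 'cV[R]_n) :
  extreme_relation K u v ->
  (#|pos_set r| = p /\ #|neg_set r| = q) \/ (#|pos_set r| = q /\ #|neg_set r| = p).
Proof.
move=> /frame_relation [f [g [t [t0 [fi gi] _ Hf Hg]]]].
have cf : #|[set k | 0 < t * r k]%SET| = p.
  have -> : [set k | 0 < t * r k]%SET = [set f i | i : 'I_p]%SET.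
    apply/finset.setP => k; rewrite !inE; apply/idP/finset.imsetP.
      by move=> /Hf [i <-]; exists i.
    by move=> [i _ ->]; apply/Hf; exists i.
  by rewrite card_imset ?card_ord.
have cg : #|[set k | t * r k < 0]%SET| = q.
  have -> : [set k | t * r k < 0]%SET = [set g i | i : 'I_q]%SET.
    apply/finset.setP => k; rewrite !inE; apply/idP/finset.imsetP.
      by move=> /Hg [i <-]; exists i.
    by move=> [i _ ->]; apply/Hg; exists i.
  by rewrite card_imset ?card_ord.
have [tp|tn|tz] := ltgtP t 0; last by rewrite tz eqxx in t0.
  right; split; [rewrite -cg|rewrite -cf]; congr #|pred_of_set _|.
    by apply/finset.setP => k; rewrite !inE nmulr_rlt0.
  by apply/finset.setP => k; rewrite !inE nmulr_rgt0.
left; split; [rewrite -cf|rewrite -cg]; congr #|pred_of_set _|.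
  by apply/finset.setP => k; rewrite !inE pmulr_rgt0.
by apply/finset.setP => k; rewrite !inE pmulr_rlt0.
Qed.

Lemma frame_balanced (i0 : 'I_m) : balanced K <-> balanced_signs.
Proof.
split=> [[p [q [u [v [/frame_relation_card H pq qp]]]]]|[H1 H2]].
  by rewrite /balanced_signs; case: H => -[-> ->].
exists #|pos_set r|, #|neg_set r|; do 2 eexists.
by split; first exact: (frame_extreme_relation i0).
Qed.

Lemma frame_opposite_sides i j : opposite_sides K (e i) (e j) <-> r i * r j < 0.
Proof.
split=> [[p [q [u [v [/frame_relation [f [g [t [t0 _ [Hu Hv] Hf Hg]]]] [i' [j' H]]]]]]]|].
  have eq_e k k' l : e k = l *: e k' -> k = k'.
    move=> E; apply/eqP/negPn/negP => kk; exact: (frame_distinct fK kk E).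
  have [l1 _ E1] := Hu i'; have [l2 _ E2] := Hv j'.
  have tpos : 0 < t * t by rewrite -expr2 exprn_even_gt0.
  suff : (t * r i) * (t * r j) < 0 by rewrite mulrACA pmulr_rlt0.
  case: H => -[iE jE]; move: E1 E2; rewrite -iE -jE => /eq_e E1 /eq_e E2.
    by rewrite pmulr_rlt0; [apply/Hg; exists j'|apply/Hf; exists i'].
  by rewrite nmulr_rlt0; [apply/Hf; exists i'|apply/Hg; exists j'].
move=> rij; exists #|pos_set r|, #|neg_set r|; do 2 eexists.
split; first exact: (frame_extreme_relation i).
have [ri|ri|ri] := ltgtP (r i) 0; last by rewrite ri mul0r ltxx in rij.
  have ip : i \in neg_set r by rewrite inE.
  have jp : j \in pos_set r by rewrite inE -(nmulr_rlt0 _ ri).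
  exists (enum_rank_in jp j), (enum_rank_in ip i); right.
  by rewrite !enum_rankK_in.
have ip : i \in pos_set r by rewrite inE.
have jp : j \in neg_set r by rewrite inE -(pmulr_rlt0 _ ri).
exists (enum_rank_in ip i), (enum_rank_in jp j); left.
by rewrite !enum_rankK_in.
Qed.

Lemma frame_indecomposableP : indecomposable K <-> forall i, r i != 0.
Proof.
split=> [H i|]; last exact: frame_indecomposable fK.
by apply/eqP => ri; apply: H; exact: frame_decomposable fK _ ri.
Qed.

(* [r j = 0] means that the ray of [e j] is a direct summand; the other
   generators then span an indecomposable minimal cone. *)
Definition ray_sum_signs (j : 'I_m) : Prop :=
  [/\ r j = 0, forall i, i != j -> r i != 0 & balanced_signs].

Lemma ray_sum_signs_of_sum x K' : x != 0 -> direct_sum K (ray x) K' ->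
  indecomposable K' -> balanced K' -> exists j, ray_sum_signs j.
Proof.
move=> x0 ds iK' bK'; have ds' := direct_sum_sym ds; have pK := frame_pointed fK.
have [_ cK' _ uniq_sum] := ds; have [K'0 K'D K'Z] := cK'.
have fK' := direct_sum_face pK ds'.
have [j [k k0 ej]] : exists j, exists2 k, 0 < k & e j = k *: x.
  apply: contrapT => H; move/eqP: x0; apply.
  have allK' i : K' (e i).
    have [[l l0 E]|//] := frame_direct_sum fK i ds.
    have [l1|l1] := eqVneq l 0; first by have := frame_neq0 fK i; rewrite E l1 scale0r eqxx.
    by case: H; exists i, l => //; rewrite lt_neqAle eq_sym l1.
  have /(frame_gen fK) [a a0 E] : K x.
    by apply: direct_sum_sub ds _; exists 1; rewrite ?ler01 ?scale1r.
  apply: (direct_sum_disjoint ds); first by exists 1; rewrite ?ler01 ?scale1r.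
  by rewrite E; apply: convex_cone_sum => // i _; exact: K'Z.
have inK' i : i != j -> K' (e i).
  move=> ij; have [[l l0 E]|//] := frame_direct_sum fK i ds.
  case: (@frame_distinct _ _ _ _ _ _ fK i j (l / k) ij).
  by rewrite ej scalerA divfK // gt_eqF.
(* If [s j > 0], one side of the relation has a nonzero component in the ray while the other side
   lies in [K']. Stated for any [s] so as to apply to both [r] and its negative. *)
have rj (s : 'I_m -> R) : cone_frame K e s -> s j <= 0.
  move=> fs; rewrite leNgt; apply/negP => sj.
  have [E _] : (s j * k) *: x = 0 /\ lincomb e (fun i =>
    if (i != j) && (0 < s i) then s i else 0)
      = lincomb e (fun i => if (i != j) && (s i < 0) then - s i else 0).
    apply: uniq_sum.
    - by exists (s j * k); rewrite // mulr_ge0 // ltW.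
    - apply: convex_cone_sum => // i _; case: ifP => [/andP[ij si]|_].
        by apply: K'Z; [exact: ltW|exact: inK'].
      by rewrite scale0r.
    - by exists 0; rewrite ?scale0r.
    - apply: convex_cone_sum => // i _; case: ifP => [/andP[ij si]|_].
        by apply: K'Z; [rewrite oppr_ge0 ltW|exact: inK'].
      by rewrite scale0r.
    rewrite -scalerA -ej add0r -[e j](lincomb_delta e) -lincombZ -lincombD.
    apply/eqP; rewrite -subr_eq0 -lincombB; apply/eqP/(frame_ker fs); exists 1 => i.
    rewrite mul1r; have [->|ij] /= := eqVneq i j; first by rewrite mulr1 addr0 subr0.
    rewrite mulr0 add0r; case: ltgtP => si; rewrite ?subr0 ?sub0r ?opprK // si.
  by move/eqP: E; rewrite scaler_eq0 (negPf x0) orbF mulf_eq0 !gt_eqF.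
have rj0 : r j = 0.
  apply/eqP; rewrite eq_le rj //=.
  by have := rj _ (frame_opp fK); rewrite oppr_le0.
exists j; split=> // [i ij|].
  (* A second vanishing coefficient would split a ray off [K']. *)
  apply/eqP => ri; apply: iK'; exists (ray (e i)), (K' `&` other_generators e i).
  have [i' ii' ri'] := frame_pos fK i.
  have i'j : i' != j by apply/eqP => i'j; move: ri'; rewrite i'j rj0 ltxx.
  have [_ cO E uO] := frame_ray_sum fK ri.
  have sub : K' `<=` K by move=> y; exact: direct_sum_sub ds'.
  split.
  - move=> Ei; have : ray (e i) (e i) by exists 1; rewrite ?ler01 ?scale1r.
    by rewrite Ei => e0; have := frame_neq0 fK i; rewrite e0 eqxx.
  - move=> Ei; have : (K' `&` other_generators e i) (e i').
      split; first exact: inK'.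
      exists (fun k => (k == i')%:R); last by rewrite lincomb_delta.
      by split=> [h|]; rewrite ?ler0n // eq_sym (negPf ii').
    by rewrite Ei => e0; have := frame_neq0 fK i'; rewrite e0 eqxx.
  split.
  - exact: ray_cone.
  - have [G0 GD GZ] := cO; split=> //.
      by move=> y z [? ?] [? ?]; split; [exact: K'D|exact: GD].
    by move=> l y l0 [? ?]; split; [exact: K'Z|exact: GZ].
  - apply/seteqP; split=> [y K'y|_ [_ [z [[l l0 ->] [K'z _] ->]]]]; last first.
      by apply: K'D => //; apply: K'Z => //; exact: inK'.
    have : K y by exact: sub.
    rewrite E => -[y1 [y2 [Hy1 Hy2 yE]]]; exists y1, y2; split=> //; split=> //.
    have Ky1 : K y1 by apply: direct_sum_sub (frame_ray_sum fK ri) _.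
    have Ky2 : K y2 by apply: direct_sum_sub (direct_sum_sym (frame_ray_sum fK ri)) _.
    have [_ _ H] := fK'; apply: (H y) => //.
    by rewrite yE addrK.
  - by move=> x1 x2 y1 y2 H1 [_ H2] H3 [_ H4]; exact: uO.
(* [K'] is a face of [K], so a balanced relation of [K'] is one of [K]. *)
have ext v : extreme_vector K' v -> extreme_vector K v.
  move=> [K'v v0 Ev]; have Kv : K v by exact: direct_sum_sub ds' _.
  have cK := frame_cone fK.
  split=> //; rewrite -Ev; apply/seteqP; split=> y.
    move=> /(PhiP _ cK Kv) [Ky [l l0 Kl]].
    have [_ _ H] := fK'.
    have K'y : K' y.
      have K'l : K' (l *: y).
        by apply: (H v) => //; case: cK => _ _; apply=> //; exact: ltW.
      by rewrite -[y]scale1r -(mulVf (lt0r_neq0 l0)) -scalerA; apply: K'Z;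
        rewrite // invr_ge0 ltW.
    apply/(PhiP _ cK' K'v); split=> //; exists l => //.
    apply: (H v) => //; rewrite opprB addrC subrK.
    by case: cK => _ _; apply; [exact: ltW|].
  move=> /(PhiP _ cK' K'v) [K'y [l l0 K'l]]; apply/(PhiP _ cK Kv); split.
    exact: direct_sum_sub ds' _.
  by exists l => //; exact: direct_sum_sub ds' _.
apply/(frame_balanced j); have [p [q [u [v [[pq [ue ve] d E] H1 H2]]]]] := bK'.
exists p, q, u, v; split=> //; split=> //.
by split=> i; exact: ext.
Qed.

End Relations.

(** * Matrices with a given digraph *)

Section RaySum.
Variables (R : realType) (n d : nat).
Variables (K : set 'cV[R]_n) (e : 'I_d.+2 -> 'cV[R]_n) (r : 'I_d.+2 -> R).
Hypothesis fK : cone_frame K e r.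
Variable j : 'I_d.+2.
Hypothesis signs : ray_sum_signs r j.

Let e' (i : 'I_d.+1) := e (lift j i).
Let r' (i : 'I_d.+1) := r (lift j i).

Let lincomb_lift (c : 'I_d.+2 -> R) : c j = 0 ->
  lincomb e c = lincomb e' (fun i => c (lift j i)).
Proof. by move=> cj; rewrite /lincomb (bigD1_ord j) //= cj scale0r add0r. Qed.

Let extend (a : 'I_d.+1 -> R) (i : 'I_d.+2) : R :=
  if unlift j i is Some k then a k else 0.

Let lincomb_extend a : lincomb e' a = lincomb e (extend a).
Proof.
rewrite lincomb_lift /extend ?unlift_none //; apply: eq_bigr => i _.
by rewrite liftK.
Qed.

Lemma other_generators_frame : cone_frame (other_generators e j) e' r'.
Proof.
have [rj _ _] := signs; split.
- move=> x; split=> [[a [a0 aj] ->]|[a a0 ->]].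
    by exists (fun i => a (lift j i)); rewrite // lincomb_lift.
  exists (extend a); last exact: lincomb_extend.
  by split=> [i|]; rewrite /extend ?unlift_none //; case: unlift.
- move=> c; rewrite lincomb_extend (frame_ker fK); split=> -[t Ht]; exists t => i.
    by have := Ht (lift j i); rewrite /extend liftK.
  by rewrite /extend; case: unliftP => [k|] ->; rewrite ?rj ?mulr0 // Ht.
- move=> i0; have [i ii ri] := frame_pos fK (lift j i0).
  have [k ik|ij] := unliftP j i; last by move: ri; rewrite ij rj ltxx.
  by exists k; rewrite /r' -?ik //; apply: contra_neq ii => ki; rewrite ik ki.
- move=> i0; have [i ii ri] := frame_neg fK (lift j i0).
  have [k ik|ij] := unliftP j i; last by move: ri; rewrite ij rj ltxx.
  by exists k; rewrite /r' -?ik //; apply: contra_neq ii => ki; rewrite ik ki.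
Qed.

Lemma card_lift (A : {set 'I_d.+2}) : j \notin A ->
  #|[set i | lift j i \in A]%SET| = #|A|.
Proof.
move=> jA; rewrite -(card_imset _ (@lift_inj _ j)); congr #|pred_of_set _|.
apply/finset.setP => k; apply/finset.imsetP/idP => [[i]|kA].
  by rewrite inE => iA ->.
have [i ki|kj] := unliftP j k; last by rewrite -kj kA in jA.
by exists i; rewrite // inE -ki.
Qed.

Lemma ray_sum_of_signs_aux : exists (x : 'cV[R]_n) (d' : nat) (K' : set 'cV[R]_n),
  [/\ x != 0, minimal_cone d' K', indecomposable K', balanced K' &
      direct_sum K (ray x) K'].
Proof.
have fK' := other_generators_frame; have [rj rn0 bs] := signs.
exists (e j), d, (other_generators e j); split.
- exact: frame_neq0 fK j.
- exact: frame_minimal_cone fK'.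
- apply/(frame_indecomposableP fK') => i; apply: rn0.
  by rewrite eq_sym neq_lift.
- apply/(frame_balanced fK' ord0); move: bs; rewrite /balanced_signs.
  rewrite -(@card_lift (pos_set r)) -?(@card_lift (neg_set r)) ?inE ?rj ?ltxx //.
  suff [-> ->] : pos_set r' = [set i | lift j i \in pos_set r]%SET /\
    neg_set r' = [set i | lift j i \in neg_set r]%SET by [].
  by split; apply/finset.setP => i; rewrite !inE.
- exact: (frame_ray_sum fK rj).
Qed.

End RaySum.

Theorem ray_sum_of_signs (R : realType) n m (K : set 'cV[R]_n) (e : 'I_m -> 'cV[R]_n)
    (r : 'I_m -> R) j : cone_frame K e r -> ray_sum_signs r j ->
  exists (x : 'cV[R]_n) (d : nat) (K' : set 'cV[R]_n),
    [/\ x != 0, minimal_cone d K', indecomposable K', balanced K' &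
        direct_sum K (ray x) K'].
Proof.
case: m e r j => [|[|d]] e r j fK sj;
  [by case: j {sj}| |exact: ray_sum_of_signs_aux fK _ sj].
by have [i] := frame_pos fK j; rewrite (ord1 i) (ord1 j).
Qed.

(** * Nonnegative matrices compatible with the relation *)

Section Realization.
Variables (R : realType) (n m : nat).
Variables (K : set 'cV[R]_n) (e : 'I_m -> 'cV[R]_n) (r : 'I_m -> R).
Hypothesis fK : cone_frame K e r.

Local Notation closure_r := (face_closure (pos_set r) (neg_set r)).

Lemma frame_linear_extension (f : 'I_m -> 'cV[R]_n) : lincomb f r = 0 ->
  exists A : 'M[R]_n, forall i, A *m e i = f i.
Proof.
move=> fr; pose M := \matrix_i (e i)^T; pose F := \matrix_i (f i)^T.
exists (pinvmx M *m F)^T => i.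
have MF : M *m (pinvmx M *m F) = F.
  apply/eqP; rewrite -subr_eq0 mulmxA -{2}[F]mul1mx -mulmxBl; apply/eqP/row_matrixP => k.
  rewrite row_mul; set c := row k _.
  (* Replacing [M] by [M *m pinvmx M *m M] changes nothing, so [c] is a relation between the
     generators, hence a multiple of [r], which [f] satisfies too. *)
  have : c *m M = 0.
    by rewrite -row_mul mulmxBl mulmxKpV // mul1mx subrr row0.
  rewrite row_lincomb => /(congr1 trmx); rewrite trmxK trmx0 => /(frame_ker fK) [t Ht].
  rewrite row_lincomb row0.
  have -> : lincomb f (c 0) = lincomb f (fun i => t * r i).
    by apply: eq_bigr => l _; rewrite Ht.
  by rewrite lincombZ fr scaler0 trmx0.
apply: trmx_inj; rewrite trmx_mul trmxK.
have := congr1 (row i) MF; rewrite row_mul.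
by rewrite /M /F !rowK.
Qed.

Lemma lincomb_lincomb (w : 'I_m -> 'I_m -> R) (a : 'I_m -> R) :
  lincomb (fun i => lincomb e (w i)) a = lincomb e (fun j => \sum_i a i * w i j).
Proof.
rewrite /lincomb; under eq_bigr do rewrite scaler_sumr.
rewrite exchange_big /=; apply: eq_bigr => j _; rewrite scaler_suml.
by apply: eq_bigr => i _; rewrite scalerA.
Qed.

(* [w] is the nonnegative matrix of [A] with respect to the generators. *)
Lemma frame_realize (w : 'I_m -> 'I_m -> R) (l : R) : (forall i j, 0 <= w i j) ->
  (forall j, \sum_i r i * w i j = l * r j) ->
  exists2 A, preserves K A & forall i, A *m e i = lincomb e (w i).
Proof.
move=> w0 Hw; have [|A HA] := @frame_linear_extension (fun i => lincomb e (w i)).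
  by rewrite lincomb_lincomb; apply/(frame_ker fK); exists l.
exists A => // x /(frame_gen fK) [a a0 ->]; rewrite mulmx_lincomb.
apply: convex_cone_sum; first exact: frame_cone fK.
move=> i _; case: (frame_cone fK) => _ _; apply=> //.
by rewrite HA; exact: (frame_K fK).
Qed.

Lemma frame_matrix A : preserves K A -> exists (w : 'I_m -> 'I_m -> R) (l : R),
  [/\ forall i j, 0 <= w i j,
      forall i, successors K e A i = closure_r [set j | 0 < w i j]%SET &
      forall j, \sum_i r i * w i j = l * r j].
Proof.
move=> KA; have Hc i : exists c : 'I_m -> R, (forall j, 0 <= c j) /\ A *m e i = lincomb e c.
  by have /(frame_gen fK) [c c0 ->] := KA _ (frame_Ke fK i); exists c.
have [w Hw] := choice Hc; exists w.
have : lincomb e (fun j => \sum_i r i * w i j) = 0.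
  rewrite -lincomb_lincomb; have -> : (fun i => lincomb e (w i)) = (fun i => A *m e i).
    by apply/funext => i; have [_ ->] := Hw i.
  rewrite -mulmx_lincomb; have -> : lincomb e r = 0.
    by apply/(frame_ker fK); exists 1 => i; rewrite mul1r.
  by rewrite mulmx0.
move=> /(frame_ker fK) [l Hl]; exists l; split=> // i.
  by have [] := Hw i.
by have [c0 E] := Hw i; rewrite /successors E (supp_lincomb fK).
Qed.

(** Both sides of the relation have at least two elements, so a closure that adds something has at
    least three. In F1 and F2 out-degrees are at most two, and so the successors show the positive
    entries of the matrix. *)
Lemma face_closure_le2 (S : {set 'I_m}) : (#|closure_r S| <= 2)%N -> 'I_m ->
  S = closure_r S.
Proof.
move=> S2 i0; apply/eqP; rewrite eq_sym; apply/negPn/negP => nS; move/negP: nS; apply.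
have [S1|S1] := leqP #|S| 1.
  rewrite face_closure_small // (leq_ltn_trans S1) //.
    exact: frame_pos_card fK i0.
  exact: frame_neg_card fK i0.
by rewrite eq_sym finset.eqEcard face_closure_sub (leq_trans S2).
Qed.

End Realization.

(** * Signs forced by the digraph *)

Section SignCycles.
Variables (R : realType) (n : nat).
Hypothesis n3 : (2 < n)%N.
Implicit Types (s : nat -> R) (l : R).

(* The columns of a nonnegative matrix with digraph F1 or F2, each applied to
   the coefficients [s] of the relation; [q = 0] in the case of F1. *)
Record sign_cycle s l : Prop := SignCycle {
  cycle_succ : forall k, (1 < k < n)%N -> exists2 a, 0 < a & s k * a = l * s k.+1;
  cycle_last : exists2 a, 0 < a & s n * a = l * s 0%N;
  cycle_one : exists b c, [/\ 0 < b, 0 < c & s 0%N * b + s n * c = l * s 1%N];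
  cycle_two : exists p q, [/\ 0 < p, 0 <= q & s 1%N * p + s 0%N * q = l * s 2%N] }.

Lemma sign_cycle_opp s l : sign_cycle s l -> sign_cycle (fun k => - s k) l.
Proof.
move=> [H1 [a a0 H2] [b [c [b0 c0 H3]]] [p [q [p0 q0 H4]]]]; split.
- by move=> k /H1 [a' a'0 H]; exists a' => //; rewrite mulNr H mulrN.
- by exists a => //; rewrite mulNr H2 mulrN.
- by exists b, c; split=> //; rewrite !mulNr -opprD H3 mulrN.
- by exists p, q; split=> //; rewrite !mulNr -opprD H4 mulrN.
Qed.

Lemma index_cases k : (k <= n)%N -> [\/ k = 0%N, k = 1%N | (1 < k <= n)%N].
Proof. by case: k => [|[|k]] kn; [constructor 1|constructor 2|constructor 3]. Qed.

(** For positive [l] the sign at 2 is handed on along 3, ..., n, 0 and then to 1. Since a relation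
    has both signs, [l] turns out to be negative and the handing on alternates the signs. *)
Lemma sign_cycle_ge0 s l : sign_cycle s l -> 0 < l -> 0 <= s 2%N ->
  forall k, (k <= n)%N -> 0 <= s k.
Proof.
move=> [H1 [a a0 H2] [b [c [b0 c0 H3]]] _] l0 s2.
have tail k : (1 < k <= n)%N -> 0 <= s k.
  case/andP; elim: k => // k IH; rewrite ltnS leq_eqVlt => /predU1P[<-//|k2] kn.
  have [|t t0 E] := H1 k; first by rewrite k2.
  by rewrite -(pmulr_rge0 _ l0) -E pmulr_lge0 // IH // ltnW.
have s0 : 0 <= s 0%N.
  by rewrite -(pmulr_rge0 _ l0) -H2 pmulr_lge0 // tail // leqnn andbT ltnW.
move=> k /index_cases[->|->|] //; last exact: tail.
rewrite -(pmulr_rge0 _ l0) -H3; apply: addr_ge0; apply: mulr_ge0 => //; try exact: ltW.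
by apply: tail; rewrite leqnn andbT ltnW.
Qed.

Lemma sign_cycle_eq0 s l : sign_cycle s l -> l != 0 -> s 2%N = 0 ->
  forall k, (k <= n)%N -> s k = 0.
Proof.
move=> [H1 [a a0 H2] [b [c [b0 c0 H3]]] _] l0 s2.
have z x : l * x = 0 -> x = 0 by move/eqP; rewrite mulf_eq0 (negPf l0) => /eqP.
have tail k : (1 < k <= n)%N -> s k = 0.
  case/andP; elim: k => // k IH; rewrite ltnS leq_eqVlt => /predU1P[<-//|k2] kn.
  have [|t t0 E] := H1 k; first by rewrite k2.
  by apply: z; rewrite -E IH ?mul0r // ltnW.
have sn : s n = 0 by rewrite tail // leqnn andbT ltnW.
have s0 : s 0%N = 0 by apply: z; rewrite -H2 sn mul0r.
move=> k /index_cases[->|->|] //; last exact: tail.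
by apply: z; rewrite -H3 sn s0 !mul0r addr0.
Qed.

Lemma sign_cycle_degenerate s : sign_cycle s 0 -> forall k, (k <= n)%N -> s k = 0.
Proof.
move=> [H1 [a a0 H2] [b [c [b0 c0 H3]]] [p [q [p0 q0 H4]]]].
have z x y : 0 < y -> x * y = 0 * s 0%N -> x = 0.
  by move=> y0 /eqP; rewrite mul0r mulf_eq0 (gt_eqF y0) orbF => /eqP.
have sn : s n = 0 by exact: z a0 H2.
have s0 : s 0%N = 0.
  by apply: z b0 _; move: H3; rewrite sn !mul0r addr0.
have s1 : s 1%N = 0.
  by apply: z p0 _; move: H4; rewrite s0 !mul0r addr0.
move=> k /index_cases[->|->|] // /andP[k1]; rewrite leq_eqVlt => /predU1P[->//|kn].
have [|t t0 E] := H1 k; first by rewrite k1.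
by apply: z t0 _; rewrite E !mul0r.
Qed.

Lemma sign_cycle_alternates s l : sign_cycle s l ->
  (exists2 k, (k <= n)%N & 0 < s k) -> (exists2 k, (k <= n)%N & s k < 0) ->
  [/\ l < 0, s 2%N != 0, forall k, (1 < k < n)%N -> s k * s k.+1 < 0 & s n * s 0%N < 0].
Proof.
move=> cs [kp kpn sp] [kq kqn sq].
have l0 : l < 0.
  have [//|lp|lz] := ltgtP l 0; last first.
    by move: sp; rewrite (sign_cycle_degenerate (s := s)) -?lz ?ltxx.
  have [s2|s2] := leP 0 (s 2%N).
    by have := sign_cycle_ge0 cs lp s2 kqn; lra.
  have := sign_cycle_ge0 (sign_cycle_opp cs) lp; rewrite oppr_ge0 => /(_ (ltW s2) _ kpn).
  lra.
have s2 : s 2%N != 0.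
  by apply/eqP => /(sign_cycle_eq0 cs (ltr0_neq0 l0) )/(_ _ kpn) E; rewrite E ltxx in sp.
have step x y a : 0 < a -> x != 0 -> x * a = l * y -> x * y < 0 /\ y != 0.
  move=> a0 x0 E.
  have yE : y = l^-1 * a * x
    by rewrite -mulrA [a * x]mulrC E mulrA mulVf ?mul1r // ltr0_neq0.
  split; last first.
    by rewrite yE mulf_neq0 // mulf_neq0 ?invr_eq0 ?(ltr0_neq0 l0) ?(lt0r_neq0 a0).
  have -> : x * y = l^-1 * (a * x ^+ 2) by rewrite yE; ring.
  by rewrite nmulr_rlt0 ?invr_lt0 // mulr_gt0 // exprn_even_gt0.
case: cs => H1 [a a0 H2] _ _.
have tail k : (1 < k <= n)%N -> s k != 0.
  case/andP; elim: k => // k IH; rewrite ltnS leq_eqVlt => /predU1P[<-//|k2] kn.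
  have [|t t0 E] := H1 k; first by rewrite k2.
  by have [] := step _ _ _ t0 (IH k2 (ltnW kn)) E.
split=> // [k kn|].
  have [t t0 E] := H1 k kn; have [|//] := step _ _ _ t0 _ E.
  by apply: tail; case/andP: kn => -> /ltnW.
have [|//] := step _ _ _ a0 _ H2.
by rewrite tail // leqnn andbT ltnW.
Qed.

(** There are [n - 2] sign changes from 2 to n and one more from n to 0. *)
Lemma alternating_parity s : s 2%N != 0 ->
  (forall k, (1 < k < n)%N -> s k * s k.+1 < 0) -> s n * s 0%N < 0 ->
  0 < (-1) ^+ n.+1 * (s 2%N * s 0%N).
Proof.
move=> s2 H1 H2.
have sgs (x y : R) : x * y < 0 -> Num.sg y = - Num.sg x.
  by case: (ltgtP x 0) => [x0|x0|->]; rewrite ?mul0r ?ltxx //;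
    [rewrite nmulr_rlt0|rewrite pmulr_rlt0] => // y0; rewrite ?(gtr0_sg y0) ?(ltr0_sg y0)
      ?(gtr0_sg x0) ?(ltr0_sg x0) ?opprK.
have tail k : (1 < k <= n)%N -> Num.sg (s k) = (-1) ^+ k * Num.sg (s 2%N).
  case/andP; elim: k => // k IH; rewrite ltnS leq_eqVlt => /predU1P[<-|k2] kn.
    by rewrite sqrrN expr1n mul1r.
  have -> : Num.sg (s k.+1) = - Num.sg (s k) by apply: sgs; rewrite H1 ?k2.
  by rewrite IH ?(ltnW kn) // exprS mulN1r mulNr.
have sn : Num.sg (s n) = (-1) ^+ n * Num.sg (s 2%N) by rewrite tail // leqnn andbT ltnW.
rewrite -sgr_gt0 !sgrM (sgs _ _ H2) sn exprS mulN1r sgrN sgrX sgrN1.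
set y := Num.sg (s 2%N); set t := (-1) ^+ n.
have yy : y * y = 1 by rewrite -sgrM gtr0_sg // -expr2 exprn_even_gt0.
have tt : t * t = 1 by rewrite -exprMn mulrNN mulr1 expr1n.
have -> : - t * (y * - (t * y)) = (t * t) * (y * y) by ring.
by rewrite tt yy mulr1 ltr01.
Qed.

End SignCycles.

(** * Exponents of the digraphs F1 and F2 *)

Section DigraphsOfFrames.
Variables (R : realType) (n : nat).
Hypothesis n3 : (2 < n)%N.
Variables (K : set 'cV[R]_n) (x : 'I_n.+1 -> 'cV[R]_n) (r : 'I_n.+1 -> R).
Hypothesis fK : cone_frame K x r.
Hypothesis Ku : exists u : 'cV[R]_n, nbhs u K.
Variable A : 'M[R]_n.
Hypothesis KA : preserves K A.

Local Notation N := (successors K x A).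
Local Notation iterN := (face_iter (pos_set r) (neg_set r) N).

Local Notation o := (@inord n).
Let oK k : (k <= n)%N -> o k = k :> nat. Proof. by move=> kn; rewrite inordK. Qed.
Let oE (i : 'I_n.+1) : o i = i. Proof. exact: inord_val. Qed.

Let P1 : (1 < #|pos_set r|)%N := frame_pos_card fK ord0.
Let Q1 : (1 < #|neg_set r|)%N := frame_neg_card fK ord0.
Let dPQ := pos_neg_disjoint r.

Lemma opp_signE i j : ((i \in pos_set r) && (j \in neg_set r) ||
  (i \in neg_set r) && (j \in pos_set r)) = (r i * r j < 0).
Proof.
rewrite !inE; case: (ltgtP (r i) 0) => ri; rewrite ?ri ?mul0r ?ltxx //=.
  by rewrite nmulr_rlt0.
by rewrite orbF pmulr_rlt0.
Qed.

Lemma same_signE i j : ((i \in pos_set r) && (j \in pos_set r) ||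
  (i \in neg_set r) && (j \in neg_set r)) = (0 < r i * r j).
Proof.
rewrite !inE; case: (ltgtP (r i) 0) => ri; rewrite ?ri ?mul0r ?ltxx //=.
  by rewrite nmulr_rgt0.
by rewrite orbF pmulr_rgt0.
Qed.

Lemma digraph_sign_cycle : (forall i j, F1 i j -> j \in N i) ->
  (forall i j, j \in N i -> F2 i j) ->
  exists l, sign_cycle n (fun k => r (o k)) l /\
    (o 2 \notin N (o 0) -> exists2 p, 0 < p & r (o 1) * p = l * r (o 2)).
Proof.
move=> F1N NF2; have [w [l [w0 Nw Hw]]] := frame_matrix fK KA.
(* By [face_closure_le2] the successor sets are then exactly the supports of the rows of [w]. *)
have N2 i : (#|N i| <= 2)%N.
  have two (a b : 'I_n.+1) : N i \subset [set a; b]%SET -> (#|N i| <= 2)%N.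
    by move=> /subset_leq_card H; apply: leq_trans H _; rewrite finset.cards2;
      case: (_ != _).
  have [ei|ei] := eqVneq (i : nat) n.
    apply: (two (o 0) (o 1)); apply/fintype.subsetP => j /NF2.
    by rewrite /F2 /F1 !inE -!val_eqE /= !oK ?(ltnW (ltnW n3)) //;
      have := ltn_ord j; clear -n3 ei; lia.
  apply: (two (o i.+1) (o 2)); apply/fintype.subsetP => j /NF2.
  have li : (i < n)%N by rewrite ltn_neqAle ei -ltnS ltn_ord.
  by rewrite /F2 /F1 !inE -!val_eqE /= !oK ?(ltnW n3) //; clear -n3 li; lia.
have wN i j : (j \in N i) = (0 < w i j).
  have E : [set j | 0 < w i j]%SET = N i.
    by rewrite Nw; apply: (face_closure_le2 fK) => //; rewrite -Nw.
  by rewrite -E inE.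
have wz i j : j \notin N i -> w i j = 0.
  by rewrite wN -leNgt => H; apply/eqP; rewrite eq_le H w0.
have wF i j : ~~ F2 i j -> w i j = 0 by move=> H; apply: wz; apply: contra H => /NF2.
have wp i j : F1 i j -> 0 < w i j by move=> /F1N; rewrite wN.
have col j k : (forall i, i != k -> ~~ F2 i j) -> r k * w k j = l * r j.
  move=> H; rewrite -Hw (bigD1 k) //= big1 ?addr0 // => i ik.
  by rewrite wF ?mulr0 // H.
have n1 : (1 <= n)%N := ltnW (ltnW n3); have n2 : (2 <= n)%N := ltnW n3.
have col2 j k k' : k != k' -> (forall i, i != k -> i != k' -> ~~ F2 i j) ->
    r k * w k j + r k' * w k' j = l * r j.
  move=> kk H; rewrite -Hw (bigD1 k) //= (bigD1 k') 1?eq_sym //= big1 ?addr0 //.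
  by move=> i /andP[ik ik']; rewrite wF ?mulr0 // H.
exists l; split; first split.
- move=> k kn; exists (w (o k) (o k.+1)).
    by apply: wp; rewrite /F1 !oK; clear -kn; lia.
  apply: col => i; rewrite -val_eqE /F2 /F1 /= !oK; clear -kn n3; lia.
- exists (w (o n) (o 0)); first by apply: wp; rewrite /F1 !oK //=; clear; lia.
  by apply: col => i; rewrite -val_eqE /F2 /F1 /= !oK //; clear -n3; lia.
- exists (w (o 0) (o 1)), (w (o n) (o 1)); split.
  + by apply: wp; rewrite /F1 !oK //=; clear; lia.
  + by apply: wp; rewrite /F1 !oK //=; clear; lia.
  apply: col2 => [|i]; rewrite -!val_eqE /F2 /F1 /= !oK //; clear -n3; lia.
- exists (w (o 1) (o 2)), (w (o 0) (o 2)); split=> //.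
    by apply: wp; rewrite /F1 !oK //=; clear; lia.
  apply: col2 => [|i]; rewrite -!val_eqE /F2 /F1 /= !oK //; clear -n3; lia.
move=> n02; exists (w (o 1) (o 2)).
  by apply: wp; rewrite /F1 !oK //=; clear; lia.
rewrite -[LHS]addr0 -(mulr0 (r (o 0))) -(wz _ _ n02).
apply: col2 => [|i]; rewrite -!val_eqE /F2 /F1 /= !oK //; clear -n3; lia.
Qed.

(** F1 forces this with [s = 1]. F2 forces only [s = 2], because column 2 has two positive entries
    and leaves the coefficient at 1 free. *)
Definition alternates (s : nat) : Prop :=
  (forall k, (s <= k < n)%N -> r (o k) * r (o k.+1) < 0) /\ r (o n) * r (o 0) < 0.

Let exists_o (Q : 'I_n.+1 -> Prop) : (exists i, Q i) -> exists2 k, (k <= n)%N & Q (o k).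
Proof. by move=> [i Qi]; exists i; rewrite ?oE // -ltnS. Qed.

Let digraph_alternates l : sign_cycle n (fun k => r (o k)) l ->
  [/\ l < 0, r (o 2) != 0 & alternates 2].
Proof.
move=> cs; have [||l0 s2 H1 H2] := sign_cycle_alternates n3 cs.
- by apply: (exists_o (Q := fun i => 0 < r i)); have [i _ ri] := frame_pos fK ord0;
  exists i.
- by apply: (exists_o (Q := fun i => r i < 0)); have [i _ ri] := frame_neg fK ord0;
  exists i.
by split.
Qed.

Lemma alternates_parity : r (o 2) != 0 -> alternates 2 ->
  0 < (-1) ^+ n.+1 * (r (o 2) * r (o 0)).
Proof. by move=> s2 [H1 H2]; exact: (alternating_parity n3 (s := fun k => r (o k))). Qed.

Lemma F2_alternates : (forall i j, (j \in N i) = F2 i j) ->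
  r (o 2) != 0 /\ alternates 2.
Proof.
move=> NF; have [||l [/digraph_alternates [_ ? ?] _]] := digraph_sign_cycle => //.
  by move=> i j; rewrite NF /F2 => ->.
by move=> i j; rewrite NF.
Qed.

Lemma F1_alternates : (forall i j, (j \in N i) = F1 i j) ->
  r (o 2) != 0 /\ alternates 1.
Proof.
move=> NF; have [||l [/digraph_alternates [l0 s2 [H1 H2]]]] := digraph_sign_cycle.
- by move=> i j; rewrite NF.
- by move=> i j; rewrite NF /F2 => ->.
case=> [|p p0 E].
  by rewrite NF /F1 !oK ?(ltnW n3) //; clear -n3; lia.
split=> //; split=> // k /andP[k1 kn]; have [k2|k2] := ltnP 1 k.
  by apply: H1; rewrite k2.
have -> : k = 1%N by apply/eqP; rewrite eqn_leq k2.
have -> : r (o 1) = l * r (o 2) / p by rewrite -E mulfK ?gt_eqF.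
have -> : l * r (o 2) / p * r (o 2) = l * (r (o 2) ^+ 2 / p) by ring.
by rewrite nmulr_rlt0 // divr_gt0 // exprn_even_gt0.
Qed.

Lemma primitive_reach_full : primitive K A ->
  forall i, exists k, iterN k i = finset.setT.
Proof.
by move=> [_ [p _ /(positive_powerP fK KA p Ku) H]] i; exists p.
Qed.

Lemma exponent_le p q : is_exponent K A p -> (0 < q)%N ->
  (forall j, iterN q j = finset.setT) -> (p <= q)%N.
Proof.
by move=> [_ _ _ minp] q0 H; apply: minp => //; apply/(positive_powerP fK KA q Ku).
Qed.

Lemma exponent_gt p q j : is_exponent K A p -> iterN q j != finset.setT -> (q < p)%N.
Proof.
move=> [pA p0 /(positive_powerP fK KA p Ku) H _] nq; rewrite ltnNge.
apply: contra nq => pq; apply/eqP.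
exact: (face_iter_full P1 (primitive_reach_full pA) (H j) pq).
Qed.

Lemma F1_sub_primitive : (forall i j, F1 i j -> j \in N i) -> r (o 2) != 0 ->
  primitive K A.
Proof.
move=> F1N r2; have o2 : o 2 \in pos_set r :|: neg_set r.
  by rewrite !inE; move: r2; case: ltgtP.
have H := iter_reach_full n3 P1 Q1 dPQ F1N o2.
have [k Hk] := choice H; split=> //; exists (\sum_i k i).+1 => //.
apply/(positive_powerP fK KA _ Ku) => j; apply: (face_iter_full P1 H (Hk j)).
by rewrite (bigD1 j) //= -addnS leq_addr.
Qed.

Let timeE : (n * n.-1 = (n * n.-1).-1.+1)%N.
Proof. by rewrite prednK // muln_gt0 (ltn_trans _ n3) //=; case: (n) n3 => [|[]]. Qed.

(** Vertex 0 has the single successor 1 and so lags one step behind it. *)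
Let iterN_F1 k : (forall i j, (j \in N i) = F1 i j) -> iterN k.+1 (o 0) = iterN k (o 1).
Proof.
move=> NF; rewrite /face_iter iterSr {2}/face_step finset.big_set1.
have -> : N (o 0) = [set o 1]%SET.
  apply/finset.setP => j; rewrite NF /F1 inE -val_eqE /= !oK ?(ltnW (ltnW n3)) //.
  by clear -n3; lia.
by rewrite face_closure_small // finset.cards1.
Qed.

Let F1N_of (NF : forall i j, (j \in N i) = F1 i j) i j : F1 i j -> j \in N i.
Proof. by rewrite NF. Qed.

Let NF2_of (NF : forall i j, (j \in N i) = F1 i j) i j : j \in N i -> F2 i j.
Proof. by rewrite NF /F2 => ->. Qed.

Let iter_pos_full (H : forall i, exists k, iterN k i = finset.setT)
  (F1N : forall i j, F1 i j -> j \in N i) (j : 'I_n.+1) (j0 : (0 < j)%N) :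
  iterN (n * n.-1) j = finset.setT.
Proof. exact: (iter_full_pos n3 P1 Q1 dPQ F1N H j0). Qed.

Let ord_cases (j : 'I_n.+1) : j = o 0 \/ (0 < j)%N.
Proof.
case: (posnP j) => [j0|]; [left|by right].
by apply/val_inj; rewrite /= oK.
Qed.

(** By parity 0 and 2 have equal signs and 1 and 2 opposite ones, so 0 and 1 are opposite and vertex
    1 needs the full time [n * n.-1]; vertex 0 needs one step more. For even [n] the signs at 0 and
    1 agree, and both times drop by one. *)
Lemma F1_exponent_odd p : (forall i j, (j \in N i) = F1 i j) -> odd n ->
  is_exponent K A p -> p = (n * n.-1).+1.
Proof.
move=> NF no ep; have pr := primitive_reach_full (let: And4 h _ _ _ := ep in h).
have F1N := F1N_of NF.
apply/eqP; rewrite eqn_leq; apply/andP; split.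
  apply: exponent_le ep _ _ => // j; have [->|j0] := ord_cases j.
    by rewrite iterN_F1 //; apply: iter_pos_full => //; rewrite oK // ltnW // ltnW.
  exact: (face_iter_full P1 pr (iter_pos_full pr F1N j0)).
apply: (exponent_gt (j := o 0)) ep _; rewrite timeE iterN_F1 //.
have [r2 [H1 H2]] := F1_alternates NF.
apply: (iter_not_full_opp n3 (NF2_of NF)).
- by move=> k /andP[k1 kn]; rewrite opp_signE H1 // kn ltnW.
- by rewrite opp_signE.
rewrite opp_signE.
have a2 : alternates 2 by split=> // k /andP[k1 kn]; rewrite H1 // kn ltnW.
have := alternates_parity r2 a2; rewrite -signr_odd /= no /= expr0 mul1r.
have : r (o 1) * r (o 2) < 0 by apply: H1; rewrite (ltnW n3).
move=> r12 r20; suff : (r (o 0) * r (o 1)) * (r (o 2) ^+ 2) < 0.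
  by rewrite pmulr_llt0 // exprn_even_gt0.
have -> : r (o 0) * r (o 1) * r (o 2) ^+ 2 = (r (o 1) * r (o 2)) * (r (o 2) * r (o 0)) by ring.
by rewrite pmulr_llt0.
Qed.

Lemma F1_exponent_even p : (forall i j, (j \in N i) = F1 i j) -> ~~ odd n ->
  is_exponent K A p -> p = (n * n.-1)%N.
Proof.
move=> NF ne ep; have pr := primitive_reach_full (let: And4 h _ _ _ := ep in h).
have F1N := F1N_of NF; have [r2 [H1 H2]] := F1_alternates NF.
have a2 : alternates 2 by split=> // k /andP[k1 kn]; rewrite H1 // kn ltnW.
have r12 : r (o 1) * r (o 2) < 0 by apply: H1; rewrite (ltnW n3).
have s01 : 0 < r (o 0) * r (o 1).
  have := alternates_parity r2 a2; rewrite -signr_odd /= ne /= expr1 mulN1r oppr_gt0.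
  move=> r20; suff : 0 < (r (o 0) * r (o 1)) * (r (o 2) ^+ 2).
    by rewrite pmulr_lgt0 // exprn_even_gt0.
  have -> : r (o 0) * r (o 1) * r (o 2) ^+ 2 = (r (o 1) * r (o 2)) * (r (o 2) * r (o 0)) by ring.
  by rewrite nmulr_lgt0.
apply/eqP; rewrite eqn_leq; apply/andP; split.
  apply: exponent_le ep _ _ => [|j]; first by rewrite timeE.
  have [->|j0] := ord_cases j; last exact: iter_pos_full.
  rewrite timeE iterN_F1 //.
  by apply: (iter_full_same n3 P1 Q1 dPQ F1N); rewrite same_signE.
rewrite timeE; apply: (exponent_gt (j := o 0)) ep _.
have -> : (n * n.-1).-1 = (n * n.-1).-2.+1.
  by rewrite prednK //; case: (n) n3 => [|[|[|]]].
rewrite iterN_F1 //.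
apply: (iter_not_full_same n3 (NF2_of NF)).
- by move=> k /andP[k1 kn]; rewrite opp_signE H1 // kn ltnW.
- by rewrite opp_signE.
by rewrite opp_signE.
Qed.

Lemma F2_exponent_le p : (forall i j, (j \in N i) = F2 i j) ->
  is_exponent K A p -> (p <= n * n.-1)%N.
Proof.
move=> NF ep; have pr := primitive_reach_full (let: And4 h _ _ _ := ep in h).
have F1N i j : F1 i j -> j \in N i by rewrite NF /F2 => ->.
apply: exponent_le ep _ _ => [|j]; first by rewrite timeE.
have [->|j0] := ord_cases j; last exact: iter_pos_full.
apply: (iter_full_F2 n3 P1 Q1 dPQ F1N pr).
by rewrite NF /F2 /F1 !oK ?(ltnW n3) //=; clear; lia.
Qed.

(** Vertex 1 is slowest: it passes through the singletons 2, ..., n, and after one step the set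
    reached from 0 contains 2, the only successor of 1. With 0 and 1 on the same side vertex 1 fills
    up one step early. *)
Lemma F2_exponent_same p : (forall i j, (j \in N i) = F2 i j) ->
  0 < r (o 0) * r (o 1) -> is_exponent K A p -> (p < n * n.-1)%N.
Proof.
move=> NF s01 ep; have pr := primitive_reach_full (let: And4 h _ _ _ := ep in h).
have F1N i j : F1 i j -> j \in N i by rewrite NF /F2 => ->.
have full1 : iterN (n * n.-1).-1 (o 1) = finset.setT.
  by apply: (iter_full_same n3 P1 Q1 dPQ F1N); rewrite same_signE.
have t0 : (n * n.-1).-1 = (n * n.-1).-2.+1.
  by rewrite prednK //; case: (n) n3 => [|[|[|]]].
rewrite timeE ltnS; apply: exponent_le ep _ _ => [|j]; first by rewrite t0.
have from1 k : (0 < k <= n)%N -> iterN k.-1 (o 1) = [set o k]%SET.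
  case/andP; case: k => // k _; elim: k => // k IH kn.
  rewrite face_iterS IH ?(ltnW kn) // /face_step finset.big_set1.
  have -> : N (o k.+1) = [set o k.+2]%SET.
    apply/finset.setP => j'; rewrite NF /F2 /F1 inE -val_eqE /= !oK ?(ltnW kn) //.
    by have := ltn_ord j'; clear -kn; lia.
  by rewrite face_closure_small // finset.cards1.
have [->|j0] := ord_cases j.
  apply/eqP; rewrite -finset.subTset -full1 t0.
  have -> : iterN (n * n.-1).-2.+1 (o 1) = iterN (n * n.-1).-2 (o 2).
    rewrite /face_iter iterSr -/(iterN 0 (o 1)); congr iter.
    exact: (from1 2 (ltnW n3)).
  apply: (@face_iterD _ (pos_set r) (neg_set r) N 1); rewrite face_iterS.
  apply: (@mem_face_step _ _ _ _ _ (o 0)); first by rewrite finset.set11.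
  by rewrite NF /F2 /F1 !oK ?(ltnW n3) //=; clear; lia.
apply/eqP; rewrite -finset.subTset.
have jn : (j <= n)%N by rewrite -ltnS.
have <- : iterN ((n * n.-1).-1 + j.-1) (o 1) = finset.setT.
  by apply: (face_iter_full P1 pr full1); rewrite leq_addr.
by rewrite face_iter_addn from1 ?j0 // oE.
Qed.

Lemma F2_exponent_opp p : (forall i j, (j \in N i) = F2 i j) -> ~~ odd n ->
  r (o 0) * r (o 1) <= 0 -> is_exponent K A p -> p = (n * n.-1)%N.
Proof.
move=> NF ne s01 ep; apply/eqP; rewrite eqn_leq F2_exponent_le //=.
have F1N i j : F1 i j -> j \in N i by rewrite NF /F2 => ->.
have NF2 i j : j \in N i -> F2 i j by rewrite NF.
have [r2 a2] := F2_alternates NF; have [H1 H2] := a2.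
rewrite timeE; apply: (exponent_gt (j := o 1)) ep _.
have oppS k : (1 < k < n)%N -> (o k \in pos_set r) && (o k.+1 \in neg_set r) ||
    (o k \in neg_set r) && (o k.+1 \in pos_set r) by move=> kn; rewrite opp_signE H1.
have oppW : (o n \in pos_set r) && (o 0 \in neg_set r) ||
    (o n \in neg_set r) && (o 0 \in pos_set r) by rewrite opp_signE.
have r20 : r (o 0) * r (o 2) < 0.
  have := alternates_parity r2 a2.
  by rewrite -signr_odd /= ne /= expr1 mulN1r oppr_gt0 mulrC.
have [r1|r1] := eqVneq (r (o 1)) 0.
  apply: (iter_not_full_zero n3 NF2 oppS oppW).
    by rewrite opp_signE.
  by rewrite !inE r1 ltxx.
apply: (iter_not_full_opp n3 NF2 oppS oppW).
rewrite opp_signE lt_neqAle s01 andbT mulf_neq0 //.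
by apply: contraTneq r20 => ->; rewrite mul0r ltxx.
Qed.

End DigraphsOfFrames.

(** * Realizing alternating signs *)

Section SignRearrangement.
Variables (R : realType).

Lemma card_zero_signs m (r : 'I_m -> R) :
  #|[set i | r i == 0]%SET| = (m - (#|pos_set r| + #|neg_set r|))%N.
Proof.
have -> : [set i | r i == 0]%SET = ~: (pos_set r :|: neg_set r).
  by apply/finset.setP => i; rewrite !inE; case: ltgtP.
rewrite finset.cardsCs finset.setCK card_ord finset.cardsU.
have /eqP -> : pos_set r :&: neg_set r == finset.set0.
  by rewrite finset.setI_eq0; exact: pos_neg_disjoint.
by rewrite finset.cards0 subn0.
Qed.

Lemma sign_rearrangement m (r s : 'I_m -> R) :
  #|pos_set r| = #|pos_set s| -> #|neg_set r| = #|neg_set s| ->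
  exists2 f : 'I_m -> 'I_m, injective f & forall i, Num.sg (r (f i)) = Num.sg (s i).
Proof.
move=> Ep En.
have cnt (q : 'I_m -> R) (y : R) :
    count_mem y [tuple Num.sg (q i) | i < m] = #|[set i | Num.sg (q i) == y]%SET|.
  rewrite -sum1_count big_map big_enum_cond /= sum1_card.
  by apply: eq_card => i; rewrite !inE.
have /tuple_permP [f Hf] :
    perm_eq [tuple Num.sg (s i) | i < m] [tuple Num.sg (r i) | i < m].
  apply/allP => y; rewrite mem_cat => yin; apply/eqP; rewrite /= !cnt.
  have : y \in [:: 1; -1; 0].
    case/orP: yin => /mapP [i _ ->]; rewrite !inE;
      by case: sgrP; rewrite ?eqxx ?orbT.
  have p1 (q : 'I_m -> R) : [set i | Num.sg (q i) == 1]%SET = pos_set q.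
    by apply/finset.setP => i; rewrite !inE sgr_cp0.
  have n1 (q : 'I_m -> R) : [set i | Num.sg (q i) == -1]%SET = neg_set q.
    by apply/finset.setP => i; rewrite !inE sgr_cp0.
  have z1 (q : 'I_m -> R) : [set i | Num.sg (q i) == 0]%SET = [set i | q i == 0]%SET.
    by apply/finset.setP => i; rewrite !inE sgr_eq0.
  rewrite !inE => /or3P[] /eqP ->; rewrite ?p1 ?n1 ?z1 //.
  by rewrite !card_zero_signs Ep En.
exists f; first exact: perm_inj.
move=> i; have /(congr1 (fun t => tnth t i)) := val_inj Hf.
by rewrite !tnth_mktuple.
Qed.

Lemma frame_relabel n m (K : set 'cV[R]_n) (x : 'I_m -> 'cV[R]_n) r (f : 'I_m -> 'I_m) :
  injective f -> cone_frame K x r -> cone_frame K (x \o f) (r \o f).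
Proof.
move=> fi fK; have [g fg gf] : bijective f by exact: injF_bij.
have E a : lincomb x a = lincomb (x \o f) (a \o f).
  by rewrite /lincomb (reindex f) //; exists g => i _.
have E' a : lincomb (x \o f) a = lincomb x (a \o g).
  by rewrite E; apply: eq_bigr => i _; rewrite /= fg.
split.
- move=> y; rewrite (frame_gen fK); split=> -[a a0 ->].
    by exists (a \o f); rewrite // => i; exact: a0.
  by exists (a \o g); rewrite // => i; exact: a0.
- move=> c; rewrite E' (frame_ker fK); split=> -[t Ht]; exists t => i /=.
    by have := Ht (f i); rewrite /= fg.
  by rewrite Ht /= gf.
- move=> i0; have [i ii ri] := frame_pos fK (f i0); exists (g i); rewrite /= ?gf //.
  by apply: contra_neq ii => <-; rewrite gf.
- move=> i0; have [i ii ri] := frame_neg fK (f i0); exists (g i); rewrite /= ?gf //.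
  by apply: contra_neq ii => <-; rewrite gf.
Qed.

(** The cyclic successor maps the positive indices other than [i0] injectively to negative ones, and
    conversely. *)
Lemma cyclic_card_le m (r : 'I_m -> R) (i0 : 'I_m) :
  (forall i, i != i0 -> r i != 0 -> r i * r (ordS i) < 0) -> balanced_signs r.
Proof.
have half (q : 'I_m -> R) : (forall i, i != i0 -> q i != 0 -> q i * q (ordS i) < 0) ->
    (#|pos_set q| <= #|neg_set q|.+1)%N.
  move=> H; rewrite (finset.cardsD1 i0) -add1n; apply: leq_add; first by case: (_ \in _).
  rewrite -(card_imset _ (@ordS_inj m)); apply/subset_leq_card/fintype.subsetP => j.
  case/finset.imsetP => i; rewrite !inE => /andP[ii qi] ->.
  by have := H i ii; rewrite gt_eqF // => /(_ isT); rewrite pmulr_rlt0.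
move=> H; split; first exact: half.
have Ep : neg_set r = pos_set (fun i => - r i).
  by apply/finset.setP => i; rewrite !inE oppr_gt0.
have En : pos_set r = neg_set (fun i => - r i).
  by apply/finset.setP => i; rewrite !inE oppr_lt0.
rewrite Ep En; apply: half => i ii.
by rewrite oppr_eq0 mulrNN; exact: H.
Qed.

Section Alternating.
Variable n : nat.
Hypothesis n3 : (2 < n)%N.
Implicit Types (r : 'I_n.+1 -> R).
Local Notation o := (@inord n).

Let ordS_o (i : 'I_n.+1) : ordS i = if i == n :> nat then o 0 else o i.+1.
Proof.
apply/val_inj; rewrite /=; have := ltn_ord i; case: eqP => [->|/eqP ni] ii.
  by rewrite modnn inordK.
by rewrite inordK ?modn_small // ltn_neqAle ni.
Qed.

Let alternates_succ s r (i : 'I_n.+1) : alternates r s -> (s <= i)%N ->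
  r i * r (ordS i) < 0.
Proof.
move=> [H1 H2] si; rewrite ordS_o; case: eqP => [ni|/eqP ni].
  by rewrite -{1}[i]inord_val ni.
by rewrite -{1}[i]inord_val; apply: H1; rewrite si ltn_neqAle ni -ltnS ltn_ord.
Qed.

Lemma alternates1_balanced r : alternates r 1 -> balanced_signs r.
Proof.
move=> H; apply: (@cyclic_card_le _ _ (o 0)) => i; rewrite -val_eqE /= inordK // => i0 _.
by apply: alternates_succ H _; rewrite lt0n.
Qed.

Lemma alternates2_balanced r : alternates r 2 -> r (o 0) * r (o 1) <= 0 ->
  balanced_signs r.
Proof.
move=> H r01; have n1 : (1 <= n)%N := ltnW (ltnW n3).
(* The one index excepted from alternation is 0 if the coefficient after it vanishes, and 1
   otherwise. *)
have [r1|r1] := eqVneq (r (o 1)) 0.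
  apply: (@cyclic_card_le _ _ (o 0)) => i; rewrite -val_eqE /= inordK // => i0 ri.
  apply: alternates_succ H _; have [|i1] := leqP 2 i => // .
  have ei : i = o 1 by apply/val_inj; rewrite /= inordK //; clear -i0 i1; lia.
  by rewrite ei r1 eqxx in ri.
apply: (@cyclic_card_le _ _ (o 1)) => i; rewrite -val_eqE /= inordK // => i1 ri.
have [|i2] := leqP 2 i; first exact: alternates_succ.
have ei : i = o 0 by apply/val_inj; rewrite /= inordK //; clear -i1 i2; lia.
rewrite ordS_o ei inordK // (_ : (0%N == n) = false); last by clear -n3; lia.
rewrite lt_neqAle r01 andbT mulf_neq0 //.
by rewrite -ei.
Qed.

(** Model patterns: [alt] alternates from 1 through n to 0, and [alt0] has a zero at 1. *)
Let alt (i : 'I_n.+1) : R := if i == 0%N :> nat then - (-1) ^+ n else (-1) ^+ i.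
Let alt0 (i : 'I_n.+1) : R := if i == 1%N :> nat then 0 else alt i.

Let sq k : (-1) ^+ k * (-1) ^+ k = 1 :> R.
Proof. by rewrite -exprMn mulrNN mulr1 expr1n. Qed.

Let alt_step k : (-1) ^+ k * (-1) ^+ k.+1 < 0 :> R.
Proof. by rewrite exprS mulN1r mulrN sq oppr_lt0 ltr01. Qed.

Let alt_alternates : alternates alt 1.
Proof.
split=> [k /andP[k1 kn]|]; rewrite /alt ?inordK ?(ltnW kn) // ?ltnS ?(ltnW kn) //=.
  by rewrite gtn_eqF // alt_step.
by rewrite gtn_eqF ?(ltn_trans _ n3) // mulrN sq oppr_lt0 ltr01.
Qed.

Let alt0_alternates : alternates alt0 2.
Proof.
have [H1 H2] := alt_alternates; have n1 : (1 < n)%N := ltnW n3.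
split=> [k /andP[k1 kn]|]; rewrite /alt0 !inordK ?(ltnW kn) // ?ltnS ?(ltnW kn) //=.
  by rewrite gtn_eqF // (gtn_eqF (ltnW k1 : (1 < k.+1)%N)) H1 // kn ltnW.
by rewrite gtn_eqF.
Qed.

Let alt_neq0 i : alt i != 0.
Proof. by rewrite /alt; case: ifP; rewrite ?oppr_eq0 signr_eq0. Qed.

Lemma alternates_sg s r r' : (forall i, Num.sg (r i) = Num.sg (r' i)) ->
  alternates r' s -> alternates r s.
Proof.
move=> E; have sgM i j : r' i * r' j < 0 -> r i * r j < 0.
  by rewrite -sgr_lt0 sgrM -!E -sgrM sgr_lt0.
by move=> [H1 H2]; split=> [k /H1 /sgM|]; [|exact: sgM].
Qed.

Let card_nonzero r : (forall i, r i != 0) -> (#|pos_set r| + #|neg_set r| = n.+1)%N.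
Proof.
move=> H; have := card_zero_signs r.
have -> : [set i | r i == 0]%SET = finset.set0.
  by apply/finset.setP => i; rewrite !inE (negPf (H i)).
rewrite finset.cards0 => /esym/eqP; rewrite subn_eq0 => n1.
apply/eqP; rewrite eqn_leq n1 andbT.
have := max_card (mem (pos_set r :|: neg_set r)); rewrite card_ord finset.cardsU.
have /eqP -> : pos_set r :&: neg_set r == finset.set0.
  by rewrite finset.setI_eq0; exact: pos_neg_disjoint.
by rewrite finset.cards0 subn0.
Qed.

Let card_one_zero r j : r j = 0 -> (forall i, i != j -> r i != 0) ->
  (#|pos_set r| + #|neg_set r| = n)%N.
Proof.
move=> rj H; have := card_zero_signs r.
have -> : [set i | r i == 0]%SET = [set j]%SET.
  apply/finset.setP => i; rewrite !inE; have [->|ij] := eqVneq i j;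
    first by rewrite rj eqxx.
  by rewrite (negPf (H i ij)).
by rewrite finset.cards1; lia.
Qed.

(** Two balanced patterns without zeros have the same numbers of signs up to exchanging the signs,
    and replacing [r] by its negative exchanges them. Equal numbers allow a relabelling. *)
Lemma balanced_alternates K (x : 'I_n.+1 -> 'cV[R]_n) r : cone_frame K x r ->
  (forall i, r i != 0) -> balanced_signs r ->
  exists (y : 'I_n.+1 -> 'cV[R]_n) (s : 'I_n.+1 -> R),
    cone_frame K y s /\ alternates s 1.
Proof.
move=> fK r0 [b1 b2]; have [c1 c2] := alternates1_balanced alt_alternates.
have cr := card_nonzero r0; have ca := card_nonzero alt_neq0.
have done q : cone_frame K x q -> #|pos_set q| = #|pos_set alt| ->
    #|neg_set q| = #|neg_set alt| ->
    exists (y : 'I_n.+1 -> 'cV[R]_n) (s : 'I_n.+1 -> R),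
    cone_frame K y s /\ alternates s 1.
  move=> fq Ep En; have [f fi Ef] := sign_rearrangement Ep En.
  exists (x \o f), (q \o f); split; first exact: frame_relabel.
  exact: alternates_sg Ef alt_alternates.
have [E|E] := eqVneq #|pos_set r| #|pos_set alt|.
  by apply: (done r) => //; clear -E cr ca; lia.
apply: (done (fun i => - r i)); first exact: frame_opp.
  have -> : pos_set (fun i => - r i) = neg_set r.
    by apply/finset.setP => i; rewrite !inE oppr_gt0.
  by move/eqP: E; clear -b1 b2 c1 c2 cr ca; lia.
have -> : neg_set (fun i => - r i) = pos_set r.
  by apply/finset.setP => i; rewrite !inE oppr_lt0.
by move/eqP: E; clear -b1 b2 c1 c2 cr ca; lia.
Qed.

Lemma ray_sum_alternates K (x : 'I_n.+1 -> 'cV[R]_n) r j : cone_frame K x r ->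
  ~~ odd n -> ray_sum_signs r j ->
  exists (y : 'I_n.+1 -> 'cV[R]_n) (s : 'I_n.+1 -> R),
    [/\ cone_frame K y s, alternates s 2 & s (o 1) = 0].
Proof.
move=> fK ne [rj rn [b1 b2]]; have n1 : (1 <= n)%N := ltnW (ltnW n3).
have a01 : alt0 (o 1) = 0 by rewrite /alt0 inordK.
have [|c1 c2] := alternates2_balanced alt0_alternates; first by rewrite a01 mulr0.
have cr := card_one_zero rj rn.
have ca : (#|pos_set alt0| + #|neg_set alt0| = n)%N.
  apply: (card_one_zero a01) => i; rewrite /alt0 -val_eqE /= inordK // => /negPf ->.
  exact: alt_neq0.
(* An even number of nonzero coefficients in balance is split equally. *)
have [Ep En] : #|pos_set r| = #|pos_set alt0| /\ #|neg_set r| = #|neg_set alt0|.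
  by clear -b1 b2 c1 c2 cr ca ne; lia.
have [f fi Ef] := sign_rearrangement Ep En.
exists (x \o f), (r \o f); split; first exact: frame_relabel.
  exact: alternates_sg Ef alt0_alternates.
by apply/eqP; rewrite -sgr_eq0 /= Ef a01 sgr0.
Qed.

End Alternating.
End SignRearrangement.

(** * Matrices with digraph F1 or F2 *)

Section RealizedDigraphs.
Variables (R : realType) (n : nat).
Hypothesis n3 : (2 < n)%N.
Variables (K : set 'cV[R]_n) (x : 'I_n.+1 -> 'cV[R]_n) (r : 'I_n.+1 -> R).
Hypothesis fK : cone_frame K x r.
Hypothesis alt2 : alternates r 2.
Local Notation o := (@inord n).

Let oE (i : 'I_n.+1) k : i = k :> nat -> i = o k.
Proof. by move=> <-; rewrite inord_val. Qed.

Let oppr_div_gt0 (a b : R) : a * b < 0 -> 0 < - b / a.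
Proof.
move=> ab; have a0 : a != 0 by apply: contraTneq ab => ->; rewrite mul0r ltxx.
have -> : - b / a = - (a * b) / a ^+ 2 by field.
by rewrite divr_gt0 ?oppr_gt0 // exprn_even_gt0.
Qed.

(* The coefficients of the columns 1 and 2 are free up to one linear equation
   each; the other columns contain a single entry. *)
Lemma realize_digraph (a b c d : R) : 0 < a -> 0 < b -> 0 < d -> 0 <= c ->
  r (o 0) * a + r (o n) * b = - r (o 1) -> r (o 1) * d + r (o 0) * c = - r (o 2) ->
  (0 < c -> (3 < n)%N) ->
  exists2 A, preserves K A & forall i j, (j \in successors K x A i) =
    F1 i j || [&& 0 < c, i == 0%N :> nat & j == 2%N :> nat].
Proof.
move=> a0 b0 d0 c0 E1 E2 c3; have [H1 H2] := alt2.
have n1 : (1 <= n)%N := ltnW (ltnW n3); have n2 : (2 <= n)%N := ltnW n3.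
(* The multiplier of the relation is taken to be -1, so a column with a single entry has
   [- r j / r i], positive by alternation. *)
pose w (i j : 'I_n.+1) : R :=
  if j == 1%N :> nat then
    (if i == 0%N :> nat then a else if i == n :> nat then b else 0)
  else if j == 2%N :> nat then
    (if i == 1%N :> nat then d else if i == 0%N :> nat then c else 0)
  else if F1 i j then - r j / r i else 0.
have F1_opp (i j : 'I_n.+1) : j != 1%N :> nat -> j != 2%N :> nat -> F1 i j -> r i * r j < 0.
  move=> j1 j2 /or3P[/eqP ji|/andP[/eqP iE /eqP jE]|/andP[_ /eqP jE]]; last first.
  - by rewrite jE in j1.
  - by rewrite (oE iE) (oE jE).
  rewrite (oE ji) -{1}[i]inord_val; apply: H1.
  by have := ltn_ord j; clear -ji j1 j2; lia.
have w_ge0 i j : 0 <= w i j.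
  rewrite /w; case: ifP => [_|/negbT j1]; first by do 2?case: ifP => _; rewrite // ltW.
  case: ifP => [_|/negbT j2]; first by do 2?case: ifP => _; rewrite // ltW.
  by case: ifP => [/F1_opp H|//]; apply/ltW/oppr_div_gt0/H.
have wF i j : (0 < w i j) = F1 i j || [&& 0 < c, i == 0%N :> nat & j == 2%N :> nat].
  rewrite /w; case: ifP => [/eqP j1|/negbT j1].
    have -> : F1 i j = (i == 0%N :> nat) || (i == n :> nat).
      by rewrite /F1 j1 /=; have := ltn_ord i; clear; lia.
    rewrite j1 !andbF orbF; case: ifP => _; first by rewrite a0.
    by case: ifP => _; rewrite ?b0 ?ltxx.
  case: ifP => [/eqP j2|/negbT j2].
    have -> : F1 i j = (i == 1%N :> nat).
      by rewrite /F1 j2 /=; have := ltn_ord i; clear -n3; lia.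
    rewrite ?andbT; case: ifP => [/eqP->|_]; first by rewrite d0.
    by case: ifP => _; rewrite ?andbT ?andbF ?ltxx.
  rewrite !andbF orbF; case: ifP => [/F1_opp H|_]; last by rewrite ltxx.
  exact/oppr_div_gt0/H.
have wz i j : ~~ (0 < w i j) -> w i j = 0.
  by rewrite -leNgt => H; apply/eqP; rewrite eq_le H w_ge0.
have col (j k : 'I_n.+1) : (forall i, i != k -> ~~ (0 < w i j)) ->
    r k * w k j = - 1 * r j -> \sum_i r i * w i j = - 1 * r j.
  move=> H <-; rewrite (bigD1 k) //= big1 ?addr0 // => i ik.
  by rewrite wz ?mulr0 // H.
have col2 (j k k' : 'I_n.+1) : k != k' ->
    (forall i, i != k -> i != k' -> ~~ (0 < w i j)) ->
    r k * w k j + r k' * w k' j = - 1 * r j -> \sum_i r i * w i j = - 1 * r j.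
  move=> kk H <-; rewrite (bigD1 k) //= (bigD1 k') 1?eq_sym //= big1 ?addr0 //.
  by move=> i /andP[ik ik']; rewrite wz ?mulr0 // H.
have [|A KA HA] := frame_realize fK (l := -1) w_ge0.
  move=> j; have [j1|j1] := eqVneq (j : nat) 1%N.
    rewrite (oE j1); apply: (@col2 _ (o 0) (o n)).
    - by rewrite -val_eqE /= !inordK //; clear -n1; lia.
    - move=> i; rewrite -!val_eqE /= !inordK // => i0 iN.
      by rewrite /w inordK //= (negPf i0) (negPf iN) ltxx.
    rewrite mulN1r -E1 /w !inordK //= eqxx.
    by case: eqP => [nE|_] //; clear -nE n1; lia.
  have [j2|j2] := eqVneq (j : nat) 2%N.
    rewrite (oE j2); apply: (@col2 _ (o 1) (o 0)).
    - by rewrite -val_eqE /= !inordK.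
    - move=> i; rewrite -!val_eqE /= !inordK // => i1 i0.
      by rewrite /w inordK //= (negPf i1) (negPf i0) ltxx.
    by rewrite mulN1r -E2 /w !inordK.
  have single k : F1 k j -> (forall i, i != k -> ~~ F1 i j) ->
      \sum_i r i * w i j = - 1 * r j.
    move=> Fk H; apply: (@col _ k) => [i ik|].
      by rewrite wF negb_or H //= (negPf j2) !andbF.
    have rk0 : r k != 0.
      by have := F1_opp k j j1 j2 Fk; apply: contraTneq => ->; rewrite mul0r ltxx.
    by rewrite /w (negPf j1) (negPf j2) Fk; field.
  have [j0|j0] := eqVneq (j : nat) 0%N.
    apply: (@single (o n)) => [|i]; rewrite -?val_eqE /F1 /= inordK //;
      rewrite ?j0; have := ltn_ord j; clear -n3; lia.
  apply: (@single (o j.-1)) => [|i]; have := ltn_ord j; rewrite -?val_eqE /F1 /= => jn;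
    rewrite inordK; clear -j0 j1 j2 jn; lia.
exists A => // i j; rewrite /successors HA (supp_lincomb fK) //.
pose S := [set j | 0 < w i j]%SET; rewrite -/S.
(* The closure must not add arcs. It suffices that a row of [w] misses two vertices of opposite
   signs; for row 0 of F2 these are 3 and 4, which is why [0 < c] asks for [3 < n]. *)
have missing (k k' : 'I_n.+1) : k \notin S -> k' \notin S -> r k * r k' < 0 ->
    face_closure (pos_set r) (neg_set r) S = S.
  move=> kS k'S; rewrite -opp_signE => /orP[]/andP[kP k'P].
    exact: face_closure_id kP kS k'P k'S.
  exact: face_closure_id k'P k'S kP kS.
suff -> : face_closure (pos_set r) (neg_set r) S = S by rewrite inE wF.
have [/andP[c1 i0]|nc] := boolP ((0 < c) && (i == 0%N :> nat)).
  have n4 := c3 c1; apply: (missing (o 3) (o 4)); last by apply: H1; rewrite n4.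
    by rewrite inE wF /F1 (eqP i0) /= !inordK //; move: (0 < c) => bc; clear -n4; lia.
  by rewrite inE wF /F1 (eqP i0) /= !inordK //; move: (0 < c) => bc; clear -n4; lia.
have [iN|iN] := eqVneq (i : nat) n.
  apply: (missing (o 2) (o 3)); last by apply: H1; rewrite n3.
    by rewrite inE wF /F1 /= !inordK // iN; move: (0 < c) => bc; clear -n3; lia.
  by rewrite inE wF /F1 /= !inordK // iN; move: (0 < c) => bc; clear -n3; lia.
have S1 : S \subset [set o i.+1]%SET.
  apply/fintype.subsetP => k; rewrite !inE wF -val_eqE /F1 /=.
  rewrite inordK; last by rewrite ltnS ltn_neqAle iN -ltnS ltn_ord.
  by case/orP => [|/and3P[c1 i0 _]]; [have := ltn_ord k; clear -iN; lia|
    rewrite c1 i0 in nc].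
have {}S1 : (#|S| <= 1)%N by move: (subset_leq_card S1); rewrite finset.cards1.
by rewrite face_closure_small // (leq_ltn_trans S1) ?(frame_pos_card fK i) ?(frame_neg_card fK i).
Qed.

Lemma realize_F1 : alternates r 1 ->
  exists2 A, preserves K A & forall i j, (j \in successors K x A i) = F1 i j.
Proof.
move=> [H1 H2].
have r12 : r (o 1) * r (o 2) < 0 by apply: H1; rewrite (ltnW n3).
have r1 : r (o 1) != 0 by apply: contraTneq r12 => ->; rewrite mul0r ltxx.
have r0 : r (o 0) != 0 by apply: contraTneq H2 => ->; rewrite mulr0 ltxx.
have rn : r (o n) != 0 by apply: contraTneq H2 => ->; rewrite mul0r ltxx.
(* The coefficients at 0 and n have opposite signs. The one with the sign of [r (o 1)] contributes
   [r (o 1)] and the other [- 2 r (o 1)]. *)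
have [a [b [a0 b0 E]]] : exists a b, [/\ 0 < a, 0 < b &
    r (o 0) * a + r (o n) * b = - r (o 1)].
  have [r01|r01|/eqP] := ltgtP (r (o 0) * r (o 1)) 0; last first.
  - by rewrite mulf_eq0 (negPf r0) (negPf r1).
  - exists (r (o 1) / r (o 0)), (- (2 * r (o 1)) / r (o n)); split.
    + have -> : r (o 1) / r (o 0) = r (o 0) * r (o 1) / r (o 0) ^+ 2 by field.
      by rewrite divr_gt0 // exprn_even_gt0.
    + apply: oppr_div_gt0; rewrite mulrCA pmulr_rlt0 //.
      have : (r (o n) * r (o 1)) * r (o 0) ^+ 2 < 0.
        have -> : r (o n) * r (o 1) * r (o 0) ^+ 2 = (r (o n) * r (o 0)) * (r (o 0) * r (o 1)) by ring.
        by rewrite pmulr_llt0.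
      by rewrite pmulr_llt0 // exprn_even_gt0.
    by field; rewrite r0 rn.
  exists (- (2 * r (o 1)) / r (o 0)), (r (o 1) / r (o n)); split.
  - by apply: oppr_div_gt0; rewrite mulrCA pmulr_rlt0.
  - have : 0 < (r (o 1) / r (o n)) * (r (o n) * r (o 0)) ^+ 2.
      have -> : (r (o 1) / r (o n)) * (r (o n) * r (o 0)) ^+ 2 =
          (r (o n) * r (o 0)) * (r (o 0) * r (o 1)) by field.
      by rewrite nmulr_rgt0.
    by rewrite pmulr_lgt0 // exprn_even_gt0 // mulf_neq0.
  by field; rewrite r0 rn.
have [||A KA HA] := @realize_digraph a b 0 (- r (o 2) / r (o 1)) a0 b0
    (oppr_div_gt0 r12) (lexx 0) E _ _.
- by field.
- by rewrite ltxx.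
by exists A => // i j; rewrite HA ltxx orbF.
Qed.

Lemma realize_F2 : ~~ odd n -> r (o 2) != 0 -> r (o 1) = 0 ->
  exists2 A, preserves K A & forall i j, (j \in successors K x A i) = F2 i j.
Proof.
move=> ne r2 r1; have [H1 H2] := alt2.
have r0 : r (o 0) != 0 by apply: contraTneq H2 => ->; rewrite mulr0 ltxx.
have rn : r (o n) != 0 by apply: contraTneq H2 => ->; rewrite mul0r ltxx.
have r02 : r (o 0) * r (o 2) < 0.
  have := alternates_parity n3 r2 alt2.
  by rewrite -signr_odd /= ne /= expr1 mulN1r oppr_gt0 mulrC.
have c0 := oppr_div_gt0 r02; have b0 := oppr_div_gt0 H2.
have [|||A KA HA] := @realize_digraph 1 (- r (o 0) / r (o n))
    (- r (o 2) / r (o 0)) 1 ltr01 b0 ltr01 (ltW c0) _ _ _.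
- by rewrite r1; field.
- by rewrite r1; field.
- by move=> _; clear -n3 ne; move: n3; rewrite leq_eqVlt => /predU1P[nE|//];
  rewrite -nE in ne.
by exists A => // i j; rewrite HA /F2 c0.
Qed.

End RealizedDigraphs.

(** * The maximal exponent *)

Section MaximalExponents.
Variables (R : realType) (n : nat).
Hypothesis n3 : (2 < n)%N.
Implicit Types (K : set 'cV[R]_n) (A : 'M[R]_n).
Local Notation o := (@inord n).

Definition max_exponent : nat := if odd n then (n * n.-1).+1 else (n * n.-1)%N.

Lemma minimal_cone_nbhs K : minimal_cone n K -> exists u : 'cV[R]_n, nbhs u K.
Proof.
move=> [[_ _ _ [V [_ dV [u _ nu]]]] _]; exists u.
have Vfull : V = fullv by apply/eqP; rewrite eqEdim subvf dimvf /dim /= muln1 dV.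
by apply: filterS nu => y; apply; rewrite Vfull memvf.
Qed.

Lemma exponent_exists K A : primitive K A -> exists p, is_exponent K A p.
Proof.
move=> pA; have [_ [p p0 Hp]] := pA.
have ex : exists p, (0 < p)%N && `[< positive_power K A p >].
  by exists p; rewrite p0; apply/asboolP.
case: (ex_minnP ex) => q /andP[q0 /asboolP Hq] minq.
by exists q; split=> // k k0 Hk; apply: minq; rewrite k0; apply/asboolP.
Qed.

Lemma digraph_given_byP K (x : 'I_n.+1 -> 'cV[R]_n) r A (E : rel 'I_n.+1) :
  cone_frame K x r -> preserves K A ->
  digraph_given_by K A x E <-> forall i j, (j \in successors K x A i) = E i j.
Proof.
move=> fK KA; have arcP i j :
    ray_arc K A (Phi K (x i)) (Phi K (x j)) <-> j \in successors K x A i.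
  have KAx : K (A *m x i) by apply: KA; exact: frame_Ke fK i.
  split=> [[x' [y' [/(frame_extremeP fK) [k [l [l0 ->]]] _]]]|H].
    rewrite (frame_PhiZ fK l0 (frame_Ke fK k)) => /(frame_Phi_inj fK) <- <-.
    rewrite -scalemxAr (frame_PhiZ fK l0 KAx).
    by move=> H; apply/(Phi_e_sub fK).
  exists (x i), (x j); split=> //; try exact: frame_extreme fK _.
  by apply/(Phi_e_sub fK).
split=> [H i j|H i j]; last by rewrite arcP H.
by apply/idP/idP => [/arcP/H|/H/arcP].
Qed.

Lemma long_exponent_digraph K A p : minimal_cone n K -> is_exponent K A p ->
  (n.+1 + (n - 1) * (n - 2) < p)%N ->
  exists (x : 'I_n.+1 -> 'cV[R]_n) (r : 'I_n.+1 -> R),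
    [/\ extreme_labelling K x, cone_frame K x r &
    (forall i j, (j \in successors K x A i) = F1 i j) \/
    (forall i j, (j \in successors K x A i) = F2 i j)].
Proof.
move=> mK ep lp; have [x0 xl] := minimal_cone_labelling mK.
have [r0 fK] := minimal_cone_frame mK xl; have Ku := minimal_cone_nbhs mK.
have [[KA _] _ _ _] := ep; have [pA _ _ _] := ep.
have P1 := frame_pos_card fK ord0; have Q1 := frame_neg_card fK ord0.
have [v nv] : exists v, face_iter (pos_set r0) (neg_set r0) (successors K x0 A)
    (n.+1 + (n - 1) * (n - 2)) v != finset.setT.
  apply: contrapT => H; have : (p <= n.+1 + (n - 1) * (n - 2))%N.
    apply: (exponent_le fK Ku KA ep) => // j.
    by apply/eqP/negPn/negP => nj; apply: H; exists j.
  by rewrite leqNgt lp.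
have [s si Hs] := slow_digraph n3 (card_ord _) P1 Q1 (pos_neg_disjoint r0)
  (primitive_reach_full fK Ku KA pA) nv (successors_compatible fK KA).
have fKs := frame_relabel si fK.
exists (x0 \o s), (r0 \o s); split=> //; first exact: frame_labelling fKs.
have E i j : (j \in successors K (x0 \o s) A i) = (s j \in successors K x0 A (s i)).
  by rewrite !inE.
by case: Hs => Hs; [left|right] => i j; rewrite E Hs.
Qed.

(** The maximum exceeds the threshold by [n - 2] for odd and by [n - 3] for even [n], hence by just
    1 for [n = 3] and [n = 4]. *)
Lemma max_exponent_long p : (max_exponent <= p)%N -> (n.+1 + (n - 1) * (n - 2) < p)%N.
Proof.
apply: leq_trans; rewrite /max_exponent; case: ifP; clear -n3.
  by case: n n3 => [|[|[|k]]] // _ _; rewrite !subSS !subn0 /=; nia.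
by case: n n3 => [|[|[|[|k]]]] // _ _; rewrite !subSS !subn0 /=; nia.
Qed.

Lemma exponent_le_max K A p : minimal_cone n K -> is_exponent K A p ->
  (p <= max_exponent)%N.
Proof.
move=> mK ep; have Ku := minimal_cone_nbhs mK; have [[KA _] _ _ _] := ep.
rewrite leqNgt; apply/negP => lp; have lp' := max_exponent_long (ltnW lp).
have [x [r [xl fK HF]]] := long_exponent_digraph mK ep lp'.
move: lp; rewrite /max_exponent; case: ifP => [no|/negbT ne]; case: HF => NF.
- by rewrite -(F1_exponent_odd n3 fK Ku KA NF no ep) ltnn.
- by have := F2_exponent_le n3 fK Ku KA NF ep; clear; lia.
- by rewrite -(F1_exponent_even n3 fK Ku KA NF ne ep) ltnn.
- by have := F2_exponent_le n3 fK Ku KA NF ep; clear; lia.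
Qed.

(** The matrix sends each generator to a positive multiple [w i] of the sum of all generators, an
    interior vector. The weights make the positive and the negative part of the relation each
    contribute 1, so that it is annihilated. *)
Lemma primitive_exists K : minimal_cone n K -> exists A, primitive K A.
Proof.
move=> mK; have [x xl] := minimal_cone_labelling mK.
have [r fK] := minimal_cone_frame mK xl; have Ku := minimal_cone_nbhs mK.
have P1 := frame_pos_card fK ord0; have Q1 := frame_neg_card fK ord0.
have pn (k : nat) : (1 < k)%N -> 0 < k%:R :> R by move=> k1; rewrite ltr0n ltnW.
pose w (i : 'I_n.+1) : R := if 0 < r i then (r i * #|pos_set r|%:R)^-1
  else if r i < 0 then (- r i * #|neg_set r|%:R)^-1 else 1.
have w0 i : 0 < w i.
  rewrite /w; have [ri|ri|_] := ltgtP (r i) 0; last exact: ltr01.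
    by rewrite invr_gt0 mulr_gt0 ?pn // oppr_gt0.
  by rewrite invr_gt0 mulr_gt0 ?pn.
have sumw : \sum_i r i * w i = 0.
  have -> : \sum_i r i * w i = \sum_i (if i \in pos_set r then #|pos_set r|%:R^-1 else 0)
      - \sum_i (if i \in neg_set r then #|neg_set r|%:R^-1 else 0).
    rewrite -sumrB; apply: eq_bigr => i _; rewrite /w !inE.
    have := pn _ P1; have := pn _ Q1; set a := _%:R; set b := _%:R => a0 b0.
    have [ri|ri|ri] := ltgtP (r i) 0; last by rewrite ri mul0r subr0.
      by field; rewrite (lt_eqF ri) gt_eqF.
    by field; rewrite (gt_eqF ri) gt_eqF.
  have one (B : {set 'I_n.+1}) : (1 < #|B|)%N ->
      \sum_i (if i \in B then #|B|%:R^-1 else 0) = 1 :> R.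
    move=> B1; rewrite -big_mkcond /= sumr_const -[LHS]mulr_natr mulVf //.
    by rewrite gt_eqF // pn.
  by rewrite !one ?subrr.
have [||A KA HA] := @frame_realize _ _ _ _ _ _ fK (fun i _ => w i) 0.
- by move=> i _; exact: ltW.
- by move=> j; rewrite sumw mul0r.
exists A; split=> //; exists 1%N => //; apply/(positive_powerP fK KA _ Ku) => j.
rewrite /face_iter /= /face_step finset.big_set1 /successors HA.
rewrite (supp_lincomb fK); last by move=> i; exact: ltW.
have -> : [set _ | 0 < w j]%SET = [set: 'I_n.+1]%SET.
  by apply/finset.setP => i; rewrite !inE w0.
by apply/eqP; rewrite -finset.subTset face_closure_idem face_closure_sub.
Qed.

Lemma cone_exponent_exists K : minimal_cone n K ->
  exists2 g, is_cone_exponent K g & (g <= max_exponent)%N.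
Proof.
move=> mK; have [A pA] := primitive_exists mK; have [p ep] := exponent_exists pA.
have ex : exists p, `[< exists A, is_exponent K A p >].
  by exists p; apply/asboolP; exists A.
have bd q : `[< exists A, is_exponent K A q >] -> (q <= max_exponent)%N.
  by move=> /asboolP [B eB]; exact: exponent_le_max eB.
case: (ex_maxnP ex bd) => g /asboolP [B eB] maxg.
exists g; last exact: exponent_le_max eB.
split; first by exists B.
by move=> C q eC; apply: maxg; apply/asboolP; exists C.
Qed.

Lemma cone_exponent_of_max K A : minimal_cone n K ->
  is_exponent K A max_exponent -> is_cone_exponent K max_exponent.
Proof.
by move=> mK eA; split; [exists A|move=> B q eB; exact: exponent_le_max eB].
Qed.

Lemma cone_exponent_unique K g h : is_cone_exponent K g -> is_cone_exponent K h -> g = h.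
Proof.
move=> [[A eA] Hg] [[B eB] Hh]; apply/eqP; rewrite eqn_leq.
by rewrite (Hh A) // (Hg B).
Qed.

Lemma signs_exponent_F1 K (x : 'I_n.+1 -> 'cV[R]_n) r : minimal_cone n K ->
  cone_frame K x r -> alternates r 1 -> exists A, is_exponent K A max_exponent.
Proof.
move=> mK fK [H1 H2]; have Ku := minimal_cone_nbhs mK.
have a2 : alternates r 2 by split=> // k /andP[k1 kn]; rewrite H1 // kn ltnW.
have r2 : r (o 2) != 0.
  have : r (o 2) * r (o 3) < 0 by apply: H1; rewrite n3.
  by apply: contraTneq => ->; rewrite mul0r ltxx.
have [A KA NF] := realize_F1 n3 fK a2 (conj H1 H2).
have pA : primitive K A.
  by apply: (F1_sub_primitive n3 fK Ku KA) r2 => i j; rewrite NF.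
have [p ep] := exponent_exists pA; exists A; rewrite /max_exponent.
case: ifP => [no|/negbT ne].
  by rewrite -(F1_exponent_odd n3 fK Ku KA NF no ep).
by rewrite -(F1_exponent_even n3 fK Ku KA NF ne ep).
Qed.

Lemma balanced_exponent K : minimal_cone n K -> indecomposable K -> balanced K ->
  exists A, is_exponent K A max_exponent.
Proof.
move=> mK iK bK; have [x xl] := minimal_cone_labelling mK.
have [r fK] := minimal_cone_frame mK xl.
have [y [s [fy als]]] := balanced_alternates n3 fK
  ((frame_indecomposableP fK).1 iK) ((frame_balanced fK ord0).1 bK).
exact: signs_exponent_F1 fy als.
Qed.

Lemma ray_sum_exponent K (x : 'cV[R]_n) K' : ~~ odd n -> minimal_cone n K ->
  x != 0 -> direct_sum K (ray x) K' -> indecomposable K' -> balanced K' ->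
  exists A, is_exponent K A max_exponent.
Proof.
move=> ne mK x0 ds iK' bK'; have Ku := minimal_cone_nbhs mK.
have [z zl] := minimal_cone_labelling mK; have [r fK] := minimal_cone_frame mK zl.
have [j sj] := ray_sum_signs_of_sum fK x0 ds iK' bK'.
have [y [s [fy als s1]]] := ray_sum_alternates n3 fK ne sj.
have s2 : s (o 2) != 0.
  have [H1 _] := als; have : s (o 2) * s (o 3) < 0 by apply: H1; rewrite n3.
  by apply: contraTneq => ->; rewrite mul0r ltxx.
have [A KA NF] := realize_F2 n3 fy als ne s2 s1.
have pA : primitive K A.
  by apply: (F1_sub_primitive n3 fy Ku KA) s2 => i1 i2; rewrite NF /F2 => ->.
have [p ep] := exponent_exists pA; exists A; rewrite /max_exponent (negPf ne).
by rewrite -(F2_exponent_opp n3 fy Ku KA NF ne _ ep) // s1 mulr0.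
Qed.

(** Take the standard basis and one more vector chosen so that the relation has coefficients
    [(-1) ^+ i]. As [n] is at least 3, each sign occurs at least twice. *)
Lemma balanced_cone_exists :
  exists K, [/\ minimal_cone n K, indecomposable K & balanced K].
Proof.
pose r (i : 'I_n.+1) : R := (-1) ^+ i.
pose e (i : 'I_n.+1) : 'cV[R]_n := if unlift ord_max i is Some k then delta_mx k 0
  else - (r ord_max)^-1 *: \sum_k r (lift ord_max k) *: delta_mx k 0.
pose K : set 'cV[R]_n := [set x | exists2 a, (forall i, 0 <= a i) & x = lincomb e a].
have rn0 i : r i != 0 by rewrite /r signr_eq0.
have lincombE c : lincomb e c = \sum_k (c (lift ord_max k) -
    c ord_max / r ord_max * r (lift ord_max k)) *: delta_mx k 0.
  rewrite /lincomb (bigD1_ord ord_max) //= /e unlift_none scalerA scaler_sumr addrC.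
  rewrite -big_split; apply: eq_bigr => k _; rewrite liftK /= scalerA -scalerDl.
  by rewrite mulrN mulNr.
have rE k : (k <= n)%N -> r (o k) = (-1) ^+ k by move=> kn; rewrite /r inordK.
have fK : cone_frame K e r.
  split=> // [c|i0|i0].
  - rewrite lincombE; split=> [H|[t Ht]]; last first.
      apply: big1 => k _; rewrite !Ht (_ : _ - _ = 0) ?scale0r //.
      by field.
    exists (c ord_max / r ord_max) => i; have [k ->|->] := unliftP ord_max i; last first.
      by rewrite divfK.
    apply/eqP; rewrite -subr_eq0; apply/eqP; have /matrixP/(_ k 0) := H.
    rewrite summxE (bigD1 k) //= !mxE !eqxx mulr1 big1 ?addr0 // => l lk.
    by rewrite !mxE eq_sym (negPf lk) mulr0.
  - have [->|i00] := eqVneq i0 (o 0).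
      exists (o 2); first by rewrite -val_eqE /= !inordK // ltnW.
      by rewrite rE ?(ltnW n3) // sqrrN expr1n ltr01.
    by exists (o 0); [rewrite eq_sym|rewrite rE // expr0 ltr01].
  have [->|i01] := eqVneq i0 (o 1).
    exists (o 3); first by rewrite -val_eqE /= !inordK // ltnW // ltnW.
    by rewrite rE // exprS sqrrN expr1n mulr1 oppr_lt0 ltr01.
  exists (o 1); first by rewrite eq_sym.
  by rewrite rE ?(ltnW (ltnW n3)) // expr1 oppr_lt0 ltr01.
exists K; split; first exact: frame_minimal_cone fK.
  exact/(frame_indecomposableP fK).
apply/(frame_balanced fK ord0); apply: (@cyclic_card_le _ _ _ ord_max) => i.
rewrite -val_eqE /= => iN _.
have -> : r (ordS i) = (-1) ^+ i.+1.
  by rewrite /r /= modn_small // ltnS ltn_neqAle iN -ltnS ltn_ord.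
by rewrite /r exprS mulN1r mulrN -exprMn mulrNN mulr1 expr1n oppr_lt0 ltr01.
Qed.

Lemma max_cone_exponent : is_max_cone_exponent R n.+1 n max_exponent.
Proof.
split; last by move=> K; exact: cone_exponent_exists.
have [K [mK iK bK]] := balanced_cone_exists; exists K => //.
have [A eA] := balanced_exponent mK iK bK; exact: cone_exponent_of_max eA.
Qed.

Lemma exp_maximal_coneP K : minimal_cone n K ->
  exp_maximal_cone n.+1 K <-> exists A, is_exponent K A max_exponent.
Proof.
move=> mK; split=> [[M [[K1 mK1 eK1] HM] eK]|[A eA]]; last first.
  by exists max_exponent; [exact: max_cone_exponent|exact: cone_exponent_of_max eA].
have [[K2 mK2 eK2] HM'] := max_cone_exponent.
have [g eg gM] := HM _ mK2; have [h eh hM] := HM' _ mK1.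
have EM : M = max_exponent.
  apply/eqP; rewrite eqn_leq (cone_exponent_unique eK1 eh) hM /=.
  by rewrite (cone_exponent_unique eK2 eg) -(cone_exponent_unique eK1 eh).
by have [[A eA] _] := eK; exists A; rewrite -EM.
Qed.

Lemma exp_maximal_matrixP K A : minimal_cone n K -> exp_maximal_cone n.+1 K ->
  exp_maximal_matrix K A <-> is_exponent K A max_exponent.
Proof.
move=> mK /(exp_maximal_coneP mK) [B eB]; have gK := cone_exponent_of_max mK eB.
split=> [[g eg gg]|eA]; last by exists max_exponent.
by rewrite (cone_exponent_unique gK gg).
Qed.

Lemma digraph_isomorphicP K A (E : rel 'I_n.+1) : digraph_isomorphic_to K A E <->
  exists2 x : 'I_n.+1 -> 'cV[R]_n, extreme_labelling K x & digraph_given_by K A x E.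
Proof.
split=> [[f bf Hf]|[x [xe bx] Hx]]; last by exists (fun i => Phi K (x i)).
have [x xl fx] := extreme_labelling_of_bij bf; exists x => // i j.
by rewrite -!fx.
Qed.

Lemma alternates1_neq0 (r : 'I_n.+1 -> R) : alternates r 1 -> forall i, r i != 0.
Proof.
move=> [H1 H2] i; rewrite -[i]inord_val.
have [->|i0] := posnP i; first by apply: contraTneq H2 => ->; rewrite mulr0 ltxx.
have [->|iN] := eqVneq (i : nat) n; first by apply: contraTneq H2 => ->; rewrite mul0r ltxx.
have : r (o i) * r (o i.+1) < 0 by apply: H1; rewrite i0 ltn_neqAle iN -ltnS ltn_ord.
by apply: contraTneq => ->; rewrite mul0r ltxx.
Qed.

Lemma alternates2_neq0 (r : 'I_n.+1 -> R) : alternates r 2 ->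
  forall i, i != o 1 -> r i != 0.
Proof.
move=> [H1 H2] i; rewrite -[i]inord_val.
have [->|i0] := posnP i; first by move=> _; apply: contraTneq H2 => ->; rewrite mulr0 ltxx.
have [->|iN] := eqVneq (i : nat) n.
  by move=> _; apply: contraTneq H2 => ->; rewrite mul0r ltxx.
have [->|i1 _] := eqVneq (i : nat) 1%N; first by rewrite eqxx.
have i2 : (1 < i)%N by rewrite ltn_neqAle eq_sym i1.
have iln : (i < n)%N by rewrite ltn_neqAle iN -ltnS ltn_ord.
have : r (o i) * r (o i.+1) < 0 by apply: H1; rewrite i2.
by apply: contraTneq => ->; rewrite mul0r ltxx.
Qed.

(** F2 stays below the maximum for odd [n], and for even [n] when 0 and 1 are on the same side; the
    remaining cases are those listed. *)
Lemma maximal_exponent_digraph K A : minimal_cone n K ->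
  is_exponent K A max_exponent ->
  exists (x : 'I_n.+1 -> 'cV[R]_n) (r : 'I_n.+1 -> R), [/\ extreme_labelling K x,
    cone_frame K x r &
    [/\ forall i j, (j \in successors K x A i) = F1 i j & alternates r 1] \/
    [/\ ~~ odd n, forall i j, (j \in successors K x A i) = F2 i j, alternates r 2 &
      r (o 0) * r (o 1) <= 0]].
Proof.
move=> mK eA; have Ku := minimal_cone_nbhs mK; have [[KA _] _ _ _] := eA.
have [x [r [xl fK HF]]] := long_exponent_digraph mK eA (max_exponent_long (leqnn _)).
exists x, r; split=> //; case: HF => NF; [left|right].
  by have [_ al] := F1_alternates n3 fK KA NF.
have [_ al] := F2_alternates n3 fK KA NF.
have le := F2_exponent_le n3 fK Ku KA NF eA.
have ne : ~~ odd n by apply/negP => no; move: le; rewrite /max_exponent no ltnn.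
split=> //; rewrite leNgt; apply/negP => r01.
have := F2_exponent_same n3 fK Ku KA NF r01 eA.
by rewrite /max_exponent (negPf ne) ltnn.
Qed.

End MaximalExponents.

Theorem theorem5p3 (R : realType) (n : nat) (hn : (3 <= n)%N) :
  is_max_cone_exponent R n.+1 n
    (if odd n then (n ^ 2 - n + 1)%N else (n ^ 2 - n)%N)
  /\
  (odd n ->
    (forall K : set 'cV[R]_n, minimal_cone n K ->
      (exp_maximal_cone n.+1 K <-> indecomposable K /\ balanced K))
    /\
    (forall K : set 'cV[R]_n, minimal_cone n K -> exp_maximal_cone n.+1 K ->
      forall A : 'M[R]_n, primitive K A ->
        (exp_maximal_matrix K A <-> digraph_isomorphic_to K A (@F1 n.+1))))
  /\
  (~~ odd n ->
    (forall K : set 'cV[R]_n, minimal_cone n K ->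
      (exp_maximal_cone n.+1 K <->
        (indecomposable K /\ balanced K)
        \/
        (exists (x : 'cV[R]_n) (d : nat) (K' : set 'cV[R]_n),
          [/\ x != 0, minimal_cone d K', indecomposable K', balanced K' &
              direct_sum K (ray x) K'])))
    /\
    (forall K : set 'cV[R]_n, minimal_cone n K -> indecomposable K ->
      exp_maximal_cone n.+1 K ->
      forall A : 'M[R]_n, primitive K A ->
        (exp_maximal_matrix K A <->
          exists2 x : 'I_n.+1 -> 'cV[R]_n, extreme_labelling K x &
            digraph_given_by K A x (@F1 n.+1)
            \/
            (digraph_given_by K A x (@F2 n.+1) /\
             opposite_sides K (x (inord 0)) (x (inord 1)))))
    /\
    (forall K : set 'cV[R]_n, minimal_cone n K -> decomposable K ->
      exp_maximal_cone n.+1 K ->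
      forall A : 'M[R]_n, primitive K A ->
        (exp_maximal_matrix K A <-> digraph_isomorphic_to K A (@F2 n.+1)))).
Proof.
have F1_indecomposable (K : set 'cV[R]_n) (x : 'I_n.+1 -> 'cV[R]_n) (r : 'I_n.+1 -> R) :
    cone_frame K x r -> alternates r 1 -> indecomposable K /\ balanced K.
  move=> fK al; split; first exact/(frame_indecomposableP fK)/alternates1_neq0.
  exact/(frame_balanced fK ord0)/(alternates1_balanced al).
split; first have -> : (if odd n then (n ^ 2 - n + 1)%N else (n ^ 2 - n)%N) =
    max_exponent n.
- by rewrite /max_exponent -subn1 mulnBr muln1 mulnn addn1.
- exact: max_cone_exponent.
split=> [no|ne]; [split|split; [|split]].
- move=> K mK; rewrite (exp_maximal_coneP hn mK); split=> [[A eA]|[iK bK]].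
    have [x [r [_ fK [[_ al]|[]]]]] := maximal_exponent_digraph hn mK eA.
      exact: F1_indecomposable fK al.
    by rewrite no.
  exact: balanced_exponent.
- move=> K mK xK A pA; rewrite (exp_maximal_matrixP hn _ mK xK) digraph_isomorphicP.
  have [KA _] := pA; split=> [eA|[x xl xd]].
    have [x [r [xl fK [[NF _]|[]]]]] := maximal_exponent_digraph hn mK eA.
      by exists x => //; apply/(digraph_given_byP _ fK KA).
    by rewrite no.
  have [r fK] := minimal_cone_frame mK xl; have NF := (digraph_given_byP _ fK KA).1 xd.
  have [p ep] := exponent_exists pA; rewrite /max_exponent no.
  by rewrite -(F1_exponent_odd hn fK (minimal_cone_nbhs mK) KA NF no ep).
- move=> K mK; rewrite (exp_maximal_coneP hn mK); split.
    move=> [A eA]; have [x [r [_ fK [[_ al]|[_ _ al r01]]]]] :=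
      maximal_exponent_digraph hn mK eA; first by left; exact: F1_indecomposable fK al.
    have bs := alternates2_balanced hn al r01.
    (* Only the coefficient at 1 can vanish: if it does, its ray splits off, otherwise the cone is
       indecomposable. *)
    have [r1|r1] := eqVneq (r (inord 1)) 0.
      right; have sj : ray_sum_signs r (inord 1).
        by split=> //; exact: alternates2_neq0.
      exact: ray_sum_of_signs fK sj.
    left; split; last exact/(frame_balanced fK ord0).
    apply/(frame_indecomposableP fK) => i.
    by have [->//|] := eqVneq i (inord 1); exact: alternates2_neq0.
  move=> [[iK bK]|[x [d [K' [x0 _ iK' bK' ds]]]]]; first exact: balanced_exponent.
  exact: (ray_sum_exponent hn ne mK x0 ds iK' bK').
- move=> K mK iK xK A pA; rewrite (exp_maximal_matrixP hn _ mK xK).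
  have [KA _] := pA; have Ku := minimal_cone_nbhs mK; split=> [eA|[x xl xd]].
    have [x [r [xl fK [[NF _]|[_ NF al r01]]]]] := maximal_exponent_digraph hn mK eA.
      by exists x => //; left; apply/(digraph_given_byP _ fK KA).
    exists x => //; right; split; first by apply/(digraph_given_byP _ fK KA).
    apply/(frame_opposite_sides fK); rewrite lt_neqAle r01 andbT.
    by rewrite mulf_neq0 //; apply: (frame_indecomposableP fK).1 iK _.
  have [r fK] := minimal_cone_frame mK xl; have [p ep] := exponent_exists pA.
  rewrite /max_exponent (negPf ne); case: xd => [/(digraph_given_byP _ fK KA) NF|].
    by rewrite -(F1_exponent_even hn fK Ku KA NF ne ep).
  move=> [/(digraph_given_byP _ fK KA) NF /(frame_opposite_sides fK) r01].
  by rewrite -(F2_exponent_opp hn fK Ku KA NF ne (ltW r01) ep).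
move=> K mK dK xK A pA; rewrite (exp_maximal_matrixP hn _ mK xK) digraph_isomorphicP.
have [KA _] := pA; have Ku := minimal_cone_nbhs mK; split=> [eA|[x xl xd]].
  have [x [r [xl fK [[_ al]|[_ NF al r01]]]]] := maximal_exponent_digraph hn mK eA.
    by have [/(_ dK)] := F1_indecomposable _ _ _ fK al.
  by exists x => //; apply/(digraph_given_byP _ fK KA).
have [r fK] := minimal_cone_frame mK xl; have [p ep] := exponent_exists pA.
have NF := (digraph_given_byP _ fK KA).1 xd.
have [_ al] := F2_alternates hn fK KA NF.
(* Decomposability forces some coefficient to vanish, and F2 allows this at 1 only. *)
have r1 : r (inord 1) = 0.
  apply: contrapT => /eqP r1; have : indecomposable K by
    apply/(frame_indecomposableP fK) => i; have [->//|] := eqVneq i (inord 1);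
    exact: alternates2_neq0.
  exact.
rewrite /max_exponent (negPf ne).
rewrite -(F2_exponent_opp hn fK Ku KA NF ne _ ep) //.
by rewrite r1 mulr0.
Qed.
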